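(* Let $\mathfrak{o}$ be a compact discrete valuation ring (of arbitrary characteristic) of odd residue characteristic, with uniformiser $\pi$, let $\mathfrak{O}$ be its unramified quadratic extension, and let $\ell\in\mathbb{N}$. The matrices in $\mathfrak{gl}_3(\mathfrak{O}_\ell)$ listed below are $\mathsf{GL}_3(\mathfrak{O}_\ell)$-conjugate to anti-hermitian matrices, and every $\mathsf{GL}_3(\mathfrak{O}_\ell)$-similarity class in $\mathfrak{gl}_3(\mathfrak{O}_\ell)$ that meets $\mathfrak{gu}_3(\mathfrak{o}_\ell)$ contains exactly one of them; thus the list parametrises the set $\mathrm{Ad}(\mathsf{GU}_3(\mathfrak{o}))\backslash\mathfrak{gu}_3(\mathfrak{o}_\ell)$ of similarity classes (the class associated with a listed matrix being the intersection of its $\mathsf{GL}_3(\mathfrak{O}_\ell)$-similarity class with $\mathfrak{gu}_3(\mathfrak{o}_\ell)$). (i) $d\,\mathrm{Id}_3$, where $d\in\mathfrak{gu}_1(\mathfrak{o}_\ell)$; the associated unitary shadow has type $\mathcal{G}$. (ii) $d\,\mathrm{Id}_3+\pi^iD(a,0,0)$, where $0\le i<\ell$, $d\in\mathfrak{gu}_1(\mathfrak{o}_\ell)$ and $a\in\mathfrak{O}_{\ell-i}^\times$ with $a^\circ+a=0$; the associated unitary shadow has type $\mathcal{L}$. (iii) $d\,\mathrm{Id}_3+\pi^iD(a,0,0)+\pi^j\begin{bmatrix}0&0\\ 0&C\end{bmatrix}$, where $0\le i<j<\ell$, $d\in\varsigma(\mathfrak{gu}_1(\mathfrak{o}_j))$,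 $a\in\mathfrak{O}_{\ell-i}^\times$ with $a^\circ+a=0$, and $C\in\mathfrak{gl}_2(\mathfrak{O}_{\ell-j})$ is a companion matrix with characteristic polynomial $t^2+b_1t+b_0$ such that $b_1^\circ=-b_1$ and $b_0^\circ=b_0$; the associated unitary shadows have types $\mathcal{T}_1$, $\mathcal{T}_2$ or $\mathcal{M}$, depending on $C$. (iv) $d\,\mathrm{Id}_3+\pi^iC$, where $0\le i<\ell$, $d\in\varsigma(\mathfrak{gu}_1(\mathfrak{o}_i))$ and $C\in\mathfrak{gl}_3(\mathfrak{O}_{\ell-i})$ is a companion matrix with characteristic polynomial $t^3+c_2t^2+c_1t+c_0$ such that $c_k^\circ+(-1)^kc_k=0$ for $k\in\{0,1,2\}$; the associated unitary shadows have types $\mathcal{T}_1$, $\mathcal{T}_2$, $\mathcal{T}_3$, $\mathcal{M}$ or $\mathcal{N}$, depending on $C$. (v) $d'\,\mathrm{Id}_3+\pi^iE$, where $0\le i<\ell$, $d'\in\varsigma(\mathfrak{gu}_1(\mathfrak{o}_i))$ and $E\in\mathfrak{gl}_3(\mathfrak{O}_{\ell-i})$ is one of the following matrices: - (I) $E(\ell-i,0,0,c,d)$, where $c,d\in\mathfrak{gu}_1(\mathfrak{o}_{\ell-i})$ with $v(c)>0$; - (II) $E(\mu,a,b,c,d)$, where $1\le\mu<\ell-i$, $a,b\in\mathfrak{O}_{\ell-i}$ with $\mu=v(b)\le v(a)$ and $a^\circ+a=b^\circ-b=0$, $c\in\mathfrak{gu}_1(\mathfrak{o}_{\ell-i})$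 with $v(c)>0$ and $d\in\varsigma(\mathfrak{gu}_1(\mathfrak{o}_\mu))$; - (III$_1$) $E(\mu,a,b,c,d)$, where $1\le\mu<\ell-i$, $a,b\in\mathfrak{O}_{\ell-i}$ with $\mu=v(a)<v(b)$ and $a^\circ+a=b^\circ-b=0$, $c\in\mathfrak{gu}_1(\mathfrak{o}_{\ell-i})$ with $v(c)>0$ and $d\in\varsigma(\mathfrak{gu}_1(\mathfrak{o}_\mu))$; the associated unitary shadows in the subcases (I), (II), (III$_1$) have types $\mathcal{J}$, $\mathcal{M}$ and $\mathcal{N}$, respectively.
   Context: $\mathfrak{p}=\pi\mathfrak{o}$, $\mathfrak{P}=\pi\mathfrak{O}$, $\mathfrak{o}_\nu=\mathfrak{o}/\mathfrak{p}^\nu$, $\mathfrak{O}_\nu=\mathfrak{O}/\mathfrak{P}^\nu$; $\mathbf{k}$, $\mathbf{k}_2$ are the residue fields of $\mathfrak{o}$, $\mathfrak{O}$. Write $\mathfrak{O}=\mathfrak{o}[\delta]$ with $\delta^2\in\mathfrak{o}$ a non-square unit modulo $\mathfrak{p}$; $\circ$ is the non-trivial Galois automorphism of $\mathfrak{O}|\mathfrak{o}$, $(a+b\delta)^\circ=a-b\delta$, and also denotes the induced maps on $\mathfrak{O}_\nu$ and $\mathbf{k}_2$. For a matrix $A=(a_{ij})$, $A^\circ=(a_{ji}^\circ)_{ij}$; $A$ is anti-hermitian if $A^\circ=-A$. $\mathsf{GU}_n(R)=\{A\in\mathsf{GL}_n(R')\mid A^\circ A=\mathrm{Id}_n\}$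 and $\mathfrak{gu}_n(R)=\{A\in\mathfrak{gl}_n(R')\mid A^\circ+A=0\}$ for $(R,R')\in\{(\mathfrak{o},\mathfrak{O}),(\mathfrak{o}_\nu,\mathfrak{O}_\nu),(\mathbf{k},\mathbf{k}_2)\}$. Notation: $D(a,b,c)=\mathrm{diag}(a,b,c)$ and $E(m,a,b,c,d)=\begin{bmatrix} d & \pi^m & 0 \\ 0 & d & 1 \\ a & b & c+d \end{bmatrix}$. A companion matrix has entries $1$ at positions $(j+1,j)$, last column $(-c_0,\dots,-c_{n-1})^{\mathrm{tr}}$, and $0$ elsewhere. $v$ is the valuation; on $\mathfrak{O}_\nu$ it takes values in $\{0,\dots,\nu\}$ with $v(0)=\nu$. Representatives: for every $\nu\in\mathbb{N}_0$ choose representatives $\varsigma_0(\mathfrak{o}_\nu)\subset\mathfrak{o}$ of $\mathfrak{o}_\nu$ with $\varsigma_0(-a)=-\varsigma_0(a)$, and set $\varsigma(a_1+a_2\delta)=\varsigma_0(a_1)+\varsigma_0(a_2)\delta$ for $a_1,a_2\in\mathfrak{o}_\nu$, giving representatives $\varsigma(\mathfrak{O}_\nu)\subset\mathfrak{O}$ of $\mathfrak{O}_\nu$. For $\nu<\mu$ the set $\varsigma(\mathfrak{O}_\nu)$ is also regarded in $\mathfrak{O}_\mu$ by reduction; for $X$ over $\mathfrak{O}_{\ell-\nu}$, $\pi^\nu X$ denotes the (well-defined) reduction of $\pi^\nu\varsigma(X)$ modulo $\mathfrak{P}^\ell$. Unitary shadows: for $A\in\mathfrak{gu}_3(\mathfrak{o}_\ell)$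 let $\mathrm{sh}_{\mathsf{GU}}(A)$ and $\mathrm{sh}_{\mathfrak{gu}}(A)$ be the images modulo $\mathfrak{P}$ of the centralisers of $A$ in $\mathsf{GU}_3(\mathfrak{o})$ and $\mathfrak{gu}_3(\mathfrak{o})$; the unitary shadow of an $\mathrm{Ad}(\mathsf{GU}_3(\mathfrak{o}))$-class $\mathcal{C}$ is $\{(\mathrm{sh}_{\mathsf{GU}}(A),\mathrm{sh}_{\mathfrak{gu}}(A))\mid A\in\mathcal{C}\}$. It has a given type if it is represented by the pair of centralisers in $\mathsf{GU}_3(\mathbf{k})$ and $\mathfrak{gu}_3(\mathbf{k})$ of an element of $\mathfrak{gu}_3(\mathbf{k})$ whose minimal polynomial over $\mathbf{k}_2$ is of the form (with $\alpha,\alpha_i\in\mathfrak{gu}_1(\mathbf{k})$ unless said otherwise, differently named roots distinct): $\mathcal{G}$: $t-\alpha$; $\mathcal{L}$: $(t-\alpha_1)(t-\alpha_2)$; $\mathcal{J}$: $(t-\alpha)^2$; $\mathcal{T}_1$: $(t-\alpha_1)(t-\alpha_2)(t-\alpha_3)$; $\mathcal{T}_2$: $\prod_{i=1}^3(t-\alpha_i)$ with $\alpha_1\in\mathfrak{gu}_1(\mathbf{k})$, distinct $\alpha_2,\alpha_3\in\mathbf{k}_2$ and $\alpha_2=-\alpha_3^\circ$; $\mathcal{T}_3$: an irreducible cubic; $\mathcal{M}$: $(t-\alpha_1)(t-\alpha_2)^2$; $\mathcal{N}$: $(t-\alpha)^3$. *)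

(* Defs.v *)
From HB Require Import structures.
From mathcomp Require Import all_boot all_algebra.
From mathcomp Require Import ring.
From mathcomp Require Import boolp classical_sets functions topology.

Set Implicit Arguments.
Unset Strict Implicit.
Unset Printing Implicit Defensive.

Import GRing.Theory.
Local Open Scope classical_set_scope.
Local Open Scope ring_scope.

(* [R] with the pi-adic topology *)
Definition adic (R : comNzRingType) (pi : R) : Type := R.

Section AdicTopology.
Variables (R : comNzRingType) (pi : R).

HB.instance Definition _ := Choice.copy (adic pi) R.

Definition adic_open (U : set R) : Prop :=
  forall x, U x -> exists n, forall y, U (x + pi ^+ n * y).

Lemma adic_openT : adic_open setT.
Proof. by move=> x _; exists 0%N. Qed.

Lemma adic_openI : setI_closed adic_open.
Proof.
move=> U V oU oV x [/oU[m Um] /oV[n Vn]]; exists (m + n)%N => y; split.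
  by rewrite exprD -mulrA; apply: Um.
by rewrite exprD (mulrC (pi ^+ m)) -mulrA; apply: Vn.
Qed.

Lemma adic_open_bigU (I : Type) (f : I -> set R) :
  (forall i, adic_open (f i)) -> adic_open (\bigcup_i f i).
Proof.
by move=> fo x [i _ /fo[n fn]]; exists n => y; exists i => //; apply: fn.
Qed.

HB.instance Definition _ :=
  isOpenTopological.Build (adic pi) adic_openT adic_openI adic_open_bigU.

End AdicTopology.

Definition dvr_uniformiser (R : idomainType) (pi : R) : Prop :=
  [/\ pi != 0, pi \isn't a GRing.unit &
      forall x : R, x != 0 ->
        exists n, exists2 u : R, u \is a GRing.unit & x = u * pi ^+ n].

Record compact_dvr := CompactDVR {
  dvr_ring :> idomainType;
  unif : dvr_ring;
  unifP : dvr_uniformiser unif;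
  dvr_compact : compact [set: adic unif] }.

(* The quotient of a commutative ring by a principal ideal.  Properness is not
   required: for [a = 1] this is the zero ring, and it is needed below. *)
Section PrincipalQuotient.
Variables (R : comNzRingType) (a : R).

Definition principal : {pred R} := fun x => `[< exists y, x = a * y >].

Lemma principalP x : reflect (exists y, x = a * y) (x \in principal).
Proof. exact: asboolP. Qed.

Lemma principal_zmod_closed : zmod_closed principal.
Proof.
split; first by apply/principalP; exists 0; rewrite mulr0.
move=> x y /principalP[u ->] /principalP[v ->].
by apply/principalP; exists (u - v); rewrite mulrBr.
Qed.

HB.instance Definition _ :=
  GRing.isZmodClosed.Build R principal principal_zmod_closed.

Lemma principalMl x y : y \in principal -> x * y \in principal.
Proof.
by move=> /principalP[z ->]; apply/principalP; exists (x * z); rewrite mulrCA.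
Qed.

Definition pquot : Type := {ideal_quot principal}.

HB.instance Definition _ := GRing.Zmodule.on pquot.

Definition red (x : R) : pquot := (\pi_({ideal_quot principal}) x)%qT.
Definition qlift (x : pquot) : R := repr (x : {ideal_quot principal}).

Lemma qliftK : cancel qlift red. Proof. by move=> x; apply: reprK. Qed.

Lemma redP x y : reflect (red x = red y) (x - y \in principal).
Proof.
by rewrite (Quotient.idealrBE principal); apply: (iffP eqP).
Qed.

Lemma redD x y : red (x + y) = red x + red y.
Proof. by rewrite /red !piE. Qed.

Lemma red0 : red 0 = 0.
Proof. by rewrite /red !piE. Qed.

Lemma qlift_red x : qlift (red x) - x \in principal.
Proof. by apply/redP; rewrite qliftK. Qed.

Definition pquot_one : pquot := red 1.
Definition pquot_mul (x y : pquot) : pquot := red (qlift x * qlift y).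

Lemma pquot_mulE x y : pquot_mul (red x) (red y) = red (x * y).
Proof.
apply/redP.
have -> : qlift (red x) * qlift (red y) - x * y =
    qlift (red x) * (qlift (red y) - y) + y * (qlift (red x) - x).
  by rewrite !mulrBr addrA (mulrC y) subrK (mulrC y).
by rewrite rpredD // principalMl // qlift_red.
Qed.

Lemma pquot_mulA : associative pquot_mul.
Proof.
move=> x y z; rewrite -(qliftK x) -(qliftK y) -(qliftK z) !pquot_mulE.
by rewrite mulrA.
Qed.

Lemma pquot_mulC : commutative pquot_mul.
Proof.
by move=> x y; rewrite -(qliftK x) -(qliftK y) !pquot_mulE mulrC.
Qed.

Lemma pquot_mul1 : left_id pquot_one pquot_mul.
Proof. by move=> x; rewrite -(qliftK x) pquot_mulE mul1r. Qed.

Lemma pquot_mulDl : left_distributive pquot_mul +%R.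
Proof.
move=> x y z; rewrite -(qliftK x) -(qliftK y) -(qliftK z).
by rewrite -redD !pquot_mulE mulrDl redD.
Qed.

HB.instance Definition _ := GRing.Zmodule_isComPzRing.Build pquot
  pquot_mulA pquot_mulC pquot_mul1 pquot_mulDl.

End PrincipalQuotient.

Section ResidueRings.
Variable o : compact_dvr.

Definition oq (n : nat) : comPzRingType := pquot (unif o ^+ n).
Definition ored (n : nat) : o -> oq n := @red o (unif o ^+ n).

Definition odd_residue_char : Prop :=
  exists p : nat, [/\ prime p, odd p & p%:R = 0 :> oq 1].

Record nonsquare_unit := NonsquareUnit {
  nsq_val : o;
  nsq_unit : nsq_val \is a GRing.unit;
  nsq_nonsquare : forall x : o, ored 1 (x ^+ 2) <> ored 1 nsq_val }.

End ResidueRings.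

(* The ring o[delta], delta ^ 2 = eps, as pairs (a, b) = a + b delta; it is the
   unramified quadratic extension of o, since eps is not a square in the
   residue field. *)
Definition quadext (o : compact_dvr) (eps : nonsquare_unit o) : Type :=
  (o * o)%type.

Section QuadraticExtension.
Variables (o : compact_dvr) (eps : nonsquare_unit o).

Local Notation quadext := (quadext eps).

HB.instance Definition _ := GRing.Zmodule.copy quadext (o * o)%type.

Definition quadext_one : quadext := (1, 0).
Definition quadext_mul (x y : quadext) : quadext :=
  (x.1 * y.1 + nsq_val eps * (x.2 * y.2), x.1 * y.2 + x.2 * y.1).

Lemma quadext_mulA : associative quadext_mul.
Proof.
by move=> [a b] [c d] [e f]; rewrite /quadext_mul /=; congr pair; ring.
Qed.

Lemma quadext_mulC : commutative quadext_mul.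
Proof. by move=> [a b] [c d]; rewrite /quadext_mul /=; congr pair; ring. Qed.

Lemma quadext_mul1 : left_id quadext_one quadext_mul.
Proof. by move=> [a b]; rewrite /quadext_mul /=; congr pair; ring. Qed.

Lemma quadext_mulDl : left_distributive quadext_mul +%R.
Proof.
move=> [a b] [c d] [e f]; rewrite /quadext_mul /=; congr pair => /=; ring.
Qed.

Lemma quadext_oner_neq0 : quadext_one != 0.
Proof. by apply/eqP => [[]] /eqP; rewrite oner_eq0. Qed.

HB.instance Definition _ := GRing.Zmodule_isComNzRing.Build quadext
  quadext_mulA quadext_mulC quadext_mul1 quadext_mulDl quadext_oner_neq0.

Lemma quadextME (a b c d : o) :
  ((a, b) : quadext) * ((c, d) : quadext) =
  (a * c + nsq_val eps * (b * d), a * d + b * c) :> quadext.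
Proof. by []. Qed.

Definition quadext_conj (x : quadext) : quadext := (x.1, - x.2).

(* The uniformiser of o, which is also one of o[delta]. *)
Definition qunif : quadext := (unif o, 0).

Definition Oq (n : nat) : comPzRingType := pquot (qunif ^+ n).
Definition Ored (n : nat) : quadext -> Oq n := @red quadext (qunif ^+ n).
Definition Oconj (n : nat) (x : Oq n) : Oq n := Ored n (quadext_conj (qlift x)).

(* The residue field of o[delta], i.e. [Oq 1] with its field structure. *)
Definition residue_field : Type := Oq 1.

HB.instance Definition _ := GRing.ComPzRing.copy residue_field (Oq 1).

Definition kred : quadext -> residue_field := Ored 1.
Definition kconj : residue_field -> residue_field := @Oconj 1.

Local Notation nrm x := (x.1 ^+ 2 - nsq_val eps * x.2 ^+ 2).

Lemma unif_dvdN (x : o) : x \isn't a GRing.unit -> exists y, x = unif o * y.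
Proof.
have [p0 pU pf] := unifP o.
have [->|x0 xU] := eqVneq x 0; first by exists 0; rewrite mulr0.
have [[|n] [u uU xE]] := pf x x0.
  by move: xU; rewrite xE expr0 mulr1 uU.
by exists (u * unif o ^+ n); rewrite xE exprS mulrCA.
Qed.

Lemma unif_dvd_nunit (x y : o) : x = unif o * y -> x \isn't a GRing.unit.
Proof.
by move=> ->; rewrite unitrM; have [_ /negPf-> _] := unifP o.
Qed.

Lemma kred_eq0 (x : quadext) :
  reflect (exists a b, x = (unif o * a, unif o * b)) (kred x == 0).
Proof.
apply: (iffP eqP) => [x0|[a [b ->]]].
  have /redP/principalP[[a b]] : @red quadext (qunif ^+ 1) x = red _ 0.
    by rewrite red0.
  rewrite subr0 expr1 => ->; exists a, b.
  by rewrite /qunif quadextME; congr pair; ring.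
have : @red quadext (qunif ^+ 1) (unif o * a, unif o * b) = red _ 0.
  apply/redP/principalP; exists (a, b); rewrite subr0 expr1.
  by rewrite /qunif quadextME; congr pair; ring.
by rewrite red0.
Qed.

Lemma nrm_unit (x : quadext) : kred x != 0 -> nrm x \is a GRing.unit.
Proof.
move=> x0; apply: contraT => /unif_dvdN[z zE].
case: x => a b /= in x0 zE *.
have [bU|/unif_dvdN[b' bE]] := boolP (b \is a GRing.unit).
  case: (nsq_nonsquare (n := eps) (x := a / b)).
  apply/redP/principalP; exists (z / b ^+ 2); rewrite expr1 mulrA -zE.
  by rewrite expr_div_n mulrBl mulrK // unitrX.
have aN : a \isn't a GRing.unit.
  rewrite -(@unitrX_pos _ _ 2) //.
  apply: (@unif_dvd_nunit _ (z + nsq_val eps * b' * b)).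
  by rewrite mulrDr -zE bE; ring.
have [a' aE] := unif_dvdN aN.
by case/negP: x0; apply/kred_eq0; exists a', b'; rewrite aE bE.
Qed.

Definition residue_inv (x : residue_field) : residue_field :=
  let y : quadext := @qlift quadext (qunif ^+ 1) x in
  if x == 0 then 0 else kred (quadext_conj y * ((nrm y)^-1, 0)).

Lemma residue_oner_neq0 : (1 : residue_field) != 0.
Proof.
apply/kred_eq0 => [[a [b []]]] /unif_dvd_nunit; by rewrite unitr1.
Qed.

HB.instance Definition _ :=
  GRing.PzSemiRing_isNonZero.Build residue_field residue_oner_neq0.

Lemma residue_mulVf (x : residue_field) : x != 0 -> residue_inv x * x = 1.
Proof.
move=> x0; rewrite /residue_inv (negPf x0).
set y := qlift _.
have xE : x = kred y by rewrite /kred /Ored qliftK.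
have /nrm_unit yU : kred y != 0 by rewrite -xE.
rewrite [X in _ * X]xE [LHS](@pquot_mulE quadext (qunif ^+ 1)).
rewrite [RHS]/(red _ 1); congr red; move: yU; case: (y) => a b /= yU.
rewrite /quadext_conj /= !quadextME -[RHS]/((1, 0) : quadext); congr pair.
  by rewrite -[RHS](mulVr yU); ring.
by ring.
Qed.

Lemma residue_inv0 : residue_inv 0 = 0.
Proof. by rewrite /residue_inv eqxx. Qed.

HB.instance Definition _ := GRing.ComNzRing_isField.Build residue_field
  residue_mulVf residue_inv0.

End QuadraticExtension.

(* Matrices over a ring with an involution [c]. *)
Section UnitaryGroups.
Variables (R : comPzRingType) (c : R -> R).

Definition mx_inverse n (g h : 'M[R]_n) : Prop :=
  g *m h = 1%:M /\ h *m g = 1%:M.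

Definition GL n : set 'M[R]_n := [set g | exists h, mx_inverse g h].

Definition GL_similar n (A B : 'M[R]_n) : Prop :=
  exists g h, mx_inverse g h /\ A = g *m B *m h.

Definition star n (A : 'M[R]_n) : 'M[R]_n := map_mx c A^T.

Definition GU n : set 'M[R]_n := [set A | GL A /\ star A *m A = 1%:M].

Definition gu n : set 'M[R]_n := [set A | star A + A = 0].

(* [gu] for 1 x 1 matrices, which are identified with scalars *)
Definition gu1 : set R := [set x | c x + x = 0].

Definition is_unit (x : R) : Prop := exists y, x * y = 1.

(* characteristic polynomial t^n + \sum_k a_k t^k *)
Definition companion n (a : 'I_n -> R) : 'M[R]_n :=
  \matrix_(i, j) if j.+1 == n then - a i else (i == j.+1 :> nat)%:R.

Definition mx_D (x y z : R) : 'M[R]_3 :=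
  diag_mx (\row_j [:: x; y; z]`_j).

Definition mx_E (p a b x w : R) : 'M[R]_3 :=
  \matrix_(i, j)
    (nth [::] [:: [:: w; p; 0]; [:: 0; w; 1]; [:: a; b; x + w]] i)`_j.

End UnitaryGroups.

Inductive shadow_type :=
  TypeG | TypeL | TypeJ | TypeT1 | TypeT2 | TypeT3 | TypeM | TypeN.

Definition min_poly_of_type (F : fieldType) (c : F -> F) (T : shadow_type)
    (p : {poly F}) : Prop :=
  match T with
  | TypeG => exists2 a, gu1 c a & p = 'X - a%:P
  | TypeL => exists a1 a2, [/\ gu1 c a1, gu1 c a2, a1 != a2 &
               p = ('X - a1%:P) * ('X - a2%:P)]
  | TypeJ => exists2 a, gu1 c a & p = ('X - a%:P) ^+ 2
  | TypeT1 => exists a1 a2 a3,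
      [/\ gu1 c a1, gu1 c a2, gu1 c a3, uniq [:: a1; a2; a3] &
       p = ('X - a1%:P) * ('X - a2%:P) * ('X - a3%:P)]
  | TypeT2 => exists a1 a2 a3,
      [/\ gu1 c a1, a2 = - c a3, uniq [:: a1; a2; a3] &
       p = ('X - a1%:P) * ('X - a2%:P) * ('X - a3%:P)]
  | TypeT3 => size p = 4%N /\ irreducible_poly p
  | TypeM => exists a1 a2, [/\ gu1 c a1, gu1 c a2, a1 != a2 &
               p = ('X - a1%:P) * ('X - a2%:P) ^+ 2]
  | TypeN => exists2 a, gu1 c a & p = ('X - a%:P) ^+ 3
  end.

Section Classes.
Variables (o : compact_dvr) (eps : nonsquare_unit o) (l : nat).
Local Notation O := (quadext eps).
Local Notation k2 := (residue_field eps).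
Local Notation Oq := (Oq eps).
Local Notation gl3 := 'M[Oq l]_3.
Local Notation conj := (@quadext_conj o eps).
Local Notation conjl := (@Oconj o eps l).
Local Notation conjk := (@kconj o eps).
Local Notation redl := (map_mx (@Ored o eps l)).
Local Notation redk := (map_mx (@kred o eps)).

Definition sim_class (A : gl3) : set gl3 := [set B | GL_similar B A].

Definition gu3 : set gl3 := gu conjl (n := 3).

Definition Ad_orbit (A : gl3) : set gl3 :=
  [set B | exists g h : 'M[O]_3,
     [/\ GU conj g, mx_inverse g h & B = redl g *m A *m redl h]].

Definition Ad_orbits : set (set gl3) := Ad_orbit @` gu3.

Definition associated_class (M : gl3) : set gl3 := sim_class M `&` gu3.

Definition sh_GU (A : gl3) : set 'M[k2]_3 :=
  redk @` [set g | GU conj g /\ redl g *m A = A *m redl g].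

Definition sh_gu (A : gl3) : set 'M[k2]_3 :=
  redk @` [set X | gu conj X /\ redl X *m A = A *m redl X].

Definition unitary_shadow (C : set gl3) : set (set 'M[k2]_3 * set 'M[k2]_3) :=
  [set (sh_GU A, sh_gu A) | A in C].

Definition shadow_has_type (C : set gl3) (T : shadow_type) : Prop :=
  exists S : 'M[k2]_3,
    [/\ gu conjk S, min_poly_of_type conjk T (mxminpoly S) &
        unitary_shadow C ([set g | GU conjk g /\ g *m S = S *m g],
                          [set X | gu conjk X /\ X *m S = S *m X])].

End Classes.

Section Representatives.
Variables (o : compact_dvr) (eps : nonsquare_unit o).
Variable s0 : forall n, oq o n -> o.
Arguments s0 {n} _.
Local Notation O := (quadext eps).
Local Notation Oq := (Oq eps).
Local Notation Ored := (@Ored o eps).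
Local Notation gu1 n := (gu1 (@Oconj o eps n)).

(* the representatives extended from [oq n] to [Oq n] componentwise *)
Definition repO n (x : Oq n) : O :=
  (s0 (ored n (qlift x).1), s0 (ored n (qlift x).2)).

(* truncated valuation: the set of k is all of 0..n for x = 0, so v(0) = n *)
Definition val_Oq n (x : Oq n) : nat :=
  \max_(k < n.+1 | `[< exists y, x = Ored n (qunif eps) ^+ k * y >]) k.

(* the element of [Oq m] determined by [x] in [Oq n] through [repO] *)
Definition transfer m n (x : Oq n) : Oq m := Ored m (repO x).

Variable l : nat.

(* pi^i X for X over the quotient by pi^(l - i) *)
Definition pi_scale i p q (X : 'M[Oq (l - i)]_(p, q)) : 'M[Oq l]_(p, q) :=
  map_mx (fun x => Ored l (qunif eps ^+ i * repO x)) X.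

Implicit Type M : 'M[Oq l]_3.

Arguments pi_scale i {p q} X.

Definition case_i M : Prop := exists2 d : Oq l, gu1 l d & M = d%:M.

Definition case_ii M : Prop :=
  exists (i : nat) (d : Oq l) (a : Oq (l - i)),
    [/\ (i < l)%N, gu1 l d, is_unit a, gu1 (l - i) a &
        M = d%:M + pi_scale i (mx_D a 0 0)].

Definition case_iii j (C : 'M[Oq (l - j)]_2) M : Prop :=
  exists (i : nat) (d : Oq j) (a : Oq (l - i)) (b : 'I_2 -> Oq (l - j)),
    [/\ (i < j)%N /\ (j < l)%N,
        gu1 j d,
        is_unit a /\ gu1 (l - i) a,
        [/\ C = companion b,
            Oconj (b 1) = - b 1 & Oconj (b 0) = b 0] &
        M = (transfer l d)%:M + pi_scale i (mx_D a 0 0)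
            + pi_scale j (block_mx 0 0 0 C : 'M_(1 + 2))].

Definition case_iv i (C : 'M[Oq (l - i)]_3) M : Prop :=
  exists (d : Oq i) (c : 'I_3 -> Oq (l - i)),
    [/\ (i < l)%N,
        gu1 i d,
        C = companion c,
        forall k : 'I_3, Oconj (c k) + (-1) ^+ k * c k = 0 &
        M = (transfer l d)%:M + pi_scale i C].

Definition piq n m : Oq n := Ored n (qunif eps) ^+ m.

Definition subcase_I n (E : 'M[Oq n]_3) : Prop :=
  exists c d : Oq n,
    [/\ gu1 n c, gu1 n d, (0 < val_Oq c)%N &
        E = mx_E (piq n n) 0 0 c d].

Definition subcase_II n (E : 'M[Oq n]_3) : Prop :=
  exists (mu : nat) (a b c : Oq n) (d : Oq mu),
    [/\ (1 <= mu < n)%N,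
        mu = val_Oq b /\ (val_Oq b <= val_Oq a)%N,
        Oconj a + a = 0 /\ Oconj b - b = 0,
        [/\ gu1 n c, (0 < val_Oq c)%N & gu1 mu d] &
        E = mx_E (piq n mu) a b c (transfer n d)].

Definition subcase_III1 n (E : 'M[Oq n]_3) : Prop :=
  exists (mu : nat) (a b c : Oq n) (d : Oq mu),
    [/\ (1 <= mu < n)%N,
        mu = val_Oq a /\ (val_Oq a < val_Oq b)%N,
        Oconj a + a = 0 /\ Oconj b - b = 0,
        [/\ gu1 n c, (0 < val_Oq c)%N & gu1 mu d] &
        E = mx_E (piq n mu) a b c (transfer n d)].

Definition case_v (P : forall n, 'M[Oq n]_3 -> Prop) M : Prop :=
  exists (i : nat) (d : Oq i) (E : 'M[Oq (l - i)]_3),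
    [/\ (i < l)%N, gu1 i d, P (l - i)%N E &
        M = (transfer l d)%:M + pi_scale i E].

Definition listed : set 'M[Oq l]_3 := [set M |
  case_i M \/ case_ii M \/
  (exists j C, @case_iii j C M) \/ (exists i C, @case_iv i C M) \/
  case_v subcase_I M \/ case_v subcase_II M \/ case_v subcase_III1 M].

End Representatives.

Arguments gu3 {o} eps l.
Arguments Ad_orbits {o} eps l.
Arguments associated_class {o} eps l M.
Arguments case_i {o} eps l M.
Arguments case_ii {o} eps s0 l M.
Arguments case_iii {o} eps s0 l j C M.
Arguments case_iv {o} eps s0 l i C M.
Arguments case_v {o} eps s0 l P M.
Arguments subcase_I {o} eps n E.
Arguments subcase_II {o} eps s0 n E.
Arguments subcase_III1 {o} eps s0 n E.
Arguments listed {o} eps s0 l M.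

(* Main.v *)
(* All matrices are lifted exactly to O = o[delta].  The key fact is that a
   hermitian H over O with unit determinant is K^* K for some K that commutes
   modulo pi^m with whatever H commutes with: in the residue algebra k[H] this
   is a norm equation, solved prime power by prime power for polynomials over a
   finite field, and the remaining factor 1 + pi X has a square root by
   completeness.  Hence a matrix that is skew for some hermitian form is
   conjugate to an anti-hermitian one, anti-hermitian matrices that are
   GL_3-similar modulo pi^l are GU_3-conjugate, and a unitary shadow may be
   computed with any hermitian form H: if M is H-skew and the centraliser of M
   modulo pi^l reduces onto that of an H-skew S over the residue field, then the
   type of the shadow is that of the minimal polynomial of S.

   Existence: write M = d + pi^i B with B not scalar modulo pi.  Over the
   residue field B is cyclic, or similar to x + t E_11, or similar to x + E_23.
   In the first case B is similar to a companion matrix.  In the second an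
   eigenvector lifts and its orthogonal complement is a 2 x 2 block.  In the
   third the plane spanned by e_3 and B e_3 is non-degenerate, and a basis adapted
   to it and to its orthogonal complement gives a matrix E.  The symmetry of
   the coefficients comes from the trace, the trace of the square and the
   determinant.

   Uniqueness: these three invariants determine the coefficients; a matrix that
   is of rank one modulo pi^k has its determinant determined modulo pi^(n+k) by
   its class modulo pi^n, and the parameters i, j, mu are the precisions up to
   which M, respectively (M - d) / pi^i, is a scalar, respectively a scalar plus
   a matrix of rank one. *)
Require Import Defs.
From HB Require Import structures.
From mathcomp Require Import all_boot all_algebra all_field finmap.
From mathcomp Require Import boolp classical_sets functions filter topology.
From mathcomp Require Import ring.
Set Implicit Arguments. Unset Strict Implicit. Unset Printing Implicit Defensive.
Import GRing.Theory.
Local Open Scope ring_scope.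

(** * Norms in quotients of polynomial rings *)

(** Two obstacles shape the proof. The listed matrices are not anti-hermitian, and while an adapted
    hermitian form H can be written down for each of them, a conjugating matrix cannot; so skewness
    for H, a polynomial identity in the entries, stands in for anti-hermitian symmetry until the
    norm theorem converts it. Moreover, in cases (iii), (II) and (III_1) the reduction of B modulo
    pi has a centraliser larger than the reduction of the centraliser of B. There S is the reduction
    of another matrix S0 that commutes exactly with B and has a cyclic reduction; it is built from a
    quotient by a power of pi, namely the companion block in (iii), and (Y^2 - c Y) / pi^mu in (v),
    where Y is E without its scalar. Lifting to O pays because multiplication by pi^k is injective
    there: a symmetry of pi^mu b is a symmetry of b, without loss of precision. *)

Section FiniteField.
Variable F : finFieldType.

Definition squares : {set F} := [set x ^+ 2 | x : F].

(** The fibres of squaring have at most two elements and the fibre of 0 has only one, whence the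
    strict inequality. *)
Lemma card_squares : (#|F| < 2 * #|squares|)%N.
Proof.
have sq0 : 0 \in squares by apply/imsetP; exists 0; rewrite // expr0n.
rewrite -[#|F|]sum1_card (partition_big (fun x => x ^+ 2) (mem squares)) /=; last first.
  by move=> x _; apply: imset_f.
rewrite (bigD1 0) //= (cardsD1 0 squares) sq0 mulnDr /= muln1 -addSn.
apply: leq_add.
  rewrite ltnS sum1_card.
  apply: (@leq_trans #|[set (0 : F)]|); last by rewrite cards1.
  apply: subset_leq_card.
  by apply/fintype.subsetP => x; rewrite unfold_in /= inE -sqrf_eq0; apply.
rewrite -[#|_ :\ _|]sum1_card big_distrr /=.
rewrite [leqRHS](eq_bigl (fun i => (i \in squares) && (i != 0))); last first.
  by move=> i; rewrite !inE andbC.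
apply: leq_sum => a /andP[/imsetP[y _ ->] _].
rewrite sum1_card muln1; apply: leq_trans (_ : #|[set y; - y]| <= 2)%N.
  apply: subset_leq_card; apply/fintype.subsetP => x.
  by rewrite unfold_in /= !inE -eqf_sqr; apply.
by rewrite cards2; case: (_ != _).
Qed.

(** Pigeonhole: the squares and the translate [u] + [e] times the squares each fill more than half
    of the field, so they meet. *)
Lemma norm_form_surj (e u : F) : e != 0 -> exists x y, x ^+ 2 - e * y ^+ 2 = u.
Proof.
move=> e0; pose B := [set u + e * s | s in squares].
have cB : #|B| = #|squares|.
  by apply: card_imset => s t /addrI /(mulfI e0).
have /finset.set0Pn[z /finset.setIP[/imsetP[x _ zx] /imsetP[s /imsetP[y _ ->] zy]]] :
    squares :&: B != finset.set0.
  apply/eqP => sB; have := card_squares.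
  rewrite mul2n -addnn -{2}cB -finset.cardsUI sB cards0 addn0 ltnNge.
  by rewrite max_card.
by exists x, y; rewrite -zx zy; ring.
Qed.

(** For a non-square [e] the squares and their [e]-multiples meet only in 0; the count of squares
    then forces their union to be everything. *)
Lemma square_or_twisted (e u : F) : (forall x, x ^+ 2 != e) ->
  (exists x, u = x ^+ 2) \/ (exists x, u = e * x ^+ 2).
Proof.
move=> eN; have e0 : e != 0 by have := eN 0; rewrite expr0n eq_sym.
pose B := [set e * s | s in squares].
have cB : #|B| = #|squares| by apply: card_imset => s t /(mulfI e0).
have sB : squares :&: B = [set 0].
  apply/setP => z; rewrite !inE; apply/andP/eqP => [|->]; last first.
    split; first by apply/imsetP; exists 0; rewrite // expr0n.
    apply/imsetP; exists 0; rewrite ?mulr0 //.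
    by apply/imsetP; exists 0; rewrite // expr0n.
  move=> [/imsetP[x _ zx] /imsetP[s /imsetP[y _ ->] zy]].
  have [y0|y0] := eqVneq y 0; first by rewrite zy y0 expr0n mulr0.
  case/eqP: (eN (x / y)); rewrite expr_div_n -zx zy mulfK //.
  by rewrite expf_neq0.
have cU : #|F| = #|squares :|: B|.
  apply/eqP; rewrite eqn_leq max_card andbT -(leq_add2r 1).
  by rewrite -{2}(cards1 (0 : F)) -sB finset.cardsUI cB addnn -mul2n addn1 card_squares.
have : u \in squares :|: B.
  have /eqP <- : [set: F] == squares :|: B.
    by rewrite eq_sym eqEcard finset.subsetT cardsT cU /=.
  by rewrite inE.
case/finset.setUP => [/imsetP[x _ ->]|/imsetP[s /imsetP[x _ ->] ->]]; first by left; exists x.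
by right; exists x.
Qed.

End FiniteField.

Section PolyNorm.
Variable F : finFieldType.
Implicit Types p q r u x y : {poly F}.

Lemma exists_irreducible_dvd q : (1 < size q)%N ->
  exists r, [/\ irreducible_poly r, r \is monic & r %| q].
Proof.
move: {2}(size q) (leqnn (size q)) => n; elim: n q => [|n IH] q qn q1.
  by move: q1; rewrite ltnNge (leq_trans qn).
have q0 : q != 0 by rewrite -size_poly_gt0 (ltn_trans _ q1).
have [irr|] := pselect (irreducible_poly q).
  exists ((lead_coef q)^-1 *: q); split.
  - split; first by rewrite size_scale ?invr_eq0 ?lead_coef_eq0 //.
    move=> d d1 dq; have := irr.2 d d1.
    rewrite dvdpZr ?invr_eq0 ?lead_coef_eq0 // in dq => /(_ dq).
    by move/eqp_trans; apply; rewrite eqp_sym eqp_scale // invr_eq0 lead_coef_eq0.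
  - by rewrite monicE lead_coefZ mulVf // lead_coef_eq0.
  - by rewrite dvdpZl ?invr_eq0 ?lead_coef_eq0.
move=> Nirr; have [d [d1 dq dN]] : exists d : {poly F}, [/\ size d != 1%N, d %| q & ~~ (d %= q)].
  apply: contrapT => H; apply: Nirr; split=> // d d1 dq.
  by apply/negP => /negP dN; apply: H; exists d.
have d0 : d != 0 by apply: contraNneq q0 => d0; rewrite d0 dvd0p in dq.
have dlt : (size d < size q)%N.
  by rewrite ltn_neqAle dvdp_leq // andbT; rewrite (dvdp_size_eqp dq).
have [||r [rI rm rd]] := IH d; first by rewrite -ltnS (leq_trans dlt).
  by rewrite ltn_neqAle eq_sym d1 size_poly_gt0.
by exists r; split=> //; apply: dvdp_trans dq.
Qed.

Lemma poly_norm_irreducible (e : F) r u : e != 0 -> irreducible_poly r ->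
  r \is monic -> exists x y, r %| x ^+ 2 - e *: y ^+ 2 - u.
Proof.
move=> e0 irr mr; pose hI : monic_irreducible_poly r := (irr, mr).
pose K : finFieldType := {poly %/ r with hI}.
pose h (p : {poly F}) : K := in_qpoly r p.
have ee0 : e%:A != 0 :> K by rewrite scaler_eq0 negb_or e0 (oner_neq0 K).
have [x [y xy]] := norm_form_surj (h u) ee0.
have lift (z : K) : h (val (z : {poly %/ r})) = z.
  apply/val_inj; apply: (@in_qpoly_small _ r (val (z : {poly %/ r}))).
  exact: size_mk_monic.
exists (val (x : {poly %/ r})), (val (y : {poly %/ r})).
set p := _ - _ - u; have hp : h p = 0.
  rewrite /p /h !rmorphB /= linearZ /= !rmorphXn /= -!/(h _) !lift.
  by rewrite -xy -[X in X - _]/(_ - _) mulr_algl subrr.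
have := congr1 val hp; rewrite /= mk_monicE // => /eqP.
by rewrite -Pdiv.IdomainMonic.modpE.
Qed.

(** With p the characteristic, the p-th power of a solution modulo q solves the equation for u^p
    modulo q^p. As p = 2m + 1 is odd, e^p and u^p are e and u times squares; the square in u^p is
    cancelled by an inverse of u. Unlike in a Hensel lift, no derivative has to be invertible. *)
Lemma poly_norm_frobenius (e : F) q u x y : 2%:R != 0 :> F -> coprimep u q ->
  q %| x ^+ 2 - e *: y ^+ 2 - u ->
  exists x' y', q ^+ 2 %| x' ^+ 2 - e *: y' ^+ 2 - u.
Proof.
move=> two0 cuq dq.
have [p pr_p pF] := finPcharP F.
have oddp : odd p.
  by case: (even_prime pr_p) => // p2; move: two0; rewrite -p2 (pcharf0 pF) eqxx.
have pP : p \in [pchar {poly F}] by rewrite pchar_poly.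
pose m := (p./2)%N; have pE : p = (m.*2.+1)%N by rewrite -{1}(odd_double_half p) oddp.
have /Bezout_eq1_coprimepP[[v w] /= vw] : coprimep u (q ^+ 2) by rewrite coprimep_expr.
exists (x ^+ p * v ^+ m), (e ^+ m *: (y ^+ p * v ^+ m)).
have odd_exp (R' : comNzRingType) (z : R') : z ^+ p = z * (z ^+ m) ^+ 2.
  by rewrite -exprM muln2 -exprS -pE.
have p1 : p.-1 = (m * 2)%N by rewrite pE muln2.
(* The first summand is divisible by q^p, the second by q^2 because v inverts u modulo q^2. *)
have -> : (x ^+ p * v ^+ m) ^+ 2 - e *: (e ^+ m *: (y ^+ p * v ^+ m)) ^+ 2 - u =
    (x ^+ 2 - e *: y ^+ 2 - u) ^+ p * v ^+ (p.-1) + u * ((u * v) ^+ p.-1 - 1).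
  rewrite -[in RHS](pFrobenius_autE pP).
  rewrite !(pFrobenius_autB_comm _ (mulrC _ _)) !pFrobenius_autE.
  rewrite -!mul_polyC [(_ * y ^+ 2) ^+ p]exprMn ![e%:P ^+ p]odd_exp [u ^+ p]odd_exp.
  rewrite [x ^+ 2 ^+ p]exprAC [y ^+ 2 ^+ p]exprAC p1 ![_ ^+ (m * 2)]exprM.
  by rewrite [(u * v) ^+ m]exprMn !rmorphXn /=; ring.
apply: dvdp_add.
  apply/dvdp_mulr/(dvdp_trans _ (dvdp_exp2r _ dq)).
  by rewrite dvdp_exp2l // prime_gt1.
apply: dvdp_mull; rewrite subrX1; apply: dvdp_mulr.
have -> : u * v - 1 = - (w * q ^+ 2) by rewrite -vw; ring.
by rewrite dvdpNr dvdp_mull.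
Qed.

Lemma poly_norm_crt (e : F) q1 q2 u x1 y1 x2 y2 : coprimep q1 q2 ->
  q1 %| x1 ^+ 2 - e *: y1 ^+ 2 - u -> q2 %| x2 ^+ 2 - e *: y2 ^+ 2 - u ->
  exists x y, q1 * q2 %| x ^+ 2 - e *: y ^+ 2 - u.
Proof.
move=> c12 d1 d2; have /Bezout_eq1_coprimepP[[a b] /= ab] := c12.
pose z s t := s * (b * q2) + t * (a * q1) : {poly F}.
exists (z x1 x2), (z y1 y2); rewrite Gauss_dvdp //.
have z1 s t : z s t = s + (t - s) * a * q1.
  have bq : b * q2 = 1 - a * q1 by rewrite -ab; ring.
  by rewrite /z bq; ring.
have z2 s t : z s t = t + (s - t) * b * q2.
  have aq : a * q1 = 1 - b * q2 by rewrite -ab; ring.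
  by rewrite /z aq; ring.
apply/andP; split.
  rewrite !z1; set f := (_ * a); set g := (_ * a).
  rewrite -mul_polyC.
  have -> : (x1 + f * q1) ^+ 2 - e%:P * (y1 + g * q1) ^+ 2 - u =
    (x1 ^+ 2 - e%:P * y1 ^+ 2 - u) +
    (f * (2%:R * x1 + f * q1) - e%:P * g * (2%:R * y1 + g * q1)) * q1 by ring.
  by rewrite dvdp_add ?dvdp_mull // mul_polyC.
rewrite !z2; set f := (_ * b); set g := (_ * b).
rewrite -mul_polyC.
have -> : (x2 + f * q2) ^+ 2 - e%:P * (y2 + g * q2) ^+ 2 - u =
  (x2 ^+ 2 - e%:P * y2 ^+ 2 - u) +
  (f * (2%:R * x2 + f * q2) - e%:P * g * (2%:R * y2 + g * q2)) * q2 by ring.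
by rewrite dvdp_add ?dvdp_mull // mul_polyC.
Qed.

(** Split off an irreducible factor, q = q' r. If r divides q', then q divides q'^2 and the
    Frobenius step raises a solution modulo q'; otherwise q' and r are coprime and their solutions
    are glued. *)
Lemma poly_norm (e : F) q u : 2%:R != 0 :> F -> e != 0 -> q != 0 ->
  coprimep u q -> exists x y, q %| x ^+ 2 - e *: y ^+ 2 - u.
Proof.
move=> two0 e0; move: {2}(size q) (leqnn (size q)) => n.
elim: n q => [|n IH] q qn q0 cuq.
  by move: q0; rewrite -size_poly_leq0 qn.
have [q1|q1] := leqP (size q) 1.
  exists 0, 0; have /size_poly1P[c c0 ->] : size q == 1%N.
    by rewrite eqn_leq q1 size_poly_gt0.
  by rewrite -[c%:P]mulr1 mul_polyC dvdpZl // dvd1p.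
have [r [rI rm /dvdpP[q' qE]]] := exists_irreducible_dvd q1.
have q'0 : q' != 0 by apply: contraNneq q0 => q'0; rewrite qE q'0 mul0r.
have /andP[cuq' cur] : coprimep u q' && coprimep u r by rewrite -coprimepMr -qE.
have q'n : (size q' <= n)%N.
  rewrite -ltnS (leq_trans _ qn) // qE size_Mmonic //.
  by have := rI.1; case: (size r) => [|[|k]] //= _; rewrite !addnS /= ltnS leq_addr.
have [x [y xy]] := IH _ q'n q'0 cuq'.
have [rq'|rq'] := boolP (r %| q').
  have [x' [y' xy']] := poly_norm_frobenius two0 cuq' xy.
  exists x', y'; apply: dvdp_trans xy'.
  by rewrite qE expr2 dvdp_mul2l.
have [x2 [y2 xy2]] := poly_norm_irreducible u e0 rI rm.
rewrite qE; apply: poly_norm_crt xy xy2.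
by rewrite coprimep_sym irreducible_poly_coprime.
Qed.

End PolyNorm.

(** * Residue rings and completeness *)

Local Open Scope classical_set_scope.
Local Open Scope ring_scope.

Section Reduction.
Variables (R : comNzRingType) (a : R).

Lemma red_zmod : zmod_morphism (@red R a).
Proof.
by move=> x y; rewrite -{2}(subrK y x) (redD a (x - y) y) addrK.
Qed.

HB.instance Definition _ := GRing.isZmodMorphism.Build R (pquot a) (@red R a) red_zmod.

Lemma red_monoid : monoid_morphism (@red R a).
Proof. by split=> // x y; rewrite -[LHS](@pquot_mulE R a). Qed.

HB.instance Definition _ := GRing.isMonoidMorphism.Build R (pquot a) (@red R a) red_monoid.

Lemma red_eq0P x : (red a x = 0) <-> exists y, x = a * y.
Proof.
rewrite -(red0 a); split=> [/redP/principalP[y]|[y ->]].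
  by rewrite subr0 => ->; exists y.
by apply/redP/principalP; exists y; rewrite subr0.
Qed.

End Reduction.

Section ResidueField.
Variable o : compact_dvr.

HB.instance Definition _ n := GRing.RMorphism.copy (@ored o n) (@red o (unif o ^+ n)).

Definition kres : Type := oq o 1.

HB.instance Definition _ := GRing.ComPzRing.copy kres (oq o 1).

Definition kresred : o -> kres := @ored o 1.

HB.instance Definition _ := GRing.RMorphism.copy kresred (@ored o 1).

Lemma kresred_surj x : exists a, x = kresred a.
Proof. by exists (@qlift o (unif o ^+ 1) x); rewrite /kresred /ored qliftK. Qed.

Lemma kresred_eq0 a : (kresred a == 0) = (a \isn't a GRing.unit).
Proof.
apply/eqP/idP => [/red_eq0P[y ->]|].
  have [_ pU _] := unifP o.
  by rewrite expr1 unitrM negb_and pU.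
have [_ _ pf] := unifP o.
have [->|a0] := eqVneq a 0; first by rewrite rmorph0.
have [[|n] [u uU ->]] := pf a a0; first by rewrite expr0 mulr1 uU.
by move=> _; apply/red_eq0P; exists (u * unif o ^+ n); rewrite expr1 exprS mulrCA.
Qed.

Lemma kres_oner_neq0 : (1 : kres) != 0.
Proof. by rewrite -(rmorph1 kresred) kresred_eq0 unitr1. Qed.

HB.instance Definition _ :=
  GRing.PzSemiRing_isNonZero.Build kres kres_oner_neq0.

Definition kres_inv (x : kres) : kres :=
  kresred (if x == 0 then 0 else (@qlift o (unif o ^+ 1) x)^-1).

Lemma kres_mulVf (x : kres) : x != 0 -> kres_inv x * x = 1.
Proof.
move=> x0; rewrite /kres_inv (negPf x0).
have {2}-> : x = kresred (@qlift o (unif o ^+ 1) x) by rewrite /kresred /ored qliftK.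
rewrite -rmorphM /= mulVr ?rmorph1 // -[_ \is a _]negbK -kresred_eq0.
by rewrite /kresred /ored qliftK.
Qed.

Lemma kres_inv0 : kres_inv 0 = 0.
Proof. by rewrite /kres_inv eqxx rmorph0. Qed.

HB.instance Definition _ := GRing.ComNzRing_isField.Build kres
  kres_mulVf kres_inv0.

HB.instance Definition _ := isPointed.Build (adic (unif o)) (0 : o).

Lemma adic_openP (U : set (adic (unif o))) : open U = @adic_open o (unif o) U.
Proof. by []. Qed.

(** The cosets of the maximal ideal are open and cover o, so by compactness finitely many of them
    suffice. *)
Lemma kres_enum : exists s : seq kres, forall x, x \in s.
Proof.
have : @cover_compact (adic (unif o)) setT.
  by rewrite -compact_cover; exact: dvr_compact.
move=> /(_ (adic (unif o)) setT (fun a => [set x | kresred x = kresred a])) [].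
- move=> a _; rewrite adic_openP => x /= xa; exists 1%N => y /=.
  rewrite -xa /kresred /ored rmorphD /= [X in _ + X](_ : _ = 0) ?addr0 //.
  by apply/red_eq0P; exists y.
- by move=> x _; exists x.
move=> D _ cD; exists [seq kresred a | a <- D] => x.
have [a ->] := kresred_surj x; have [d dD /= ->] := cD a I.
by apply: map_f.
Qed.

Definition kres_seq : seq kres := undup (sval (cid kres_enum)).

Lemma kres_seqP x : x \in kres_seq.
Proof. by rewrite mem_undup; case: cid => s. Qed.

Lemma kres_pickleK : pcancel (fun x => index x kres_seq) (fun n => Some (nth 0 kres_seq n)).
Proof. by move=> x; rewrite nth_index ?kres_seqP. Qed.

HB.instance Definition _ := isCountable.Build kres kres_pickleK.

HB.instance Definition _ := isFinite.Build kres
  (Finite.uniq_enumP (undup_uniq _) kres_seqP).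

(* Only consecutive terms are compared: the congruences telescope. *)
Lemma adic_complete (x : nat -> o) :
  (forall m, exists y, x m.+1 - x m = unif o ^+ m * y) ->
  exists z, forall m, exists y, z - x m = unif o ^+ m * y.
Proof.
move=> xC; have xD m n : exists y, x (m + n)%N - x m = unif o ^+ m * y.
  elim: n => [|n [y yE]]; first by exists 0; rewrite addn0 subrr mulr0.
  have [z zE] := xC (m + n)%N; exists (unif o ^+ n * z + y).
  by rewrite addnS mulrDr mulrA -exprD -zE -yE; ring.
(* The balls around the terms generate a proper filter. A cluster point, which compactness provides,
   is the limit: its neighbourhood of radius pi^m meets the m-th ball. *)
pose B m := [set z : adic (unif o) | exists y, z - x m = unif o ^+ m * y].
have fB : Filter (filter_from setT B).
  apply: filter_fromT_filter; first by exists 0%N.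
  move=> i j; exists (i + j)%N => z [y yE]; split.
    have [w wE] := xD i j; exists (unif o ^+ j * y + w).
    by rewrite mulrDr mulrA -exprD -yE -wE; ring.
  have [w wE] := xD j i; exists (unif o ^+ i * y + w).
  by rewrite mulrDr mulrA -exprD (addnC j) -yE -wE addnC; ring.
have pB : ProperFilter (filter_from setT B).
  by apply: filter_from_proper => m _; exists (x m), 0; rewrite subrr mulr0.
have [|z [_ zB]] := @dvr_compact o (filter_from setT B) pB.
  by apply: filterT.
exists z => m; pose V := [set y : adic (unif o) | exists t, (y : o) - z = unif o ^+ m * t].
have Vz : nbhs z V.
  apply: open_nbhs_nbhs; split; last by exists 0; rewrite subrr mulr0.
  rewrite adic_openP => y [t tE]; exists m => s; exists (t + s).
  by rewrite mulrDr -tE; ring.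
have [|w [[y yE] [t tE]]] := zB (B m) V _ Vz; first by exists m.
by exists (y - t); rewrite mulrBr -yE -tE; ring.
Qed.

End ResidueField.

(** * The quadratic extension *)

Section QuadExt.
Variables (o : compact_dvr) (eps : nonsquare_unit o).
Local Notation O := (quadext eps).
Local Notation cj := (@quadext_conj o eps).
Local Notation pi := (qunif eps).
Local Notation Ored := (@Ored o eps).
Local Notation k2 := (residue_field eps).

HB.instance Definition _ n := GRing.RMorphism.copy (@Defs.Ored o eps n) (@red O (pi ^+ n)).

Lemma kred_zmod : zmod_morphism (@kred o eps).
Proof. exact: (@red_zmod O (pi ^+ 1)). Qed.
HB.instance Definition _ := GRing.isZmodMorphism.Build O k2 (@kred o eps) kred_zmod.
Lemma kred_monoid : monoid_morphism (@kred o eps).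
Proof. exact: (@red_monoid O (pi ^+ 1)). Qed.
HB.instance Definition _ := GRing.isMonoidMorphism.Build O k2 (@kred o eps) kred_monoid.

Lemma conj_zmod : zmod_morphism cj.
Proof. by move=> [a b] [c d]; congr pair => /=; ring. Qed.
HB.instance Definition _ := GRing.isZmodMorphism.Build O O cj conj_zmod.
Lemma conj_monoid : monoid_morphism cj.
Proof.
split=> [|[a b] [c d]]; first by congr pair; rewrite /= oppr0.
by rewrite /quadext_conj /= !quadextME; congr pair; ring.
Qed.
HB.instance Definition _ := GRing.isMonoidMorphism.Build O O cj conj_monoid.

Lemma conjK : involutive cj.
Proof. by move=> [a b]; rewrite /quadext_conj /= opprK. Qed.

Lemma conj_pi : cj pi = pi.
Proof. by rewrite /quadext_conj /= oppr0. Qed.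

Definition emb (a : o) : O := (a, 0).
Definition dlt : O := (0, 1).

Lemma emb_zmod : zmod_morphism emb.
Proof. by move=> a b; congr pair; rewrite /= subr0. Qed.
HB.instance Definition _ := GRing.isZmodMorphism.Build o O emb emb_zmod.
Lemma emb_monoid : monoid_morphism emb.
Proof. by split=> // a b; rewrite /emb quadextME; congr pair; ring. Qed.
HB.instance Definition _ := GRing.isMonoidMorphism.Build o O emb emb_monoid.

Lemma conj_emb a : cj (emb a) = emb a.
Proof. by rewrite /quadext_conj /= oppr0. Qed.

Lemma conj_dlt : cj dlt = - dlt.
Proof. by congr pair; rewrite /= oppr0. Qed.

Lemma dltM : dlt * dlt = emb (nsq_val eps).
Proof. by rewrite /dlt quadextME /emb; congr pair; ring. Qed.

Lemma quadextE (x : O) : x = emb x.1 + dlt * emb x.2.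
Proof. by case: x => a b; rewrite /emb /dlt quadextME; congr pair => /=; ring. Qed.

Lemma pi_emb : pi = emb (unif o). Proof. by []. Qed.

Lemma piXM n (a b : o) : pi ^+ n * ((a, b) : O) = (unif o ^+ n * a, unif o ^+ n * b).
Proof. by rewrite pi_emb -rmorphXn /= /emb quadextME; congr pair; ring. Qed.

Lemma piXI n : injective (fun x : O => pi ^+ n * x).
Proof.
move=> [a b] [c d]; rewrite !piXM => -[].
have p0 : unif o ^+ n != 0 by rewrite expf_neq0 //; have [] := unifP o.
by move=> /(mulfI p0) -> /(mulfI p0) ->.
Qed.

Lemma Ored_eq0 n (x : O) : (Ored n x = 0) <-> exists y, x = pi ^+ n * y.
Proof. exact: red_eq0P. Qed.

Lemma Ored_eqP n (x y : O) : (Ored n x = Ored n y) <-> exists z, x = y + pi ^+ n * z.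
Proof.
split=> [xy|[z ->]].
  have [|z zE] := (Ored_eq0 n (x - y)).1; first by rewrite rmorphB /= xy subrr.
  by exists z; rewrite -zE; ring.
by rewrite rmorphD /= [X in _ + X](_ : _ = 0) ?addr0 //; apply/Ored_eq0; exists z.
Qed.

Lemma Ored_qlift n (x : Oq eps n) : Ored n (qlift x) = x.
Proof. exact: qliftK. Qed.

Lemma Oconj_red n (x : O) : Oconj (Ored n x) = Ored n (cj x).
Proof.
rewrite /Oconj; have /Ored_eqP[z ->] := Ored_qlift (Ored n x).
apply/Ored_eqP; exists (cj z).
by rewrite -/(cj _) rmorphD rmorphM rmorphXn /= conj_pi.
Qed.

Lemma kconj_red (x : O) : kconj (kred x) = kred (cj x).
Proof. exact: (@Oconj_red 1). Qed.

Lemma kred_surj (x : k2) : exists y, x = kred y.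
Proof. by exists (qlift (x : Oq eps 1)); rewrite /kred Ored_qlift. Qed.

Lemma kred_eqP (x y : O) : kred x = kred y <-> exists z, x = y + pi * z.
Proof. by rewrite -[pi]expr1; exact: (@Ored_eqP 1). Qed.

Lemma kred_eq0P (x : O) : kred x = 0 <-> exists z, x = pi * z.
Proof. by rewrite -[pi]expr1; exact: (@Ored_eq0 1). Qed.

Lemma kred_pi : kred pi = 0.
Proof. by apply/kred_eq0P; exists 1; rewrite mulr1. Qed.

Lemma Ored_kred n (x y : O) : (0 < n)%N -> Ored n x = Ored n y -> kred x = kred y.
Proof.
case: n => // n _ /Ored_eqP[z ->].
by rewrite rmorphD rmorphM rmorphXn /= kred_pi expr0n mul0r addr0.
Qed.

Lemma Ored_le m n (x y : O) : (m <= n)%N -> Ored n x = Ored n y -> Ored m x = Ored m y.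
Proof.
move=> mn /Ored_eqP[z ->]; apply/Ored_eqP; exists (pi ^+ (n - m) * z).
by rewrite mulrA -exprD subnKC.
Qed.

Lemma unit_of_kred (x : O) : kred x != 0 -> exists y, y * x = 1.
Proof.
move=> /nrm_unit nU; exists (cj x * emb ((x.1 ^+ 2 - nsq_val eps * x.2 ^+ 2)^-1)).
case: x nU => a b /= nU; rewrite /quadext_conj /emb /= !quadextME.
rewrite -[RHS]/((1, 0) : O); congr pair; last by ring.
by rewrite -[RHS](mulVr nU); ring.
Qed.

(** Invertibility is declared as non-vanishing in the residue field, so that [unitOE] holds by
    conversion. *)
Definition Ounit : pred O := fun x => kred x != 0.
Definition Oinv (x : O) : O :=
  if pselect (exists y, y * x = 1) is left e then sval (cid e) else x.

Lemma Omul_inv : {in Ounit, left_inverse 1 Oinv *%R}.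
Proof.
move=> x xU; rewrite /Oinv; case: pselect => [e|]; first by case: cid.
by case; apply: unit_of_kred.
Qed.

Lemma Ounit_mul (x y : O) : y * x = 1 -> Ounit x.
Proof.
move=> /(congr1 (@kred o eps)); rewrite rmorphM rmorph1 /= => yx.
by apply/eqP => x0; move: yx => /eqP; rewrite x0 mulr0 eq_sym oner_eq0.
Qed.

Lemma Oinv_out : {in [predC Ounit], Oinv =1 id}.
Proof.
move=> x xU; rewrite /Oinv; case: pselect => // e.
by exfalso; case: e => y /Ounit_mul xU'; case/negP: xU.
Qed.

HB.instance Definition _ := GRing.ComNzRing_hasMulInverse.Build O
  Omul_inv Ounit_mul Oinv_out.

Lemma unitOE (x : O) : (x \is a GRing.unit) = (kred x != 0).
Proof. by []. Qed.

Lemma dlt_unit : dlt \is a GRing.unit.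
Proof.
apply/unitrP; exists (emb (nsq_val eps)^-1 * dlt).
have e : emb (nsq_val eps)^-1 * emb (nsq_val eps) = 1.
  by rewrite -rmorphM mulVr ?rmorph1 // nsq_unit.
by split; [rewrite -mulrA dltM|rewrite mulrCA dltM].
Qed.

Lemma adic_separated (x : O) : (forall m, exists y, x = pi ^+ m * y) -> x = 0.
Proof.
have [p0 pU pf] := unifP o.
have sep (a : o) : (forall m, exists b, a = unif o ^+ m * b) -> a = 0.
  move=> ha; apply/eqP/contraT => a0; have [n [u uU uE]] := pf a a0.
  have [b bE] := ha n.+1; case/negP: pU.
  have uE' : u = unif o * b.
    apply: (mulIf (expf_neq0 n p0)); rewrite -uE bE exprS; ring.
  by move: uU; rewrite uE' unitrM => /andP[].
case: x => a b hx; congr pair; apply: sep => m; have [[c d]] := hx m;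
  by rewrite piXM => -[aE bE]; first [by exists c|by exists d].
Qed.

Lemma Oadic_complete (x : nat -> O) :
  (forall m, Ored m (x m.+1) = Ored m (x m)) ->
  exists z, forall m, Ored m z = Ored m (x m).
Proof.
move=> xC; have /adic_complete[a aE] :
    forall m, exists y, (x m.+1).1 - (x m).1 = unif o ^+ m * y.
  move=> m; have /Ored_eqP[[c d] ->] := xC m; exists c.
  by rewrite piXM /= addrC addKr.
have /adic_complete[b bE] :
    forall m, exists y, (x m.+1).2 - (x m).2 = unif o ^+ m * y.
  move=> m; have /Ored_eqP[[c d] ->] := xC m; exists d.
  by rewrite piXM /= addrC addKr.
exists (a, b) => m; have [c cE] := aE m; have [d dE] := bE m.
apply/Ored_eqP; exists (c, d); rewrite piXM -cE -dE.
by case: (x m) => u v; congr pair; rewrite /= addrC subrK.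
Qed.

Hypothesis hodd : odd_residue_char o.

Lemma kres_two_neq0 : 2%:R != 0 :> kres o.
Proof.
have [p [_ podd p0]] := hodd; apply/eqP => two0.
have /eqP : p%:R = 0 :> kres o by exact: p0.
rewrite -(odd_double_half p) podd -muln2 natrD natrM two0 mulr0 addr0.
by rewrite oner_eq0.
Qed.

Lemma two_unit_o : (2%:R : o) \is a GRing.unit.
Proof. by have := kres_two_neq0; rewrite -(rmorph_nat (@kresred o)) kresred_eq0 negbK. Qed.

Lemma two_unit : (2%:R : O) \is a GRing.unit.
Proof.
apply/unitrP; exists (emb 2%:R^-1); rewrite -(rmorph_nat emb) -!rmorphM /=.
by rewrite mulVr ?mulrV ?rmorph1 // two_unit_o.
Qed.

End QuadExt.

(** * Matrices over the quadratic extension *)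

Section StarMatrices.
Variables (o : compact_dvr) (eps : nonsquare_unit o).
Local Notation O := (quadext eps).
Local Notation cj := (@quadext_conj o eps).

Lemma starM n (A B : 'M[O]_n) : star cj (A *m B) = star cj B *m star cj A.
Proof. by rewrite /star trmx_mul map_mxM. Qed.

Lemma starD n (A B : 'M[O]_n) : star cj (A + B) = star cj A + star cj B.
Proof. by rewrite /star linearD /= map_mxD. Qed.

Lemma starB n (A B : 'M[O]_n) : star cj (A - B) = star cj A - star cj B.
Proof. by rewrite /star linearB /= map_mxB. Qed.

Lemma starZ n a (A : 'M[O]_n) : star cj (a *: A) = cj a *: star cj A.
Proof. by rewrite /star linearZ /= map_mxZ. Qed.

Lemma star_scalar n a : star cj (a%:M : 'M[O]_n) = (cj a)%:M.
Proof. by rewrite /star tr_scalar_mx map_scalar_mx. Qed.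

Lemma star1 n : star cj (1%:M : 'M[O]_n) = 1%:M.
Proof. by rewrite star_scalar rmorph1. Qed.

Lemma starK n : involutive (@star O cj n).
Proof. by move=> A; apply/matrixP => i j; rewrite !mxE conjK. Qed.

End StarMatrices.

(** * Congruences of matrices, commutation modulo powers of pi, and square roots *)

Section Congruences.
Variables (o : compact_dvr) (eps : nonsquare_unit o).
Local Notation O := (quadext eps).
Local Notation cj := (@quadext_conj o eps).
Local Notation pi := (qunif eps).
Local Notation redm m := (map_mx (@Defs.Ored o eps m)).
Local Notation redk := (map_mx (@kred o eps)).

Lemma redm_eqP m p q (A B : 'M[O]_(p, q)) :
  redm m A = redm m B <-> exists Z, A = B + pi ^+ m *: Z.
Proof.
split=> [/matrixP AB|[Z ->]]; last first.
  by apply/matrixP => i j; rewrite !mxE; apply/Ored_eqP; exists (Z i j).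
have h i j : exists z, A i j = B i j + pi ^+ m * z.
  by apply/Ored_eqP; have := AB i j; rewrite !mxE.
exists (\matrix_(i, j) sval (cid (h i j))); apply/matrixP => i j.
by rewrite !mxE; case: cid.
Qed.

Lemma redm_mul3 m n (P Q X Y : 'M[O]_n) : redm m X = redm m Y ->
  redm m (P *m X *m Q) = redm m (P *m Y *m Q).
Proof. by rewrite !map_mxM => ->. Qed.

Lemma redm_le m n p q (A B : 'M[O]_(p, q)) : (m <= n)%N ->
  redm n A = redm n B -> redm m A = redm m B.
Proof.
move=> mn /redm_eqP[Z ->]; apply/redm_eqP; exists (pi ^+ (n - m) *: Z).
by rewrite scalerA -exprD subnKC.
Qed.

Lemma redm_redk m p q (A B : 'M[O]_(p, q)) : (0 < m)%N ->
  redm m A = redm m B -> redk A = redk B.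
Proof.
move=> m0 /matrixP AB; apply/matrixP => i j; have := AB i j; rewrite !mxE.
exact: Ored_kred.
Qed.

Lemma redk_mul3 n (P Q X Y : 'M[O]_n) : redk X = redk Y ->
  redk (P *m X *m Q) = redk (P *m Y *m Q).
Proof. by rewrite !map_mxM => ->. Qed.

Lemma redk_eqP p q (A B : 'M[O]_(p, q)) :
  redk A = redk B <-> exists Z, A = B + pi *: Z.
Proof. by rewrite -[pi]expr1 -redm_eqP. Qed.

Lemma redm_lift m p q (A : 'M[Oq eps m]_(p, q)) : exists B, A = redm m B.
Proof.
by exists (map_mx (@qlift _ _) A); apply/matrixP => i j; rewrite !mxE Ored_qlift.
Qed.

Lemma redk_lift p q (A : 'M[residue_field eps]_(p, q)) : exists B, A = redk B.
Proof.
exists (map_mx (@qlift O (pi ^+ 1)) A); apply/matrixP => i j.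
by rewrite !mxE /kred Ored_qlift.
Qed.

Lemma separated_mx p q (A B : 'M[O]_(p, q)) :
  (forall m, redm m A = redm m B) -> A = B.
Proof.
move=> AB; apply/matrixP => i j; apply/eqP; rewrite -subr_eq0; apply/eqP.
apply: adic_separated => m; have /matrixP/(_ i j) := AB m; rewrite !mxE.
by move=> /Ored_eqP[z ->]; exists z; rewrite addrC addKr.
Qed.

Lemma complete_mx p q (A : nat -> 'M[O]_(p, q)) :
  (forall m, redm m (A m.+1) = redm m (A m)) ->
  exists B, forall m, redm m B = redm m (A m).
Proof.
move=> AC; have h i j : exists z, forall m, Defs.Ored m z = Defs.Ored m (A m i j).
  by apply: Oadic_complete => m; have /matrixP/(_ i j) := AC m; rewrite !mxE.
exists (\matrix_(i, j) sval (cid (h i j))) => m; apply/matrixP => i j.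
by rewrite !mxE; case: cid.
Qed.

Lemma unitmx_redk n (A : 'M[O]_n) : (A \in unitmx) = (redk A \in unitmx).
Proof. by rewrite !unitmxE det_map_mx unitOE unitfE. Qed.

Definition comm_mod m n (A B : 'M[O]_n) : Prop :=
  redm m (A *m B) = redm m (B *m A).

Section CommMod.
Variables (m n : nat) (B : 'M[O]_n).

Lemma comm_mod_scalar a : comm_mod m a%:M B.
Proof. by rewrite /comm_mod scalar_mxC. Qed.

Lemma comm_modD A A' : comm_mod m A B -> comm_mod m A' B -> comm_mod m (A + A') B.
Proof. by rewrite /comm_mod mulmxDl mulmxDr !map_mxD => -> ->. Qed.

Lemma comm_modN A : comm_mod m A B -> comm_mod m (- A) B.
Proof. by rewrite /comm_mod mulNmx mulmxN !map_mxN => ->. Qed.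

Lemma comm_modB A A' : comm_mod m A B -> comm_mod m A' B -> comm_mod m (A - A') B.
Proof. by move=> h /comm_modN; apply: comm_modD. Qed.

Lemma comm_modZ a A : comm_mod m A B -> comm_mod m (a *: A) B.
Proof. by rewrite /comm_mod -scalemxAl -scalemxAr !map_mxZ => ->. Qed.

Lemma comm_modM A A' : comm_mod m A B -> comm_mod m A' B -> comm_mod m (A *m A') B.
Proof.
rewrite /comm_mod => h h'.
rewrite -mulmxA map_mxM h' -map_mxM mulmxA map_mxM h -map_mxM.
by rewrite mulmxA.
Qed.

Lemma comm_mod_inv A : A \in unitmx -> comm_mod m A B -> comm_mod m (invmx A) B.
Proof.
move=> uA h; rewrite /comm_mod.
rewrite -[B in LHS](mulmxK uA) mulmxA map_mxM.
have -> : redm m (invmx A *m (B *m A)) = redm m B.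
  by rewrite map_mxM -h -map_mxM mulmxA mulVmx // mul1mx.
by rewrite -map_mxM.
Qed.

End CommMod.

Lemma comm_mod_congr m n (A A' B : 'M[O]_n) : redm m A = redm m A' ->
  comm_mod m A' B -> comm_mod m A B.
Proof. by rewrite /comm_mod !map_mxM => ->. Qed.

Lemma comm_mod_sym m n (A B : 'M[O]_n) : comm_mod m A B -> comm_mod m B A.
Proof. by move=> h; symmetry. Qed.

(** By separatedness; exact commutation is thereby covered by statements that hold for every
    modulus. *)
Lemma comm_modP n (A B : 'M[O]_n) : (forall m, comm_mod m A B) <-> A *m B = B *m A.
Proof. by split=> [h|h m]; [exact: separated_mx|rewrite /comm_mod h]. Qed.

Lemma star_redm m n (A : 'M[O]_n) :
  star (@Oconj o eps m) (redm m A) = redm m (star cj A).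
Proof. by apply/matrixP => i j; rewrite !mxE Oconj_red. Qed.

Lemma star_redk n (A : 'M[O]_n) : star (@kconj o eps) (redk A) = redk (star cj A).
Proof. by apply/matrixP => i j; rewrite !mxE kconj_red. Qed.

Hypothesis hodd : odd_residue_char o.

Definition half : O := 2%:R^-1.

Lemma half2 : 2%:R * half = 1. Proof. by rewrite mulrV // two_unit. Qed.

Lemma conj_half : cj half = half.
Proof. by rewrite /half rmorphV ?two_unit //= rmorph_nat. Qed.

(** The bookkeeping of one iteration, in an abstract module so that [ring] only meets scalars. *)
Lemma sqrt_step (R : comNzRingType) (V : lmodType R) (S z yz zz : V) (p h : R) k :
  S + (p ^+ k.+1 *: z + p *: (p ^+ k.+1 *: yz) +
       h *: (h *: (p ^+ k.+1 *: (p ^+ k.+1 *: zz)))) =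
  p ^+ k.+1 *: z + S + p ^+ k.+2 *: (yz + h ^+ 2 *: (p ^+ k *: zz)).
Proof.
rewrite !scalerDr !scalerA !addrA (addrC S).
by congr (_ + _ *: _ + _ *: _); rewrite !exprS; ring.
Qed.

Section SquareRoot.
Variables (n : nat) (H : 'M[O]_n).

(** Newton's iteration for S^2 = H with the derivative 2 S replaced by its residue 2. Convergence is
    only linear, but each iterate is a polynomial in H, so that commutation and symmetry are
    inherited. *)
Fixpoint sqrt_seq k : 'M[O]_n :=
  if k is k'.+1 then sqrt_seq k' + half *: (H - sqrt_seq k' *m sqrt_seq k')
  else 1%:M.

Hypothesis H1 : redk H = 1%:M.

Lemma sqrt_seq_comm m A k : comm_mod m H A -> comm_mod m (sqrt_seq k) A.
Proof.
move=> hA; elim: k => [|k IH] /=; first exact: comm_mod_scalar.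
by apply: comm_modD => //; apply/comm_modZ/comm_modB => //; apply: comm_modM.
Qed.

Lemma sqrt_seq_star k : star cj H = H -> star cj (sqrt_seq k) = sqrt_seq k.
Proof.
move=> sH; elim: k => [|k IH] /=; first exact: star1.
by rewrite starD starZ conj_half starB starM sH IH.
Qed.

Lemma sqrt_seq_square k :
  redk (sqrt_seq k) = 1%:M /\
  redm k.+1 (sqrt_seq k *m sqrt_seq k) = redm k.+1 H.
Proof.
elim: k => [|k [IH1 IH]] /=; first by rewrite mulmx1 map_mx1 -H1.
set s := sqrt_seq k in IH1 IH *; set D := H - s *m s.
have [Z DE] : exists Z, D = pi ^+ k.+1 *: Z.
  have /redm_eqP[Z ZE] := IH; exists (- Z); rewrite /D ZE scalerN.
  by rewrite opprD addrA subrr sub0r.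
split.
  rewrite map_mxD IH1 map_mxZ DE map_mxZ rmorphXn /= kred_pi expr0n scale0r.
  by rewrite scaler0 addr0.
have [Y YE] : exists Y, s = 1%:M + pi *: Y by apply/redk_eqP; rewrite IH1 map_mx1.
have sD : D *m s = s *m D.
  rewrite /D mulmxBl mulmxBr mulmxA; congr (_ - _).
  apply/comm_modP => m; apply: comm_mod_sym; apply: sqrt_seq_comm.
  by rewrite /comm_mod.
have h2 : half + half = 1 by rewrite -[RHS]half2; ring.
(* The new square exceeds H by (s - 1) D + D^2 / 4; with s = 1 + pi Y and D = pi^(k+1) Z both terms
   contain pi^(k+2). *)
apply/redm_eqP; exists (Y *m Z + half ^+ 2 *: (pi ^+ k *: (Z *m Z))).
have -> : H = D + s *m s by rewrite subrK.
rewrite mulmxDl !mulmxDr -!scalemxAl -!scalemxAr sD.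
have -> : s *m s + half *: (s *m D) + (half *: (s *m D) + half *: (half *: (D *m D)))
    = s *m s + (s *m D + half *: (half *: (D *m D))).
  by rewrite addrA -addrA -addrA; congr (_ + _); rewrite !addrA -scalerDl h2 scale1r.
rewrite [s in s *m D]YE mulmxDl mul1mx DE -!scalemxAl -!scalemxAr.
exact: sqrt_step.
Qed.

Lemma sqrt_mx : exists S, [/\ S *m S = H, redk S = 1%:M,
  star cj H = H -> star cj S = S &
  forall m A, comm_mod m H A -> comm_mod m S A].
Proof.
have [m|S SE] := @complete_mx n n (sqrt_seq).
  have [_ /redm_eqP[Z ZE]] := sqrt_seq_square m.
  apply/redm_eqP; exists (- (half *: (pi *: Z))); rewrite /=; congr (_ + _).
  by rewrite ZE opprD addrA subrr sub0r !scalerN !scalerA exprS;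
    congr (- (_ *: _)); ring.
exists S; split.
- apply: separated_mx => m; rewrite map_mxM SE -map_mxM.
  by have [_] := sqrt_seq_square m; apply: redm_le.
- by rewrite (redm_redk (ltn0Sn 0) (SE 1%N)); have [] := sqrt_seq_square 1.
- move=> sH; apply: separated_mx => m.
  have -> : redm m (star cj S) = redm m (star cj (sqrt_seq m)).
    have /redm_eqP[Z ->] := SE m; apply/redm_eqP; exists (star cj Z).
    by rewrite starD starZ /= rmorphXn /= conj_pi.
  by rewrite sqrt_seq_star // SE.
- by move=> m A hA; apply: comm_mod_congr (SE m) _; apply: sqrt_seq_comm.
Qed.

End SquareRoot.

End Congruences.

(** * Hermitian matrices as norms *)

Lemma char_poly_tr (R : comNzRingType) n (A : 'M[R]_n) : char_poly A^T = char_poly A.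
Proof.
rewrite /char_poly -[RHS]det_tr; congr (\det _).
by rewrite /char_poly_mx linearB /= map_trmx tr_scalar_mx.
Qed.

Section HermitianNorm.
Variables (o : compact_dvr) (eps : nonsquare_unit o).
Hypothesis hodd : odd_residue_char o.
Local Notation O := (quadext eps).
Local Notation cj := (@quadext_conj o eps).
Local Notation pi := (qunif eps).
Local Notation redm m := (map_mx (@Defs.Ored o eps m)).
Local Notation redk := (map_mx (@kred o eps)).
Local Notation emb := (@emb o eps).
Local Notation dlt := (dlt eps).

Lemma kres_poly_lift (p : {poly kres o}) : exists q, p = map_poly (@kresred o) q.
Proof.
exists (\poly_(i < size p) sval (cid (kresred_surj p`_i))).
apply/polyP => i; rewrite coef_map coef_poly.
case: ltnP => [_|le]; first by case: cid.
by rewrite /= rmorph0 nth_default.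
Qed.

Lemma kres_poly_eq0 (p : {poly o}) : map_poly (@kresred o) p = 0 ->
  exists q, p = unif o *: q.
Proof.
move=> p0; have h i : exists y, p`_i = unif o * y.
  have : kresred p`_i = 0 by rewrite -coef_map p0 coef0.
  by move=> /red_eq0P; rewrite expr1.
exists (\poly_(i < size p) sval (cid (h i))).
apply/polyP => i; rewrite coefZ coef_poly.
case: ltnP => [_|le]; first by case: cid.
by rewrite mulr0 nth_default.
Qed.

Variables (n : nat) (H : 'M[O]_n.+1).
Hypotheses (sH : star cj H = H) (uH : H \in unitmx).

(** Coefficients are taken in o so that the values are hermitian; then X(H) + delta Y(H) has the
    norm X(H)^2 - delta^2 Y(H)^2, the form treated by [poly_norm]. *)
Definition ev (p : {poly o}) : 'M[O]_n.+1 := horner_mx H (map_poly emb p).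

Lemma evD p q : ev (p + q) = ev p + ev q.
Proof. by rewrite /ev !rmorphD. Qed.
Lemma evB p q : ev (p - q) = ev p - ev q.
Proof. by apply: (addIr (ev q)); rewrite -evD !subrK. Qed.
Lemma evM p q : ev (p * q) = ev p *m ev q.
Proof. by rewrite /ev !rmorphM. Qed.
Lemma evX : ev 'X = H.
Proof. by rewrite /ev map_polyX horner_mx_X. Qed.
Lemma evC a : ev a%:P = (emb a)%:M.
Proof. by rewrite /ev map_polyC horner_mx_C. Qed.

Lemma ev_comm m A p : comm_mod m H A -> comm_mod m (ev p) A.
Proof.
move=> hA; elim/poly_ind: p => [|p c IH].
  by rewrite /ev !rmorph0 /comm_mod mulmx0 mul0mx.
rewrite evD evM evX evC; apply: comm_modD; last exact: comm_mod_scalar.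
exact: comm_modM.
Qed.

Lemma ev_star p : star cj (ev p) = ev p.
Proof.
elim/poly_ind: p => [|p c IH].
  by rewrite /ev !rmorph0 /star trmx0 map_mx0.
rewrite evD evM evX evC starD starM sH IH star_scalar /= conj_emb.
congr (_ + _); apply/esym/comm_modP => m; apply: ev_comm.
by rewrite /comm_mod.
Qed.

(** H equals its conjugate transpose, so conjugation fixes the characteristic polynomial; since 2 is
    not 0 in o, the delta-parts of the coefficients vanish. *)
Lemma char_poly_conj : exists q : {poly o}, char_poly H = map_poly emb q.
Proof.
exists (\poly_(i < size (char_poly H)) ((char_poly H)`_i).1).
apply/polyP => i; rewrite coef_map coef_poly.
case: ltnP => [_|le]; last by rewrite /= ?rmorph0 nth_default.
have : map_poly cj (char_poly H) = char_poly H.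
  by rewrite map_char_poly -[in RHS]sH /star -map_trmx char_poly_tr.
move=> /(congr1 (fun p : {poly O} => p`_i)); rewrite coef_map.
case: (_`_i) => a b; rewrite /quadext_conj /= => -[/eqP].
rewrite -subr_eq0 -opprD oppr_eq0 -mulr2n -mulr_natl => bb.
suff /eqP -> : b == 0 by [].
have two0 : (2%:R : o) != 0.
  by apply: contraTneq (two_unit_o hodd) => ->; rewrite unitr0.
by move: bb; rewrite mulf_eq0 (negPf two0).
Qed.

(* The class of [H] in the residue algebra is a norm by [poly_norm], and the
   remaining factor, congruent to 1, has a square root; both are polynomials
   in [H], or limits thereof. *)
Lemma hermitian_norm : exists K : 'M[O]_n.+1,
  star cj K *m K = H /\ forall m A, comm_mod m H A -> comm_mod m K A.
Proof.
have [chi chiE] := char_poly_conj.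
have embI (u v : o) : emb u = emb v -> u = v by case.
have mchi : chi \is monic.
  have /monicP := char_poly_monic H.
  by rewrite chiE lead_coef_map_inj ?rmorph0 // => /(embI _ 1) /eqP; rewrite -monicE.
have chi0 : map_poly (@kresred o) chi != 0 by rewrite monic_neq0 ?monic_map.
(* H is invertible in the residue algebra: the constant term of chi is, up to sign, the unit det
   H. *)
have cop : coprimep 'X (map_poly (@kresred o) chi).
  have -> : 'X = 'X - 0%:P :> {poly kres o} by rewrite polyC0 subr0.
  rewrite coprimep_sym coprimep_XsubC rootE horner_coef0 coef_map /=.
  rewrite kresred_eq0 negbK.
  have := char_poly_det H; rewrite chiE coef_map /= => cE.
  have : emb chi`_0 \is a GRing.unit.
    by rewrite cE unitrM unitrX ?unitrN1 //= -unitmxE.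
  rewrite unitOE; apply: contraR => cN; apply/eqP/kred_eq0P.
  by have [c ->] := unif_dvdN cN; exists (emb c); rewrite pi_emb -rmorphM.
have e0 : kresred (nsq_val eps) != 0 by rewrite kresred_eq0 negbK nsq_unit.
have [x [y /dvdpP[q xyq]]] := poly_norm (kres_two_neq0 hodd) e0 chi0 cop.
have [X xE] := kres_poly_lift x; have [Y yE] := kres_poly_lift y.
have [Q qE] := kres_poly_lift q.
have [D DE] : exists D, X ^+ 2 - (nsq_val eps)%:P * Y ^+ 2 - 'X - Q * chi = unif o *: D.
  apply: kres_poly_eq0; rewrite !(rmorphB, rmorphXn, rmorphM) /= ?rmorphXn map_polyC map_polyX /=.
  by rewrite -xE -yE -qE mul_polyC xyq subrr.
pose K0 := ev X + dlt *: ev Y.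
have sK0 : star cj K0 = ev X - dlt *: ev Y.
  by rewrite /K0 starD starZ /= conj_dlt !ev_star scaleNr.
have K0c m A : comm_mod m H A -> comm_mod m K0 A.
  by move=> hA; apply: comm_modD; [|apply: comm_modZ]; apply: ev_comm.
have evc p q' : ev p *m ev q' = ev q' *m ev p.
  by rewrite -!evM mulrC.
pose T := star cj K0 *m K0.
(* By Cayley-Hamilton the multiple of chi disappears, and the norm of K0 is H up to a multiple of
   pi. *)
have TE : T = H + pi *: ev D.
  have -> : T = ev (X ^+ 2 - (nsq_val eps)%:P * Y ^+ 2).
    rewrite /T sK0 /K0 evB !expr2 !evM evC mulmxBl !mulmxDr -!scalemxAl -!scalemxAr.
    rewrite (evc Y X) opprD addrA addrK scalerA dltM mul_scalar_mx.
    by [].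
  have -> : X ^+ 2 - (nsq_val eps)%:P * Y ^+ 2 = unif o *: D + 'X + Q * chi.
    by rewrite -DE; ring.
  have ev0 : ev chi = 0 by rewrite /ev -chiE Cayley_Hamilton.
  rewrite !evD evM ev0 mulmx0 addr0 evX addrC -mul_polyC evM evC mul_scalar_mx.
  by [].
have Tk : redk T = redk H by apply/redk_eqP; exists (ev D).
have uT : T \in unitmx by rewrite unitmx_redk Tk -unitmx_redk.
have Tc m A : comm_mod m H A -> comm_mod m T A.
  by move=> hA; rewrite TE; apply: comm_modD => //; apply/comm_modZ/ev_comm.
have sT : star cj T = T by rewrite /T starM starK.
have HH m : comm_mod m H H by [].
have TH : T *m H = H *m T by apply/comm_modP => m; apply: Tc.
(* K0 is corrected by the square root S of G, which is congruent to 1: as S commutes with T, the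
   norm of K0 S is S T S = T G = H. *)
pose G := H *m invmx T.
have Gc m A : comm_mod m H A -> comm_mod m G A.
  by move=> hA; apply: comm_modM => //; apply: comm_mod_inv => //; apply: Tc.
have Gk : redk G = 1%:M.
  by rewrite /G map_mxM -Tk -map_mxM mulmxV // map_mx1.
have TV : invmx T *m H = H *m invmx T.
  by apply/comm_modP => m; apply: comm_mod_inv => //; apply: Tc.
have sG : star cj G = G.
  have: star cj (G *m T) = star cj H by rewrite /G mulmxKV.
  by rewrite starM sT sH => e; rewrite -[LHS](mulKmx uT) e TV.
have [S [SS Sk sS Sc]] := sqrt_mx hodd Gk.
have ST : S *m T = T *m S.
  apply/comm_modP => m; apply: Sc; apply: Gc; apply: comm_mod_sym; exact: Tc.
exists (K0 *m S); split; last first.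
  by move=> m A hA; apply: comm_modM; [apply: K0c|apply/Sc/Gc].
rewrite starM (sS sG) mulmxA -(mulmxA S) -/T ST -mulmxA SS /G mulmxA TH.
by rewrite mulmxK.
Qed.

End HermitianNorm.

(** * Unitary classes and shadows *)

Section Conjugation.
Local Opaque invmx mulmx.
Variables (R : comUnitRingType) (n : nat) (K : 'M[R]_n).
Hypothesis uK : K \in unitmx.
Implicit Types X M : 'M[R]_n.

Lemma conj_mulr X M :
  invmx K *m X *m K *m M = invmx K *m (X *m (K *m M *m invmx K)) *m K.
Proof. by rewrite !mulmxA (mulmxKV uK). Qed.

Lemma conj_mull X M :
  M *m (invmx K *m X *m K) = invmx K *m (K *m M *m invmx K *m X) *m K.
Proof. by rewrite !mulmxA (mulVmx uK) mul1mx. Qed.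

Lemma conj_inj X M : invmx K *m X *m K = invmx K *m M *m K -> X = M.
Proof.
move=> /(congr1 (fun Y => K *m Y *m invmx K)).
by rewrite !mulmxA (mulmxV uK) !mul1mx !(mulmxK uK).
Qed.

Lemma conjK_inv X : K *m (invmx K *m X *m K) *m invmx K = X.
Proof. by rewrite !mulmxA (mulmxV uK) mul1mx (mulmxK uK). Qed.

Lemma conj_mul X M :
  K *m X *m invmx K *m (K *m M *m invmx K) = K *m (X *m M) *m invmx K.
Proof. by rewrite !mulmxA (mulmxKV uK). Qed.

End Conjugation.

Section Classes.
Local Opaque star invmx half Oinv mulmx map_mx.
Variables (o : compact_dvr) (eps : nonsquare_unit o).
Hypothesis hodd : odd_residue_char o.
Local Notation O := (quadext eps).
Local Notation k2 := (residue_field eps).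
Local Notation cj := (@quadext_conj o eps).
Local Notation pi := (qunif eps).
Local Notation redm m := (map_mx (@Defs.Ored o eps m)).
Local Notation redk := (map_mx (@kred o eps)).

(** The Lie algebra of the unitary group of the form H; for H = 1 these are the anti-hermitian
    matrices. *)
Definition skew_for (H X : 'M[O]_3) : Prop := star cj X *m H = - (H *m X).

Definition herm_form (H : 'M[O]_3) : Prop := star cj H = H /\ H \in unitmx.

Lemma mx_inverse_unitmx (R : comUnitRingType) n (g h : 'M[R]_n) :
  mx_inverse g h -> g \in unitmx /\ h = invmx g.
Proof.
move=> [gh hg]; have [ug uh] := mulmx1_unit gh.
by split=> //; rewrite -[LHS](mulKmx ug) gh mulmx1.
Qed.

Lemma unitmx_inverse (R : comUnitRingType) n (g : 'M[R]_n) :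
  g \in unitmx -> mx_inverse g (invmx g).
Proof. by move=> ug; split; rewrite ?mulmxV ?mulVmx. Qed.

Lemma conj_formE (K X : 'M[O]_3) : K \in unitmx ->
  K *m X *m invmx K = star cj (invmx K) *m (star cj K *m K *m X) *m invmx K.
Proof.
move=> uK; congr (_ *m _); rewrite !mulmxA -starM (mulmxV uK).
by rewrite star1 mul1mx.
Qed.

Lemma star_conj_formE (K X : 'M[O]_3) : K \in unitmx ->
  star cj (K *m X *m invmx K) =
  star cj (invmx K) *m (star cj X *m (star cj K *m K)) *m invmx K.
Proof.
move=> uK; rewrite !starM -[RHS]mulmxA; congr (_ *m _).
by rewrite -!mulmxA (mulmxV uK) mulmx1.
Qed.

Lemma skew_conj H M : herm_form H -> skew_for H M ->
  exists K, [/\ K \in unitmx, star cj K *m K = H &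
    star cj (K *m M *m invmx K) = - (K *m M *m invmx K)].
Proof.
move=> [sH uH] skM; have [K [KH _]] := hermitian_norm hodd sH uH.
have uK : K \in unitmx by move: uH; rewrite -KH unitmx_mul => /andP[].
exists K; split=> //.
by rewrite (star_conj_formE M uK) (conj_formE M uK) KH skM mulmxN mulNmx.
Qed.

Variable l : nat.
Hypothesis l0 : (0 < l)%N.
Local Notation gl3 := 'M[Oq eps l]_3.

Lemma redm_inverse (g : 'M[O]_3) : g \in unitmx ->
  mx_inverse (redm l g) (redm l (invmx g)).
Proof. by move=> ug; split; rewrite -map_mxM ?mulmxV ?mulVmx // map_mx1. Qed.

Lemma mx_inverse_lift (g h : gl3) : mx_inverse g h ->
  exists G, [/\ G \in unitmx, g = redm l G & h = redm l (invmx G)].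
Proof.
have [G ->] := redm_lift g; have [H ->] := redm_lift h.
move=> [gh hg]; have GH : redm l (G *m H) = redm l 1%:M by rewrite map_mxM gh map_mx1.
have uG : G \in unitmx.
  rewrite unitmx_redk; have e : redk G *m redk H = 1%:M.
    rewrite -map_mxM (redm_redk l0 GH) map_mx1; reflexivity.
  exact: (proj1 (mulmx1_unit e)).
exists G; split=> //.
rewrite -[redm l H]mul1mx -(map_mx1 (@Defs.Ored o eps l)) -(mulVmx uG) map_mxM -mulmxA.
by rewrite gh mulmx1.
Qed.

Lemma GL_similarP (A B : 'M[O]_3) : GL_similar (redm l A) (redm l B) <->
  exists g, g \in unitmx /\ redm l (A *m g) = redm l (g *m B).
Proof.
split=> [[g [h [/mx_inverse_lift[G [uG -> ->]] AB]]]|[g [ug AB]]].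
  exists G; split=> //; rewrite map_mxM AB -!map_mxM -!mulmxA.
  by rewrite mulVmx // mulmx1.
exists (redm l g), (redm l (invmx g)); split; first exact: redm_inverse.
by rewrite -{1}(mulmxK ug A) map_mxM AB map_mxM.
Qed.

Lemma GL_similar_sym (A B : gl3) : GL_similar A B -> GL_similar B A.
Proof.
move=> [g [h [[gh hg] ->]]]; exists h, g; split; first by split.
by rewrite !mulmxA hg mul1mx -mulmxA hg mulmx1.
Qed.

Lemma GL_similar_trans (A B C : gl3) :
  GL_similar A B -> GL_similar B C -> GL_similar A C.
Proof.
move=> [g [h [[gh hg] ->]]] [g' [h' [[gh' hg'] ->]]].
exists (g *m g'), (h' *m h); split; last by rewrite !mulmxA.
split; first by rewrite mulmxA -(mulmxA g) gh' mulmx1.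
by rewrite mulmxA -(mulmxA h') hg mulmx1.
Qed.

Lemma gu3_redm (A : 'M[O]_3) : star cj A = - A -> gu3 eps l (redm l A).
Proof.
by move=> sA; rewrite /gu3 /gu /= star_redm sA map_mxN addNr.
Qed.

Lemma skew_part m n (A : 'M[O]_n) : redm m (star cj A) = redm m (- A) ->
  exists A', star cj A' = - A' /\ redm m A' = redm m A.
Proof.
move=> /redm_eqP[Z sA]; exists (half eps *: (A - star cj A)); split.
  rewrite starZ /= (conj_half eps hodd) starB starK -scalerN.
  by rewrite opprB.
apply/redm_eqP; exists (- (half eps *: Z)); rewrite sA opprD opprK addrA.
rewrite scalerDr -mulr2n -scaler_nat scalerA (mulrC _ 2%:R) (half2 eps hodd).
by rewrite scale1r !scalerN !scalerA (mulrC _ (half eps)).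
Qed.

Lemma gu3_lift (A : gl3) : gu3 eps l A -> exists A', star cj A' = - A' /\ A = redm l A'.
Proof.
have [A0 ->] := redm_lift A; rewrite /gu3 /gu /= star_redm => /eqP.
rewrite addr_eq0 -map_mxN => /eqP/skew_part[A' [sA' <-]].
by exists A'.
Qed.

(** As A and B are anti-hermitian, g^* intertwines them in the opposite direction, so H = g^* g
    commutes with B modulo pi^l. A matrix K with K^* K = H that inherits this commutation makes g
    K^-1 unitary and still intertwining. *)
Lemma unitary_similar (A B g : 'M[O]_3) : star cj A = - A -> star cj B = - B ->
  g \in unitmx -> redm l (A *m g) = redm l (g *m B) ->
  exists u, star cj u *m u = 1%:M /\ redm l (A *m u) = redm l (u *m B).
Proof.
move=> sA sB ug Ag; pose H := star cj g *m g.
have sg : star cj g \in unitmx.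
  have e : star cj g *m star cj (invmx g) = 1%:M by rewrite -starM (mulVmx ug) star1.
  exact: (proj1 (mulmx1_unit e)).
have sH : star cj H = H by rewrite starM starK.
have uH : H \in unitmx by rewrite unitmx_mul sg ug.
have red_star (X Y : 'M[O]_3) : redm l X = redm l Y -> redm l (star cj X) = redm l (star cj Y).
  by rewrite -!star_redm => ->.
have gA : redm l (star cj g *m A) = redm l (B *m star cj g).
  have := red_star _ _ Ag; rewrite !starM sA sB mulmxN mulNmx !map_mxN.
  exact: oppr_inj.
have HB : comm_mod l H B.
  rewrite /comm_mod /H -mulmxA map_mxM -Ag -map_mxM mulmxA map_mxM gA -map_mxM.
  by rewrite mulmxA.
have [K [KH Kc]] := hermitian_norm hodd sH uH.
have uK : K \in unitmx by move: uH; rewrite -KH unitmx_mul => /andP[].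
have usK : star cj K \in unitmx by move: uH; rewrite -KH unitmx_mul => /andP[].
exists (g *m invmx K); split.
  rewrite starM -mulmxA (mulmxA _ g) -/H -KH (mulmxK uK) -starM.
  by rewrite (mulmxV uK) star1.
rewrite mulmxA map_mxM Ag -map_mxM -!mulmxA map_mxM -(comm_mod_inv uK (Kc _ _ HB)).
exact/esym/map_mxM.
Qed.

Lemma class_orbit (M A : gl3) : gu3 eps l A -> GL_similar M A ->
  associated_class eps l M = Ad_orbit A.
Proof.
move=> gA MA; apply/seteqP; split=> B; rewrite /associated_class /sim_class /=.
  move=> [BM gB]; have := GL_similar_trans BM MA.
  have [A' [sA' AE]] := gu3_lift gA; have [B' [sB' BE]] := gu3_lift gB.
  rewrite AE BE => /GL_similarP[g [ug BgA]].
  have [u [su Bu]] := unitary_similar sB' sA' ug BgA.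
  have uu : u \in unitmx by case/mulmx1_unit: su.
  exists u, (invmx u); split; first split=> //.
  - by exists (invmx u); exact: unitmx_inverse.
  - exact: unitmx_inverse.
  by rewrite -{1}(mulmxK uu B') map_mxM Bu map_mxM.
move=> [g [h [[Gg sg] gh BE]]]; have [ug hE] := mx_inverse_unitmx gh.
have [A' [sA' AE]] := gu3_lift gA; split.
  apply: GL_similar_trans (GL_similar_sym MA).
  exists (redm l g), (redm l h); split; last exact: BE.
  by rewrite hE; apply: redm_inverse.
have gE : star cj g = h by rewrite hE -[LHS](mulmxK ug) sg mul1mx.
have -> : B = redm l (g *m A' *m h) by rewrite BE AE -!map_mxM.
apply: gu3_redm; rewrite !starM gE -gE starK sA'.
by rewrite mulNmx mulmxN mulmxA.
Qed.

Lemma redk_invmx (K : 'M[O]_3) : K \in unitmx -> redk (invmx K) = invmx (redk K).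
Proof.
move=> uK; have uk : redk K \in unitmx by rewrite -unitmx_redk.
by rewrite -[LHS](mulmxK uk) -map_mxM (mulVmx uK) map_mx1 mul1mx.
Qed.

Lemma mxminpoly_conj (F : fieldType) n (V S : 'M[F]_n.+1) : V \in unitmx ->
  mxminpoly (V *m S *m invmx V) = mxminpoly S.
Proof. by move=> uV; rewrite -(conjumx S uV) (mxminpoly_uconj S uV). Qed.

Lemma shadow_typeP (H M : 'M[O]_3) (S : 'M[k2]_3) T :
  herm_form H -> skew_for H M ->
  star (@kconj o eps) S *m redk H = - (redk H *m S) ->
  min_poly_of_type (@kconj o eps) T (mxminpoly S) ->
  (forall X, comm_mod l X M -> redk X *m S = S *m redk X) ->
  (forall X, X *m S = S *m X -> exists2 X', redk X' = X & comm_mod l X' M) ->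
  shadow_has_type (associated_class eps l (redm l M)) T.
Proof.
move=> hH skM skS mS comS liftS; have [K [uK KH]] := skew_conj hH skM.
have [A AE] : exists A, A = K *m M *m invmx K by eexists.
rewrite -AE => sA.
have ukK : redk K \in unitmx by rewrite -unitmx_redk.
have ukV := redk_invmx uK.
have [S' S'E] : exists S', S' = redk K *m S *m invmx (redk K) by eexists.
have sS' : star (@kconj o eps) S' = - S'.
  have [S0 S0E] := redk_lift S.
  have S'E0 : S' = redk (K *m S0 *m invmx K).
    by rewrite S'E S0E -ukV -map_mxM -map_mxM.
  rewrite S'E0 star_redk (star_conj_formE S0 uK) (conj_formE S0 uK) KH -map_mxN.
  rewrite -mulNmx -mulmxN; apply: redk_mul3.
  by rewrite map_mxN !map_mxM -(star_redk S0) -S0E skS.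
have comm_up (X : 'M[O]_3) : comm_mod l X A -> redk X *m S' = S' *m redk X.
  move=> cX; have := comS (invmx K *m X *m K); rewrite /comm_mod.
  rewrite (conj_mulr uK) (conj_mull uK) -AE => /(_ (redm_mul3 _ _ cX)).
  have -> : redk (invmx K *m X *m K) = invmx (redk K) *m redk X *m redk K.
    by rewrite -ukV -map_mxM -map_mxM.
  move=> h; apply: (conj_inj ukK).
  have e2 := conj_mulr ukK (redk X) S.
  have e3 := conj_mull ukK (redk X) S.
  rewrite -S'E in e2 e3.
  exact: etrans (esym e2) (etrans h e3).
have lift_up (X : 'M[k2]_3) : X *m S' = S' *m X ->
    exists2 X', redk X' = X & comm_mod l X' A.
  move=> cX; have [|Y' Y'E cY] := liftS (invmx (redk K) *m X *m redk K).
    by rewrite (conj_mulr ukK) (conj_mull ukK) -S'E cX.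
  exists (K *m Y' *m invmx K).
    by rewrite !map_mxM Y'E ukV (conjK_inv ukK).
  by rewrite /comm_mod AE !(conj_mul uK); apply: redm_mul3.
(* Since A is anti-hermitian, its centraliser modulo pi^l is stable under [star]. *)
have comm_star X : comm_mod l X A -> comm_mod l (star cj X) A.
  move=> cX; have : redm l (star cj (X *m A)) = redm l (star cj (A *m X)).
    by rewrite -!star_redm cX.
  rewrite !starM sA mulNmx mulmxN !map_mxN => /oppr_inj.
  by move=> h; apply: comm_mod_sym.
exists S'; split.
- by rewrite /gu /= sS' addNr.
- by rewrite S'E (mxminpoly_conj _ ukK).
exists (redm l A).
  split; last exact: gu3_redm.
  exists (redm l K), (redm l (invmx K)); split; first exact: redm_inverse.
  by rewrite AE -map_mxM -map_mxM.
congr pair; apply/seteqP; split.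
- move=> _ [g [[Gg sg] cg] <-]; split.
    split; last by rewrite star_redk -map_mxM sg map_mx1.
    have [_ ug] := mulmx1_unit sg.
    exists (redk (invmx g)).
    by split; rewrite -map_mxM ?mulmxV ?mulVmx // map_mx1.
  by apply: comm_up; rewrite /comm_mod !map_mxM.
- move=> g [[_ sg] /lift_up[X XE cX]].
  have X1 : redk (star cj X *m X) = 1%:M by rewrite map_mxM -star_redk XE.
  have [R [RR Rk sR Rc]] := sqrt_mx hodd X1.
  have uR : R \in unitmx by rewrite unitmx_redk Rk unitmx1.
  have {}sR : star cj R = R by apply: sR; rewrite starM starK.
  have sRV : star cj (invmx R) = invmx R.
    by rewrite -[LHS](mulmxK uR) -{2}sR -starM (mulmxV uR) star1 mul1mx.
  have cR : comm_mod l R A by apply/Rc/comm_modM => //; apply: comm_star.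
  have sXR : star cj (X *m invmx R) *m (X *m invmx R) = 1%:M.
    by rewrite starM sRV -mulmxA (mulmxA (star _ _)) -RR (mulmxK uR) (mulVmx uR).
  have [_ uXR] := mulmx1_unit sXR.
  exists (X *m invmx R).
    split; last by rewrite -!map_mxM; apply: comm_modM => //; apply: comm_mod_inv.
    by split=> //; exists (invmx (X *m invmx R)); exact: unitmx_inverse.
  by rewrite map_mxM (redk_invmx uR) Rk invmx1 mulmx1 XE.
- move=> _ [X [sX cX] <-]; split; last by apply: comm_up; rewrite /comm_mod !map_mxM.
  by rewrite /gu /= star_redk -map_mxD sX map_mx0.
- move=> Y [sY /lift_up[X XE cX]].
  exists (half eps *: (X - star cj X)).
    split; last first.
      by rewrite -!map_mxM; apply/comm_modZ/comm_modB => //; apply: comm_star.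
    by rewrite /gu /= starZ (conj_half eps hodd) starB starK -scalerDr addrC subrKA subrr scaler0.
  rewrite map_mxZ map_mxB -star_redk XE; move/eqP: sY; rewrite addr_eq0 => /eqP ->.
  rewrite opprK -mulr2n -scaler_nat scalerA -(rmorph_nat (@kred o eps)) -rmorphM.
  by rewrite mulrC (half2 eps hodd) rmorph1 scale1r.
Qed.

End Classes.

(** * 3 x 3 matrices by their entries, and companion matrices *)

Definition mx3 (R : Type) (a b c d e f g h k : R) : 'M[R]_3 :=
  \matrix_(i, j) match nat_of_ord i, nat_of_ord j with
    | 0, 0 => a | 0, 1 => b | 0, _ => c
    | 1, 0 => d | 1, 1 => e | 1, _ => f
    | _, 0 => g | _, 1 => h | _, _ => k
    end%N.

Definition i0 : 'I_3 := @Ordinal 3 0 isT.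
Definition i1 : 'I_3 := @Ordinal 3 1 isT.
Definition i2 : 'I_3 := @Ordinal 3 2 isT.

Lemma ord3P (P : 'I_3 -> Prop) : P i0 -> P i1 -> P i2 -> forall i, P i.
Proof.
move=> h0 h1 h2 [[|[|[|i]]] hi] //; [move: h0|move: h1|move: h2];
  by congr P; apply: val_inj.
Qed.

Section Mx3.
Variable R : comPzRingType.
Implicit Types a b c d e f g h k : R.

Lemma mx3_ex (A : 'M[R]_3) :
  A = mx3 (A i0 i0) (A i0 i1) (A i0 i2) (A i1 i0) (A i1 i1) (A i1 i2)
          (A i2 i0) (A i2 i1) (A i2 i2).
Proof. by apply/matrixP; do 2!elim/ord3P; rewrite mxE. Qed.

Lemma mx3_surj (A : 'M[R]_3) :
  exists a b c d e f g h k, A = mx3 a b c d e f g h k.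
Proof. by do 9!eexists; exact: mx3_ex. Qed.

Lemma mx3_inj a b c d e f g h k a' b' c' d' e' f' g' h' k' :
  mx3 a b c d e f g h k = mx3 a' b' c' d' e' f' g' h' k' ->
  [/\ [/\ a = a', b = b' & c = c'], [/\ d = d', e = e' & f = f'] &
      [/\ g = g', h = h' & k = k']].
Proof.
move=> /matrixP E; have := (E i0 i0, E i0 i1, E i0 i2, (E i1 i0, E i1 i1, E i1 i2),
  (E i2 i0, E i2 i1, E i2 i2)).
by rewrite !mxE /= => -[[[[-> ->] ->] [[-> ->] ->]] [[-> ->] ->]].
Qed.

Lemma mx3D a b c d e f g h k a' b' c' d' e' f' g' h' k' :
  mx3 a b c d e f g h k + mx3 a' b' c' d' e' f' g' h' k' =
  mx3 (a + a') (b + b') (c + c') (d + d') (e + e') (f + f') (g + g') (h + h') (k + k').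
Proof. by apply/matrixP; do 2!elim/ord3P; rewrite !mxE. Qed.

Lemma mx3N a b c d e f g h k :
  - mx3 a b c d e f g h k =
  mx3 (- a) (- b) (- c) (- d) (- e) (- f) (- g) (- h) (- k).
Proof. by apply/matrixP; do 2!elim/ord3P; rewrite !mxE. Qed.

Lemma mx3Z x a b c d e f g h k :
  x *: mx3 a b c d e f g h k =
  mx3 (x * a) (x * b) (x * c) (x * d) (x * e) (x * f) (x * g) (x * h) (x * k).
Proof. by apply/matrixP; do 2!elim/ord3P; rewrite !mxE. Qed.

Lemma mx3_scalar a : a%:M = mx3 a 0 0 0 a 0 0 0 a.
Proof. by apply/matrixP; do 2!elim/ord3P; rewrite !mxE. Qed.

Lemma mx3_0 : 0 = mx3 0 0 0 0 0 0 0 0 0 :> 'M[R]_3.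
Proof. by apply/matrixP; do 2!elim/ord3P; rewrite !mxE. Qed.

Lemma mx3_tr a b c d e f g h k :
  (mx3 a b c d e f g h k)^T = mx3 a d g b e h c f k.
Proof. by apply/matrixP; do 2!elim/ord3P; rewrite !mxE. Qed.

Lemma sum3 (F : 'I_3 -> R) : \sum_i F i = F i0 + F i1 + F i2.
Proof.
rewrite !big_ord_recl big_ord0 addr0 addrA.
by congr (F _ + F _ + F _); apply: val_inj.
Qed.

Lemma mx3M a b c d e f g h k a' b' c' d' e' f' g' h' k' :
  mx3 a b c d e f g h k *m mx3 a' b' c' d' e' f' g' h' k' =
  mx3 (a * a' + b * d' + c * g') (a * b' + b * e' + c * h') (a * c' + b * f' + c * k')
      (d * a' + e * d' + f * g') (d * b' + e * e' + f * h') (d * c' + e * f' + f * k')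
      (g * a' + h * d' + k * g') (g * b' + h * e' + k * h') (g * c' + h * f' + k * k').
Proof. by apply/matrixP; do 2!elim/ord3P; rewrite !mxE sum3 !mxE. Qed.

Lemma mx3_trace a b c d e f g h k : \tr (mx3 a b c d e f g h k) = a + e + k.
Proof. by rewrite /mxtrace sum3 !mxE. Qed.

Lemma mx3_det a b c d e f g h k : \det (mx3 a b c d e f g h k) =
  a * (e * k - f * h) - b * (d * k - f * g) + c * (d * h - e * g).
Proof.
rewrite (expand_det_row _ i0) sum3 !mxE /= /cofactor.
rewrite !(expand_det_row _ (0 : 'I_2)) !big_ord_recl !big_ord0 /cofactor !det_mx11 !mxE /=.
rewrite /bump /= ?expr0 ?addn0 ?add0n ?addn1 ?expr1 ?sqrrN ?expr1n; ring.
Qed.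

Lemma mx3_adj a b c d e f g h k : \adj (mx3 a b c d e f g h k) =
  mx3 (e * k - f * h) (c * h - b * k) (b * f - c * e)
      (f * g - d * k) (a * k - c * g) (c * d - a * f)
      (d * h - e * g) (b * g - a * h) (a * e - b * d).
Proof.
apply/matrixP; do 2!elim/ord3P; rewrite !mxE /cofactor;
rewrite !(expand_det_row _ (0 : 'I_2)) !big_ord_recl !big_ord0 /cofactor !det_mx11 !mxE /=;
rewrite /bump /= !expr0 ?addn0 ?add0n ?addn1 ?expr1 ?sqrrN ?expr1n; ring.
Qed.

Definition comp3 c0 c1 c2 : 'M[R]_3 := mx3 0 0 (- c0) 1 0 (- c1) 0 1 (- c2).

(** The first basis vector e_1 is cyclic, C e_1 = e_2 and C e_2 = e_3; so X is determined by its
    first column (a, d, g), which is also that of a + d C + g C^2. *)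
Lemma comp3_cent c0 c1 c2 (X : 'M[R]_3) (C := comp3 c0 c1 c2) :
  X *m C = C *m X -> exists x0 x1 x2, X = x0%:M + x1 *: C + x2 *: (C *m C).
Proof.
have [a [b [c [d [e [f [g [h [k ->]]]]]]]]] := mx3_surj X.
rewrite /C /comp3 !mx3M => /mx3_inj[[Ea Eb Ec] [Ed Ee Ef] [Eg Eh Ek]].
exists a, d, g; rewrite !mx3_scalar !mx3Z !mx3D.
have {}Ea : b = - c0 * g by transitivity (a * 0 + b * 1 + c * 0); [ring|rewrite Ea; ring].
have {}Ed : e = a - c1 * g by transitivity (d * 0 + e * 1 + f * 0); [ring|rewrite Ed; ring].
have {}Eg : h = d - c2 * g by transitivity (g * 0 + h * 1 + k * 0); [ring|rewrite Eg; ring].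
have {}Eb : c = - c0 * h by transitivity (a * 0 + b * 0 + c * 1); [ring|rewrite Eb; ring].
have {}Ee : f = b - c1 * h by transitivity (d * 0 + e * 0 + f * 1); [ring|rewrite Ee; ring].
have {}Eh : k = e - c2 * h by transitivity (g * 0 + h * 0 + k * 1); [ring|rewrite Eh; ring].
by congr mx3; rewrite ?Eh ?Ee ?Eb ?Eg ?Ed ?Ea; ring.
Qed.

End Mx3.

Lemma map_mx3 (R S : comPzRingType) (p : {rmorphism R -> S}) a b c d e f g h k :
  map_mx p (mx3 a b c d e f g h k) =
  mx3 (p a) (p b) (p c) (p d) (p e) (p f) (p g) (p h) (p k).
Proof. by apply/matrixP; do 2!elim/ord3P; rewrite !mxE. Qed.

(** * Minimal polynomials and centralisers of cyclic matrices over a field *)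

Section MinimalPolynomials.
Variable F : fieldType.

Lemma poly_size3 (p : {poly F}) : (size p <= 3)%N ->
  p = (p`_0)%:P + (p`_1)%:P * 'X + (p`_2)%:P * 'X^2.
Proof.
move=> le3; apply/polyP => k; rewrite !coefD !coefCM coefC coefX coefXn.
case: k => [|[|[|k]]] /=; rewrite ?mulr0 ?mulr1 ?addr0 ?add0r //.
by apply: nth_default; apply: leq_trans le3 _.
Qed.

Lemma poly_size2 (p : {poly F}) : (size p <= 2)%N -> p = (p`_0)%:P + (p`_1)%:P * 'X.
Proof.
move=> le2; rewrite {1}(poly_size3 (leqW le2)).
by rewrite [p`_2]nth_default // polyC0 mul0r addr0.
Qed.

Definition cubic (c0 c1 c2 : F) : {poly F} := Poly [:: c0; c1; c2; 1].

Lemma polyseq_cubic c0 c1 c2 : cubic c0 c1 c2 = [:: c0; c1; c2; 1] :> seq F.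
Proof. by rewrite (@PolyK _ 0) //= oner_eq0. Qed.

Lemma size_cubic c0 c1 c2 : size (cubic c0 c1 c2) = 4%N.
Proof. by rewrite polyseq_cubic. Qed.

Lemma cubic_monic c0 c1 c2 : cubic c0 c1 c2 \is monic.
Proof. by rewrite monicE lead_coefE polyseq_cubic. Qed.

Lemma cubicE c0 c1 c2 :
  cubic c0 c1 c2 = 'X^3 + c2%:P * 'X^2 + c1%:P * 'X + c0%:P.
Proof. by rewrite /cubic /= !cons_poly_def polyC1; ring. Qed.

Lemma horner_mx_comp3 c0 c1 c2 : horner_mx (comp3 c0 c1 c2) (cubic c0 c1 c2) = 0.
Proof.
rewrite cubicE !exprS expr0 mulr1 !(rmorphD, rmorphM) /= !horner_mx_C horner_mx_X.
rewrite -!mulmxE !mul_scalar_mx /comp3 mx3_scalar.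
by rewrite !(mx3M, mx3Z, mx3D) mx3_0; congr mx3; ring.
Qed.

Lemma mxminpoly_monic_eq n (A : 'M[F]_n.+1) p : p \is monic -> horner_mx A p = 0 ->
  (size p <= size (mxminpoly A))%N -> mxminpoly A = p.
Proof.
move=> mp /mxminpoly_min dp sp; apply/eqP.
rewrite -eqp_monic ?mxminpoly_monic // -dvdp_size_eqp //.
by rewrite eqn_leq sp andbT dvdp_leq ?monic_neq0.
Qed.

(** For q of degree at most 2 the first column of q(C) lists the coefficients of q, so no such q
    annihilates C unless it is zero. *)
Lemma mxminpoly_comp3 c0 c1 c2 : mxminpoly (comp3 c0 c1 c2) = cubic c0 c1 c2.
Proof.
apply: mxminpoly_monic_eq; [exact: cubic_monic|exact: horner_mx_comp3|].
rewrite size_cubic ltnNge; apply/negP => le3; set C := comp3 _ _ _ in le3.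
have qE := poly_size3 le3.
have := mx_root_minpoly C; rewrite qE.
move: (_`_0) (_`_1) (_`_2) qE => q0 q1 q2 qE.
rewrite expr2 !(rmorphD, rmorphM) /= !horner_mx_C horner_mx_X -!mulmxE.
rewrite !mul_scalar_mx mx3_scalar /C /comp3 !(mx3M, mx3Z, mx3D) mx3_0 => /mx3_inj[[e0 _ _] [e1 _ _] [e2 _ _]].
have q00 : q0 = 0 by rewrite -[RHS]e0; ring.
have q10 : q1 = 0 by rewrite -[RHS]e1; ring.
have q20 : q2 = 0 by rewrite -[RHS]e2; ring.
have := monic_neq0 (mxminpoly_monic C).
by rewrite qE q00 q10 q20 polyC0 !mul0r !addr0 eqxx.
Qed.

Lemma mxminpoly_similar (S T g : 'M[F]_3) : g \in unitmx -> S *m g = g *m T ->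
  mxminpoly S = mxminpoly T.
Proof.
move=> ug e; have -> : S = g *m T *m invmx g by rewrite -e (mulmxK ug).
exact: mxminpoly_conj.
Qed.

Lemma mxminpoly_degree2 (S : 'M[F]_3) a b : (forall c, S <> c%:M) ->
  (S - a%:M) *m (S - b%:M) = 0 -> mxminpoly S = ('X - a%:P) * ('X - b%:P).
Proof.
move=> nsc Sab; apply: mxminpoly_monic_eq.
- by rewrite monicMl monicXsubC.
- by rewrite rmorphM !rmorphB /= !horner_mx_C horner_mx_X -mulmxE.
rewrite size_Mmonic ?monicXsubC ?polyXsubC_eq0 // !size_XsubC /= ltnNge.
apply/negP => le2.
have qE := poly_size2 le2.
have := mx_root_minpoly S; rewrite qE.
move: (_`_0) (_`_1) qE => q0 q1 qE.
rewrite !(rmorphD, rmorphM) /= !horner_mx_C horner_mx_X -mulmxE mul_scalar_mx => /eqP.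
have [q10|q10] := eqVneq q1 0.
  rewrite q10 scale0r addr0 => /eqP /matrixP/(_ i0 i0); rewrite !mxE /= => q00.
  have := monic_neq0 (mxminpoly_monic S).
  by rewrite qE q10 [q0]q00 polyC0 mul0r addr0 eqxx.
rewrite addrC addr_eq0 => /eqP e; case: (nsc (- (q0 / q1))).
apply: (scalerI q10); rewrite e scale_scalar_mx -raddfN; congr (_%:M).
by rewrite mulrN mulrCA mulfV // mulr1.
Qed.

Lemma cyclic_cent (S g X : 'M[F]_3) c0 c1 c2 : g \in unitmx ->
  S *m g = g *m comp3 c0 c1 c2 -> X *m S = S *m X ->
  exists x0 x1 x2, X = x0%:M + x1 *: S + x2 *: (S *m S).
Proof.
move=> ug Sg XS.
have [|x0 [x1 [x2 XE]]] := @comp3_cent _ c0 c1 c2 (invmx g *m X *m g).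
  have -> : comp3 c0 c1 c2 = invmx g *m S *m g by rewrite -mulmxA Sg (mulKmx ug).
  have e (P Q : 'M[F]_3) :
      invmx g *m P *m g *m (invmx g *m Q *m g) = invmx g *m (P *m Q) *m g.
    by rewrite !mulmxA (mulmxK ug).
  by rewrite !e XS.
exists x0, x1, x2; have SE : S = g *m comp3 c0 c1 c2 *m invmx g by rewrite -Sg (mulmxK ug).
rewrite -[LHS](conjK_inv ug) XE SE (conj_mul ug) !mulmxDr !mulmxDl.
rewrite -!scalemxAr -!scalemxAl scalar_mxC; congr (_ + _ + _).
by rewrite (mulmxK ug).
Qed.

End MinimalPolynomials.

(** * Shadows of matrices d + pi^i B *)

Section AffineShadow.
Variables (o : compact_dvr) (eps : nonsquare_unit o).
Hypothesis hodd : odd_residue_char o.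
Local Notation O := (quadext eps).
Local Notation k2 := (residue_field eps).
Local Notation cj := (@quadext_conj o eps).
Local Notation kj := (@kconj o eps).
Local Notation pi := (qunif eps).
Local Notation redm m := (map_mx (@Defs.Ored o eps m)).
Local Notation redk := (map_mx (@kred o eps)).

Lemma star_mx3 a b c d e f g h k : star cj (mx3 a b c d e f g h k) =
  mx3 (cj a) (cj d) (cj g) (cj b) (cj e) (cj h) (cj c) (cj f) (cj k).
Proof. by rewrite /star mx3_tr map_mx3. Qed.

Lemma kstar_mx3 (a b c d e f g h k : k2) : star kj (mx3 a b c d e f g h k) =
  mx3 (kj a) (kj d) (kj g) (kj b) (kj e) (kj h) (kj c) (kj f) (kj k).
Proof. by apply/matrixP; do 2!elim/ord3P; rewrite !mxE. Qed.

Lemma skew_for_affine H d i (B : 'M[O]_3) : cj d = - d -> skew_for H B ->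
  skew_for H (d%:M + pi ^+ i *: B).
Proof.
move=> sd sB; rewrite /skew_for starD starZ star_scalar rmorphXn /= conj_pi sd.
rewrite mulmxDl -scalemxAl sB mulmxDr -scalemxAr mul_scalar_mx mul_mx_scalar opprD.
by rewrite scaleNr scalerN.
Qed.

Lemma redm_scale m i p q (A B : 'M[O]_(p, q)) :
  redm (i + m) (pi ^+ i *: A) = redm (i + m) (pi ^+ i *: B) <-> redm m A = redm m B.
Proof.
split=> /redm_eqP[Z ZE]; apply/redm_eqP; exists Z; last by rewrite ZE scalerDr scalerA exprD.
apply/matrixP => r s; apply: (@piXI _ eps i).
have /matrixP/(_ r s) := ZE; rewrite !mxE /= => ->.
by rewrite mulrDr mulrA exprD.
Qed.

Lemma affine_mul n (d c : O) (B g : 'M[O]_n) :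
  (d%:M + c *: B) *m g = d *: g + c *: (B *m g) /\
  g *m (d%:M + c *: B) = d *: g + c *: (g *m B).
Proof. by rewrite mulmxDl mulmxDr -scalemxAl -scalemxAr mul_scalar_mx mul_mx_scalar. Qed.

Lemma redm_affine_mul i n d (B C g : 'M[O]_3) :
  redm (i + n) ((d%:M + pi ^+ i *: B) *m g) = redm (i + n) (g *m (d%:M + pi ^+ i *: C)) <->
  redm n (B *m g) = redm n (g *m C).
Proof.
have [-> _] := affine_mul d (pi ^+ i) B g; have [_ ->] := affine_mul d (pi ^+ i) C g.
split=> /redm_eqP[Z ZE].
  apply/(redm_scale n i)/redm_eqP; exists Z.
  by apply: (addrI (d *: g)); rewrite addrA -ZE.
apply/redm_eqP; exists Z; rewrite ZE scalerDr addrA scalerA exprD; reflexivity.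
Qed.

Lemma comm_mod_affine m i d (X B : 'M[O]_3) :
  comm_mod (i + m) X (d%:M + pi ^+ i *: B) <-> comm_mod m X B.
Proof.
by split=> e; apply/esym; [apply/(redm_affine_mul i m d)|apply/redm_affine_mul]; apply/esym.
Qed.

Lemma affine_shadow l i (H B : 'M[O]_3) (S : 'M[k2]_3) d T : (i < l)%N ->
  herm_form H -> cj d = - d -> skew_for H B ->
  star kj S *m redk H = - (redk H *m S) ->
  min_poly_of_type kj T (mxminpoly S) ->
  (forall X, comm_mod (l - i) X B -> redk X *m S = S *m redk X) ->
  (forall X, X *m S = S *m X -> exists2 X', redk X' = X & comm_mod (l - i) X' B) ->
  shadow_has_type (associated_class eps l (redm l (d%:M + pi ^+ i *: B))) T.
Proof.
move=> il hH sd skB skS mS cS lS.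
have lE : l = (i + (l - i))%N by rewrite subnKC // ltnW.
apply: (shadow_typeP hodd hH _ skS mS).
- exact: skew_for_affine.
- by move=> X; rewrite {1}lE comm_mod_affine; apply: cS.
- move=> X /lS[X' <- cX']; exists X'; first by [].
  by rewrite {1}lE comm_mod_affine.
Qed.

(** What commutes with the cyclic reduction of S0 is a polynomial in it, and the same polynomial in
    S0 is a lift that commutes with B. Hence only one inclusion of centralisers is left as a
    hypothesis. *)
Lemma cyclic_shadow l i (H B S0 : 'M[O]_3) (g : 'M[k2]_3) d c0 c1 c2 T : (i < l)%N ->
  herm_form H -> cj d = - d -> skew_for H B ->
  star kj (redk S0) *m redk H = - (redk H *m redk S0) ->
  g \in unitmx -> redk S0 *m g = g *m comp3 c0 c1 c2 ->
  min_poly_of_type kj T (cubic c0 c1 c2) ->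
  S0 *m B = B *m S0 ->
  (forall X, comm_mod (l - i) X B -> redk X *m redk S0 = redk S0 *m redk X) ->
  shadow_has_type (associated_class eps l (redm l (d%:M + pi ^+ i *: B))) T.
Proof.
move=> il hH sd skB skS ug Sg mT SB cS.
apply: (affine_shadow il hH sd skB skS _ cS).
  by rewrite (mxminpoly_similar ug Sg) mxminpoly_comp3.
move=> X XS; have [x0 [x1 [x2 XE]]] := cyclic_cent ug Sg XS.
have [y0 y0E] := kred_surj x0; have [y1 y1E] := kred_surj x1.
have [y2 y2E] := kred_surj x2.
exists (y0%:M + y1 *: S0 + y2 *: (S0 *m S0)).
  by rewrite !map_mxD !map_mxZ map_mxM map_scalar_mx /= -y0E -y1E -y2E XE.
have c0' : comm_mod (l - i) S0 B by rewrite /comm_mod SB.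
apply: comm_modD; last by apply/comm_modZ/comm_modM.
by apply: comm_modD; [exact: comm_mod_scalar|exact: comm_modZ].
Qed.

End AffineShadow.

(** * Root patterns over the residue field and shadow types *)

Section RootTypes.
Variables (o : compact_dvr) (eps : nonsquare_unit o).
Hypothesis hodd : odd_residue_char o.
Local Notation O := (quadext eps).
Local Notation k2 := (residue_field eps).
Local Notation cj := (@quadext_conj o eps).
Local Notation kj := (@kconj o eps).
Local Notation kred := (@kred o eps).

Lemma kj_zmod : zmod_morphism kj.
Proof.
move=> x y; have [a ->] := kred_surj x; have [b ->] := kred_surj y.
by rewrite -rmorphB !kconj_red !rmorphB.
Qed.
HB.instance Definition _ := GRing.isZmodMorphism.Build k2 k2 kj kj_zmod.
Lemma kj_monoid : monoid_morphism kj.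
Proof.
split=> [|x y]; first by rewrite -(rmorph1 kred) kconj_red !rmorph1.
have [a ->] := kred_surj x; have [b ->] := kred_surj y.
by rewrite -rmorphM !kconj_red !rmorphM.
Qed.
HB.instance Definition _ := GRing.isMonoidMorphism.Build k2 k2 kj kj_monoid.

Lemma kjK : involutive kj.
Proof. by move=> x; have [a ->] := kred_surj x; rewrite !kconj_red conjK. Qed.

Lemma k2_two_neq0 : 2%:R != 0 :> k2.
Proof. by rewrite -(rmorph_nat kred) -unitOE two_unit. Qed.

Lemma kdlt_neq0 : kred (dlt eps) != 0.
Proof. by rewrite -unitOE dlt_unit. Qed.

Lemma kj_dlt : kj (kred (dlt eps)) = - kred (dlt eps).
Proof. by rewrite kconj_red conj_dlt rmorphN. Qed.

Lemma gu1_kj (x : k2) : gu1 kj x <-> kj x = - x.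
Proof.
by rewrite /gu1 /=; split=> [/eqP|->]; [rewrite addr_eq0 => /eqP|rewrite addNr].
Qed.

Lemma kred_emb_eq (a b : o) : kresred a = kresred b -> kred (emb eps a) = kred (emb eps b).
Proof.
move=> ab; have : kresred (a - b) = 0 by rewrite rmorphB /= ab subrr.
move=> /red_eq0P[c]; rewrite expr1 => cE; apply/kred_eqP; exists (emb eps c).
by rewrite pi_emb -rmorphM -cE -rmorphD addrC subrK.
Qed.

Lemma kj_real (x : k2) : kj x = x -> exists a, x = kred (emb eps a).
Proof.
have [y ->] := kred_surj x => e; exists y.1.
rewrite [in LHS](quadextE y) rmorphD /=; suff -> : kred (dlt eps * emb eps y.2) = 0 by rewrite addr0.
have : kred (cj (emb eps y.1 + dlt eps * emb eps y.2)) =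
    kred (emb eps y.1 + dlt eps * emb eps y.2) by rewrite -quadextE -kconj_red.
rewrite (rmorphD cj) (rmorphM cj) /= conj_dlt !conj_emb mulNr rmorphB rmorphD /=.
move=> /addrI /eqP; rewrite eq_sym -subr_eq0 opprK -mulr2n -mulr_natl mulf_eq0.
by rewrite (negPf k2_two_neq0) => /eqP.
Qed.

(** An element of k is a square in k or the class of eps times one, and eps is the square of delta;
    the root is accordingly fixed or negated by conjugation. *)
Lemma real_square (x : k2) : kj x = x ->
  exists r, x = r ^+ 2 /\ (kj r = r \/ kj r = - r).
Proof.
move=> /kj_real[a ->].
have eN (z : kres o) : z ^+ 2 != kresred (nsq_val eps).
  have [b ->] := kresred_surj z; apply/eqP => e.
  by apply: (nsq_nonsquare (n := eps) (x := b)); rewrite rmorphXn.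
have [[z aE]|[z aE]] := square_or_twisted (kresred a) eN.
  have [b bE] := kresred_surj z; exists (kred (emb eps b)).
  rewrite kconj_red conj_emb -!rmorphXn /=; split; last by left.
  by apply: kred_emb_eq; rewrite aE bE rmorphXn.
have [b bE] := kresred_surj z; exists (kred (dlt eps * emb eps b)).
rewrite kconj_red (rmorphM cj) /= conj_dlt conj_emb mulNr rmorphN; split; last by right.
rewrite -rmorphXn exprMn expr2 dltM -rmorphXn -rmorphM.
by apply: kred_emb_eq; rewrite aE bE rmorphM rmorphXn.
Qed.

(** The involution sending r to - conj r permutes the roots of a polynomial with these symmetries:
    it fixes both roots, or exchanges two distinct ones. *)
Definition root_pair (r1 r2 : k2) : Prop :=
  (kj r1 = - r1 /\ kj r2 = - r2) \/ (r1 = - kj r2 /\ r1 != r2).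

(** The discriminant is fixed by conjugation, so it has a square root that is fixed or negated. If
    negated, both roots of the polynomial lie in gu_1; if fixed and non-zero, the involution
    exchanges them. *)
Lemma quadratic_roots (b0 b1 : k2) : kj b1 = - b1 -> kj b0 = b0 ->
  exists r1 r2, [/\ b1 = - (r1 + r2), b0 = r1 * r2 & root_pair r1 r2].
Proof.
move=> sb1 sb0; have two0 := k2_two_neq0.
have [|r [rE rs]] := @real_square (b1 ^+ 2 - 4%:R * b0).
  by rewrite rmorphB rmorphXn rmorphM /= rmorph_nat sb1 sb0 sqrrN.
exists ((- b1 + r) / 2%:R), ((- b1 - r) / 2%:R); split.
- by field.
- have -> : b0 = (b1 ^+ 2 - r ^+ 2) / 4%:R.
    rewrite -rE; field; rewrite (_ : 4%:R = 2%:R * 2%:R) ?mulf_neq0 //.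
    by rewrite -natrM.
  field; rewrite two0 (_ : 4%:R = 2%:R * 2%:R) ?mulf_neq0 //.
  by rewrite -natrM.
have kjh (x : k2) : kj (x / 2%:R) = kj x / 2%:R by rewrite fmorph_div rmorph_nat.
case: rs => rs; last first.
  by left; rewrite !kjh !rmorphD !rmorphN /= sb1 rs; split; field.
have [r0|r0] := eqVneq r 0.
  by left; rewrite !kjh r0 subr0 addr0 rmorphN /= sb1; split; field.
right; split; first by rewrite kjh rmorphB rmorphN /= sb1 rs; field.
rewrite -subr_eq0 -mulrBl (_ : - b1 + r - (- b1 - r) = 2%:R * r); last by ring.
by rewrite mulrAC mulfV // mul1r.
Qed.

Lemma root_pair_type (s r1 r2 : k2) : kj s = - s -> root_pair r1 r2 ->
  s != r1 -> s != r2 -> exists2 T, List.In T [:: TypeT1; TypeT2; TypeM] &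
    min_poly_of_type kj T (('X - s%:P) * ('X - r1%:P) * ('X - r2%:P)).
Proof.
move=> ss rr s1 s2; have [r12|r12] := eqVneq r1 r2.
  case: rr => [[h1 h2]|[_]]; last by rewrite r12 eqxx.
  exists TypeM; first by right; right; left.
  exists s, r2; split=> //; try exact/gu1_kj.
  by rewrite r12 expr2 mulrA.
case: rr => [[h1 h2]|[h _]].
  exists TypeT1; first by left.
  exists s, r1, r2; split=> //; try exact/gu1_kj.
  by rewrite /= !inE !negb_or s1 s2 r12.
exists TypeT2; first by right; left.
exists s, r1, r2; split=> //; first exact/gu1_kj.
by rewrite /= !inE !negb_or s1 s2 r12.
Qed.

Lemma root_pair_typeN (s r1 r2 : k2) : kj s = - s -> root_pair r1 r2 ->
  exists2 T, List.In T [:: TypeT1; TypeT2; TypeT3; TypeM; TypeN] &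
    min_poly_of_type kj T (('X - s%:P) * ('X - r1%:P) * ('X - r2%:P)).
Proof.
move=> ss rr.
have [s1|s1] := eqVneq s r1; last have [s2|s2] := eqVneq s r2.
- case: rr => [[h1 h2]|[h1 h12]]; last first.
    by case/eqP: h12; move: ss; rewrite s1 {2}h1 opprK => /(can_inj kjK).
  have [r12|r12] := eqVneq r1 r2.
    exists TypeN; first by do 4!right; left.
    by exists r2; [exact/gu1_kj|rewrite s1 r12 !exprS expr0 mulr1 mulrA].
  exists TypeM; first by do 3!right; left.
  exists r2, r1; split; try exact/gu1_kj; first by rewrite eq_sym.
  by rewrite s1 expr2; ring.
- case: rr => [[h1 h2]|[h1 h12]]; last first.
    by case/eqP: h12; rewrite h1 -s2 ss opprK.
  exists TypeM; first by do 3!right; left.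
  exists r1, r2; split; try exact/gu1_kj; first by rewrite -s2 eq_sym.
  by rewrite s2 expr2; ring.
have [T Tin mT] := root_pair_type ss rr s1 s2; exists T => //.
by case: Tin => [<-|[<-|[<-|[]]]]; [left|right; left|do 3!right; left].
Qed.

Lemma cubic_roots (s r1 r2 : k2) :
  cubic (- (s * r1 * r2)) (s * r1 + s * r2 + r1 * r2) (- (s + r1 + r2)) =
  ('X - s%:P) * ('X - r1%:P) * ('X - r2%:P).
Proof. by rewrite cubicE !(polyCN, polyCD, polyCM); ring. Qed.

Lemma cubic_type (c0 c1 c2 : k2) : kj c0 = - c0 -> kj c1 = c1 -> kj c2 = - c2 ->
  exists2 T, List.In T [:: TypeT1; TypeT2; TypeT3; TypeM; TypeN] &
    min_poly_of_type kj T (cubic c0 c1 c2).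
Proof.
move=> s0 s1 s2.
have [nr|/existsNP[r rr]] := pselect (forall r, ~~ root (cubic c0 c1 c2) r).
  exists TypeT3; first by do 2!right; left.
  split; first exact: size_cubic.
  by apply: cubic_irreducible; rewrite ?size_cubic.
have rootE (x : k2) : (cubic c0 c1 c2).[x] = x ^+ 3 + c2 * x ^+ 2 + c1 * x + c0.
  by rewrite cubicE !hornerE.
have {}rr : r ^+ 3 + c2 * r ^+ 2 + c1 * r + c0 = 0.
  by apply/eqP; rewrite -rootE; move: rr => /negP; rewrite negbK.
have c0E : c0 = - (r * (r ^+ 2 + c2 * r + c1)).
  by apply/eqP; rewrite -addr_eq0 -[X in _ == X]rr; apply/eqP; ring.
(* With r also - conj r is a root. If they agree, the quadratic cofactor has the symmetries of
   [quadratic_roots]; if not, they form an exchanged pair and the third root lies in gu_1. *)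
have [rs|rs] := eqVneq (kj r) (- r).
  have [||r1 [r2 [e1 e0 r12]]] := @quadratic_roots (c1 + r * (c2 + r)) (c2 + r).
  - by rewrite rmorphD /= s2 rs; ring.
  - by rewrite rmorphD rmorphM rmorphD /= s1 s2 rs; ring.
  have [T Tin mT] := root_pair_typeN rs r12; exists T => //.
  move: mT; rewrite -cubic_roots; congr (min_poly_of_type _ _ (cubic _ _ _)).
  - rewrite c0E -mulrA -e0; ring.
  - rewrite -e0 -mulrDr -[r1 + r2]opprK -e1; ring.
  - rewrite -addrA -[r1 + r2]opprK -e1; ring.
pose r' := - kj r.
have rr' : r' ^+ 3 + c2 * r' ^+ 2 + c1 * r' + c0 = 0.
  have := congr1 kj rr; rewrite !(rmorphD, rmorphM, rmorphXn) rmorph0 /= s0 s1 s2.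
  by move=> e; apply/eqP; rewrite -oppr_eq0 -[X in _ == X]e /r'; apply/eqP; ring.
have rnr' : r - r' != 0 by rewrite /r' opprK addrC -[r]opprK subr_eq0 opprK.
have c1E : c1 = - (r ^+ 2 + r * r' + r' ^+ 2 + c2 * (r + r')).
  apply: (mulfI rnr'); apply/eqP; rewrite -subr_eq0 -[X in _ == X](subrr 0).
  by rewrite -{1}rr -rr'; apply/eqP; ring.
pose s := - c2 - r - r'.
have ss : kj s = - s.
  by rewrite /s /r' !(rmorphB, rmorphN) /= kjK s2; ring.
have [|T Tin mT] := @root_pair_typeN s r r' ss.
  right; split; first by rewrite /r' rmorphN /= kjK opprK.
  by rewrite -subr_eq0.
exists T => //; move: mT; rewrite -cubic_roots.
congr (min_poly_of_type _ _ (cubic _ _ _)); rewrite ?c0E ?c1E /s; ring.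
Qed.

(** The elements 0, delta and - delta are distinct because 2 is invertible, so one of them is
    left. *)
Lemma skew_avoiding (r1 r2 : k2) : exists s, [/\ kj s = - s, s != r1 & s != r2].
Proof.
have d0 := kdlt_neq0; set d := kred _ in d0.
have dd : d != - d.
  rewrite -subr_eq0 opprK -mulr2n -mulr_natl mulf_neq0 //; exact: k2_two_neq0.
have s0 : kj 0 = - 0 by rewrite rmorph0 oppr0.
have sd : kj d = - d by exact: kj_dlt.
have sNd : kj (- d) = - - d by rewrite rmorphN /= sd.
have [e|n1] := eqVneq 0 r1.
  have [e2|n2] := eqVneq d r2; last by exists d; rewrite sd -e d0 n2.
  by exists (- d); rewrite sNd -e oppr_eq0 d0 -e2 eq_sym dd.
have [e2|n2] := eqVneq 0 r2; last by exists 0; rewrite s0 n1 n2.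
have [e|n3] := eqVneq d r1; last by exists d; rewrite sd n3 -e2 d0.
by exists (- d); rewrite sNd -e2 oppr_eq0 d0 -e eq_sym dd.
Qed.

End RootTypes.

(** * Normal forms and their shadows *)

Lemma eq_sub_trans (V : zmodType) (x y u v : V) : u = v -> x - y = u - v -> x = y.
Proof. by move=> -> /eqP; rewrite subrr subr_eq0 => /eqP. Qed.

(** The columns of g are (1, 1, 0) and its first two images; the companion matrix on the right
    belongs to (t - s)(t^2 + b1 t + b0). *)
Lemma form_iii_cyclic (R : comPzRingType) (s b0 b1 : R)
    (g := mx3 1 s (s ^+ 2) 1 0 (- b0) 0 1 (- b1)) :
  mx3 s 0 0 0 0 (- b0) 0 1 (- b1) *m g =
  g *m comp3 (- (s * b0)) (b0 - s * b1) (b1 - s).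
Proof. by rewrite /g /comp3 !mx3M; congr mx3; ring. Qed.

Section NormalForms.
Variables (o : compact_dvr) (eps : nonsquare_unit o).
Hypothesis hodd : odd_residue_char o.
Local Notation O := (quadext eps).
Local Notation k2 := (residue_field eps).
Local Notation cj := (@quadext_conj o eps).
Local Notation kj := (@kconj o eps).
Local Notation kred := (@kred o eps).
Local Notation pi := (qunif eps).
Local Notation dlt := (dlt eps).
Local Notation redm m := (map_mx (@Defs.Ored o eps m)).
Local Notation redk := (map_mx kred).

Lemma cjD (x y : O) : cj (x + y) = cj x + cj y. Proof. exact: rmorphD. Qed.
Lemma cjN (x : O) : cj (- x) = - cj x. Proof. exact: rmorphN. Qed.
Lemma cjM (x y : O) : cj (x * y) = cj x * cj y. Proof. exact: rmorphM. Qed.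
Lemma cj0 : cj 0 = 0. Proof. exact: rmorph0. Qed.
Lemma cj1 : cj 1 = 1. Proof. exact: rmorph1. Qed.
Lemma cjXpi n : cj (pi ^+ n) = pi ^+ n.
Proof. by rewrite -[in RHS](conj_pi eps); exact: rmorphXn. Qed.

Lemma herm_form_mx3 a b c d e f g h k : cj a = a -> cj e = e -> cj k = k ->
  cj b = d -> cj c = g -> cj f = h ->
  kred (a * (e * k - f * h) - b * (d * k - f * g) + c * (d * h - e * g)) != 0 ->
  herm_form (mx3 a b c d e f g h k).
Proof.
move=> ha he hk hb hc hf hdet; split; last by rewrite unitmxE mx3_det.
by rewrite star_mx3 ha he hk hb hc hf -hb -hc -hf !conjK.
Qed.

Lemma skew_for_redk (H B : 'M[O]_3) : skew_for H B ->
  star kj (redk B) *m redk H = - (redk H *m redk B).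
Proof. by move=> sk; rewrite star_redk -!map_mxM sk map_mxN. Qed.

Lemma skew_lift (x : k2) : kj x = - x -> exists y, cj y = - y /\ x = kred y.
Proof.
have [y ->] := kred_surj x => e; exists (half eps * (y - cj y)); split.
  by rewrite cjM (conj_half eps hodd) cjD cjN conjK -mulrN opprB.
have h2 : kred (half eps) * 2%:R = 1.
  by rewrite -(rmorph_nat kred) -rmorphM mulrC (half2 eps hodd) rmorph1.
by rewrite rmorphM rmorphB /= -kconj_red e opprK -mulr2n -mulr_natl mulrA h2 mul1r.
Qed.

Lemma comm_redk n (X B : 'M[O]_3) : (0 < n)%N -> comm_mod n X B ->
  redk X *m redk B = redk B *m redk X.
Proof. by move=> n0 /(redm_redk n0); rewrite !map_mxM. Qed.

Lemma Ored_scale r n (u v : O) : (r < n)%N ->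
  Defs.Ored n (pi ^+ r * u) = Defs.Ored n (pi ^+ r * v) -> kred u = kred v.
Proof.
move=> rn /Ored_eqP[z zE]; apply: (@Ored_kred _ eps (n - r)); first by rewrite subn_gt0.
apply/Ored_eqP; exists z; apply: (@piXI _ eps r).
by rewrite zE mulrDr mulrA -exprD subnKC // ltnW.
Qed.

Lemma kred_pi0 r (x : O) : (0 < r)%N -> kred (pi ^+ r * x) = 0.
Proof. by case: r => // r _; rewrite rmorphM rmorphXn /= kred_pi expr0n mul0r. Qed.

Lemma scalar_shadow l d : (0 < l)%N -> cj d = - d ->
  shadow_has_type (associated_class eps l (redm l d%:M)) TypeG.
Proof.
move=> l0 sd; have h1 : herm_form (1%:M : 'M[O]_3).
  by split; [exact: star1|exact: unitmx1].
have := @affine_shadow _ eps hodd l 0 1%:M 0 0 d TypeG l0 h1 sd.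
rewrite scaler0 addr0; apply.
- by rewrite /skew_for /star trmx0 map_mx0 mul0mx mulmx0 oppr0.
- have -> : (0 : 'M[k2]_3) = redk 0 by rewrite map_mx0.
  apply: skew_for_redk.
  by rewrite /skew_for /star trmx0 map_mx0 mul0mx mulmx0 oppr0.
- exists 0; first by apply/gu1_kj; rewrite rmorph0 oppr0.
  apply: mxminpoly_monic_eq; first exact: monicXsubC.
    by rewrite rmorphB /= horner_mx_C horner_mx_X raddf0 subr0.
  by rewrite size_XsubC size_mxminpoly ltnS mxminpoly_nonconstant.
- by move=> X _; rewrite mulmx0 mul0mx.
- move=> X _; have [X' ->] := redk_lift X; exists X' => //.
  by rewrite /comm_mod mulmx0 mul0mx.
Qed.

Definition form_ii (a : O) : 'M[O]_3 := mx3 a 0 0 0 0 0 0 0 0.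

Lemma form_ii_skew a : cj a = - a -> herm_form (1%:M : 'M[O]_3) /\ skew_for 1%:M (form_ii a).
Proof.
move=> sa; split; first by split; [exact: star1|exact: unitmx1].
rewrite /skew_for mulmx1 mul1mx /form_ii star_mx3 mx3N sa cj0.
by rewrite oppr0.
Qed.

Lemma form_ii_shadow l i d a : (i < l)%N -> cj d = - d -> cj a = - a -> kred a != 0 ->
  shadow_has_type (associated_class eps l (redm l (d%:M + pi ^+ i *: form_ii a))) TypeL.
Proof.
move=> il sd sa a0; have [h1 sk] := form_ii_skew sa.
have SE : redk (form_ii a) = mx3 (kred a) 0 0 0 0 0 0 0 0.
  by rewrite /form_ii map_mx3 rmorph0.
apply: (affine_shadow hodd il h1 sd sk (skew_for_redk sk)).
- exists (kred a), 0; split=> //.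
  + by apply/gu1_kj; rewrite kconj_red sa rmorphN.
  + by apply/gu1_kj; rewrite rmorph0 oppr0.
  apply: mxminpoly_degree2.
    move=> c; rewrite SE mx3_scalar => /mx3_inj[[e1 _ _] [_ e2 _] _].
    by case/eqP: a0; rewrite e1 -e2.
  rewrite SE !mx3_scalar !mx3N !mx3D mx3M mx3_0; congr mx3; ring.
- by move=> X; apply: comm_redk; rewrite subn_gt0.
move=> X; have [x1 [x2 [x3 [x4 [x5 [x6 [x7 [x8 [x9 ->]]]]]]]]] := mx3_surj X.
rewrite SE !mx3M => /mx3_inj[[_ e2 e3] [e4 _ _] [e7 _ _]].
have z2 : x2 = 0 by apply: (mulfI a0); rewrite mulr0; transitivity (x1 * 0 + x2 * 0 + x3 * 0); [rewrite e2; ring|ring].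
have z3 : x3 = 0 by apply: (mulfI a0); rewrite mulr0; transitivity (x1 * 0 + x2 * 0 + x3 * 0); [rewrite e3; ring|ring].
have z4 : x4 = 0 by apply: (mulIf a0); rewrite mul0r; transitivity (x4 * kred a + x5 * 0 + x6 * 0); [ring|rewrite e4; ring].
have z7 : x7 = 0 by apply: (mulIf a0); rewrite mul0r; transitivity (x7 * kred a + x8 * 0 + x9 * 0); [ring|rewrite e7; ring].
have [y1 ->] := kred_surj x1; have [y5 ->] := kred_surj x5; have [y6 ->] := kred_surj x6.
have [y8 ->] := kred_surj x8; have [y9 ->] := kred_surj x9.
exists (mx3 y1 0 0 0 y5 y6 0 y8 y9).
  by rewrite map_mx3 /= rmorph0 z2 z3 z4 z7.
rewrite /comm_mod /form_ii !mx3M; congr (map_mx _ _); congr mx3; ring.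
Qed.

Definition form_iii (a p b0 b1 : O) : 'M[O]_3 :=
  mx3 a 0 0 0 0 (- (p * b0)) 0 p (- (p * b1)).

(** An orthogonal sum of 1 and a form on O[C], C the companion block: delta (-1)^i tau(C^(i+j)), i
    and j counted from 0, where tau sends 1 to 0 and C to 1. The sign makes C skew, and delta makes
    the plane form hermitian. *)
Definition herm_iii (b1 : O) : 'M[O]_3 := mx3 1 0 0 0 0 dlt 0 (- dlt) (b1 * dlt).

Lemma herm_iiiP b1 : cj b1 = - b1 -> herm_form (herm_iii b1).
Proof.
move=> sb1; apply: herm_form_mx3; rewrite ?cjM ?conj_dlt ?sb1 ?cj0 ?cj1 //.
  by rewrite mulrNN.
have -> : 1 * (0 * (b1 * dlt) - dlt * - dlt) - 0 * (0 * (b1 * dlt) - dlt * 0) +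
  0 * (0 * - dlt - 0 * 0) = dlt * dlt by ring.
by rewrite rmorphM mulf_neq0 // kdlt_neq0.
Qed.

Lemma form_iii_skew a p b0 b1 : cj a = - a -> cj p = p -> cj b0 = b0 -> cj b1 = - b1 ->
  skew_for (herm_iii b1) (form_iii a p b0 b1).
Proof.
move=> sa sp sb0 sb1; rewrite /skew_for /form_iii /herm_iii star_mx3 !mx3M mx3N.
rewrite !cjN !cjM sa sp sb0 sb1 cj0; congr mx3; ring.
Qed.

(** A commuting X is block diagonal modulo pi because a is a unit. The equations for its lower block
    carry the factor pi^r, which cancels as r < l - i, so that block commutes with the companion
    block. S completes the companion block by an eigenvalue s that is not one of its roots, which
    makes S cyclic. *)
Lemma form_iii_shadow l i r d a b0 b1 T s : (i < l)%N -> (0 < r < l - i)%N ->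
  cj d = - d -> cj a = - a -> kred a != 0 -> cj b0 = b0 -> cj b1 = - b1 ->
  kj s = - s -> s ^+ 2 + kred b1 * s + kred b0 != 0 ->
  min_poly_of_type kj T (cubic (- (s * kred b0)) (kred b0 - s * kred b1) (kred b1 - s)) ->
  shadow_has_type (associated_class eps l
    (redm l (d%:M + pi ^+ i *: form_iii a (pi ^+ r) b0 b1))) T.
Proof.
move=> il /andP[r0 rn] sd sa a0 sb0 sb1 ss qs mT.
have hH := herm_iiiP sb1; have sk := form_iii_skew sa (cjXpi r) sb0 sb1.
have [s' [ss' sE]] := skew_lift ss.
have sk' := form_iii_skew ss' cj1 sb0 sb1.
have SE : redk (form_iii s' 1 b0 b1) =
    mx3 s 0 0 0 0 (- kred b0) 0 1 (- kred b1).
  by rewrite /form_iii map_mx3 /= !mul1r !rmorphN /= rmorph0 rmorph1 sE.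
have ug : mx3 1 s (s ^+ 2) 1 0 (- kred b0) 0 1 (- kred b1) \in unitmx.
  rewrite unitmxE mx3_det unitfE; apply: contra_neq qs => <-; ring.
apply: (cyclic_shadow hodd il hH sd sk (skew_for_redk sk') ug _ mT).
- rewrite SE; exact: form_iii_cyclic.
- rewrite /form_iii !mx3M; congr mx3; ring.
move=> X; have [x1 [x2 [x3 [x4 [x5 [x6 [x7 [x8 [x9 ->]]]]]]]]] := mx3_surj X.
have n0 : (0 < l - i)%N by rewrite subn_gt0.
rewrite SE map_mx3 /comm_mod /form_iii !mx3M !map_mx3.
move=> /mx3_inj[[_ e2 e3] [e4 e5 e6] [e7 e8 e9]].
have z3 : kred x3 = 0.
  apply: (mulfI a0); rewrite mulr0 -rmorphM; have /(Ored_kred n0) := e3.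
  rewrite (_ : _ + _ + _ = pi ^+ r * (- (b0 * x2) - b1 * x3)); last by ring.
  by rewrite kred_pi0 // (_ : _ + _ + _ = a * x3) //; ring.
have z2 : kred x2 = 0.
  apply: (mulfI a0); rewrite mulr0 -rmorphM; have /(Ored_kred n0) := e2.
  rewrite (_ : _ + _ + _ = pi ^+ r * x3); last by ring.
  by rewrite kred_pi0 // (_ : _ + _ + _ = a * x2) //; ring.
have z4 : kred x4 = 0.
  apply: (mulfI a0); rewrite mulr0 -rmorphM; have /(Ored_kred n0) := e4.
  rewrite (_ : _ + _ + _ = a * x4); last by ring.
  by rewrite (_ : _ + _ + _ = pi ^+ r * (- (b0 * x7))) ?kred_pi0 //; ring.
have z7 : kred x7 = 0.
  apply: (mulfI a0); rewrite mulr0 -rmorphM; have /(Ored_kred n0) := e7.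
  rewrite (_ : _ + _ + _ = a * x7); last by ring.
  by rewrite (_ : _ + _ + _ = pi ^+ r * (x4 - b1 * x7)) ?kred_pi0 //; ring.
have scale x y u v : Defs.Ored (l - i) x = Defs.Ored (l - i) y ->
    x = pi ^+ r * u -> y = pi ^+ r * v -> kred u = kred v.
  by move=> xy xE yE; apply: (@Ored_scale r (l - i)); rewrite -?xE -?yE.
have f5 : kred x6 = kred (- (b0 * x8)) by apply: (scale _ _ _ _ e5); ring.
have f6 : kred (- (b0 * x5) - b1 * x6) = kred (- (b0 * x9)).
  by apply: (scale _ _ _ _ e6); ring.
have f8 : kred x9 = kred (x5 - b1 * x8) by apply: (scale _ _ _ _ e8); ring.
have f9 : kred (- (b0 * x8) - b1 * x9) = kred (x6 - b1 * x9).
  by apply: (scale _ _ _ _ e9); ring.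
rewrite !(rmorphB, rmorphN, rmorphM) /= in f5 f6 f8 f9.
rewrite /= z2 z3 z4 z7; congr mx3; try by ring.
- by apply: (eq_sub_trans f5); ring.
- by apply: (eq_sub_trans f6); ring.
- by apply: (eq_sub_trans f8); ring.
- by apply: (eq_sub_trans f9); ring.
Qed.

(** The entries are (-1)^i tau(C^(i+j)), i and j counted from 0, for the functional tau on O[C] that
    sends 1, C, C^2 to 0, 0, 1; moving C from one argument to the other changes the sign. *)
Definition herm_iv (c1 c2 : O) : 'M[O]_3 := mx3 0 0 1 0 (- 1) c2 1 (- c2) (c2 ^+ 2 - c1).

Lemma form_iv_skew c0 c1 c2 : cj c0 = - c0 -> cj c1 = c1 -> cj c2 = - c2 ->
  herm_form (herm_iv c1 c2) /\ skew_for (herm_iv c1 c2) (comp3 c0 c1 c2).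
Proof.
move=> s0 s1 s2; split.
  apply: herm_form_mx3; rewrite ?cjD ?cjN ?expr2 ?cjM ?s1 ?s2 ?cj0 ?cj1 ?mulrNN //.
  rewrite (_ : _ + _ = 1); last by ring.
  by rewrite rmorph1 oner_eq0.
rewrite /skew_for /comp3 /herm_iv star_mx3 !mx3M mx3N.
by rewrite !cjN s0 s1 s2 cj0 cj1; congr mx3; ring.
Qed.

Lemma form_iv_shadow l i d c0 c1 c2 T : (i < l)%N -> cj d = - d ->
  cj c0 = - c0 -> cj c1 = c1 -> cj c2 = - c2 ->
  min_poly_of_type kj T (cubic (kred c0) (kred c1) (kred c2)) ->
  shadow_has_type (associated_class eps l
    (redm l (d%:M + pi ^+ i *: comp3 c0 c1 c2))) T.
Proof.
move=> il sd s0 s1 s2 mT; have [hH sk] := form_iv_skew s0 s1 s2.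
have SE : redk (comp3 c0 c1 c2) = comp3 (kred c0) (kred c1) (kred c2).
  by rewrite /comp3 map_mx3 /= !rmorphN /= rmorph0 rmorph1.
apply: (cyclic_shadow hodd il hH sd sk (skew_for_redk sk) (unitmx1 _ _) _ mT).
- by rewrite SE mulmx1 mul1mx.
- reflexivity.
- by move=> X; apply: comm_redk; rewrite subn_gt0.
Qed.

Definition form_v (t a b c : O) : 'M[O]_3 := mx3 0 t 0 0 0 1 a b c.

Lemma form_I_shadow l i d c : (i < l)%N -> cj d = - d -> cj c = - c -> kred c = 0 ->
  shadow_has_type (associated_class eps l
    (redm l (d%:M + pi ^+ i *: form_v 0 0 0 c))) TypeJ.
Proof.
move=> il sd sc kc.
pose H : 'M[O]_3 := mx3 1 0 0 0 (c * dlt) (- dlt) 0 dlt 0.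
have hH : herm_form H.
  apply: herm_form_mx3; rewrite ?cjM ?cjN ?conj_dlt ?sc ?cj0 ?cj1 ?mulrNN ?opprK //.
  rewrite (_ : _ + _ = dlt * dlt); last by ring.
  by rewrite rmorphM mulf_neq0 // kdlt_neq0.
have sk : skew_for H (form_v 0 0 0 c).
  rewrite /skew_for /form_v /H star_mx3 !mx3M mx3N.
  by rewrite sc cj0 cj1; congr mx3; ring.
pose S0 : 'M[O]_3 := form_v 0 0 0 0.
have skS : star kj (redk S0) *m redk H = - (redk H *m redk S0).
  have kE : redk S0 = redk (form_v 0 0 0 c).
    by rewrite /S0 /form_v !map_mx3 /= kc rmorph0.
  by rewrite kE; apply: skew_for_redk.
have SE : redk S0 = mx3 0 0 0 0 0 1 0 0 0.
  by rewrite /S0 /form_v map_mx3 /= rmorph0 rmorph1.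
apply: (affine_shadow hodd il hH sd sk skS).
- exists 0; first by apply/gu1_kj; rewrite rmorph0 oppr0.
  rewrite expr2; apply: mxminpoly_degree2.
    move=> x; rewrite SE mx3_scalar => /mx3_inj[_ [_ _ e] _].
    by move/eqP: e; rewrite oner_eq0.
  by rewrite SE !mx3_scalar !mx3N !mx3D mx3M mx3_0; congr mx3; ring.
- have -> : redk S0 = redk (form_v 0 0 0 c).
    by rewrite /S0 /form_v !map_mx3 /= kc rmorph0.
  by move=> X; apply: comm_redk; rewrite subn_gt0.
move=> X; have [x1 [x2 [x3 [x4 [x5 [x6 [x7 [x8 [x9 ->]]]]]]]]] := mx3_surj X.
rewrite SE !mx3M => /mx3_inj[[_ _ e3] [e4 e5 e6] [_ _ e9]].
have z2 : x2 = 0 by apply: (eq_sub_trans e3); ring.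
have z7 : x7 = 0 by apply: (eq_sub_trans (esym e4)); ring.
have z8 : x8 = 0 by apply: (eq_sub_trans e9); ring.
have z9 : x9 = x5 by apply: (eq_sub_trans (esym e6)); ring.
rewrite z2 z7 z8 z9.
have [y1 ->] := kred_surj x1; have [y3 ->] := kred_surj x3; have [y4 ->] := kred_surj x4.
have [y5 ->] := kred_surj x5; have [y6 ->] := kred_surj x6.
(* The terms in c vanish modulo pi; they make the lift commute with B exactly. *)
exists (mx3 y1 (- (c * y3)) y3 y4 y5 y6 0 0 (y5 + c * y6)).
  by rewrite map_mx3 /= rmorphN rmorphD !rmorphM /= kc rmorph0 !mul0r oppr0 addr0.
by rewrite /comm_mod /form_v !mx3M; congr (map_mx _ _); congr mx3; ring.
Qed.

End NormalForms.

(** * Forms and shadows for subcases (II) and (III_1) *)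

Section TypeFive.
Variables (o : compact_dvr) (eps : nonsquare_unit o).
Hypothesis hodd : odd_residue_char o.
Local Notation O := (quadext eps).
Local Notation k2 := (residue_field eps).
Local Notation cj := (@quadext_conj o eps).
Local Notation kj := (@kconj o eps).
Local Notation kred := (@kred o eps).
Local Notation pi := (qunif eps).
Local Notation dlt := (dlt eps).
Local Notation redm m := (map_mx (@Defs.Ored o eps m)).
Local Notation redk := (map_mx kred).

(** Modulo pi the determinant is delta^2 (a1 delta - b1 q). The real parameter q lets one family of
    forms serve whether a1 or b1 is the unit. *)
Definition herm_v (t a1 b1 c q : O) : 'M[O]_3 :=
  mx3 (a1 * dlt - b1 * q) (- (c * q)) q
      (c * q) (- (t * q) + c * dlt) (- dlt)
      q dlt 0.

Lemma herm_vP t a1 b1 c q : cj t = t -> cj a1 = - a1 -> cj b1 = b1 -> cj c = - c ->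
  cj q = q -> kred t = 0 -> kred c = 0 -> kred (a1 * dlt - b1 * q) != 0 ->
  herm_form (herm_v t a1 b1 c q).
Proof.
move=> st sa sb sc sq kt kc nz.
apply: herm_form_mx3; rewrite ?(cjD, cjN, cjM) ?conj_dlt ?sa ?sb ?sc ?sq ?st ?cj0
  ?mulrNN ?mulNr ?opprK //.
rewrite (_ : _ + _ = (a1 * dlt - b1 * q) * (dlt * dlt) + c * (q * dlt * q) +
  t * (q * q * q)); last by ring.
move: (_ - _) nz => A nz.
rewrite !(rmorphD kred, rmorphM kred A, rmorphM kred c, rmorphM kred t) /= kt kc.
rewrite !mul0r !addr0; apply: mulf_neq0; first exact: nz.
by rewrite rmorphM; apply: mulf_neq0; apply: kdlt_neq0.
Qed.

Lemma form_v_skew t a1 b1 c q : cj t = t -> cj a1 = - a1 -> cj b1 = b1 -> cj c = - c ->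
  cj q = q -> skew_for (herm_v t a1 b1 c q) (form_v t (t * a1) (t * b1) c).
Proof.
move=> st sa sb sc sq; rewrite /skew_for /herm_v /form_v star_mx3 !mx3M mx3N.
rewrite !cjM st sa sb sc cj0 cj1; congr mx3; ring.
Qed.

(* [t] times this matrix is [Y ^+ 2 - c Y] for [Y = form_v t (t a1) (t b1) c]. *)
Definition form_v_quot (t a1 b1 c : O) : 'M[O]_3 :=
  mx3 0 (- c) 1 a1 b1 0 0 (t * a1) b1.

Lemma form_v_quotE t a1 b1 c (Y := form_v t (t * a1) (t * b1) c) :
  t *: form_v_quot t a1 b1 c = Y *m Y - c *: Y.
Proof.
rewrite /Y /form_v_quot /form_v mx3M !mx3Z mx3N mx3D; congr mx3; ring.
Qed.

Lemma form_v_quot_comm t a1 b1 c :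
  form_v_quot t a1 b1 c *m form_v t (t * a1) (t * b1) c =
  form_v t (t * a1) (t * b1) c *m form_v_quot t a1 b1 c.
Proof. rewrite /form_v_quot /form_v !mx3M; congr mx3; ring. Qed.

(** If Y and the scalar c are skew, then Y^2 and c Y are self-adjoint, hence so is the quotient; the
    factor delta makes it skew. *)
Lemma form_v_shadow_skew t a1 b1 c q e : cj t = t -> cj a1 = - a1 -> cj b1 = b1 ->
  cj c = - c -> cj q = q -> cj e = e ->
  skew_for (herm_v t a1 b1 c q)
    (dlt *: form_v_quot t a1 b1 c + e *: form_v t (t * a1) (t * b1) c).
Proof.
move=> st sa sb sc sq se; rewrite /skew_for /herm_v /form_v_quot /form_v.
rewrite !mx3Z mx3D star_mx3 !mx3M mx3N.
rewrite !(cjD, cjN, cjM) st sa sb sc se cj0 cj1 conj_dlt; congr mx3; ring.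
Qed.

(** The reduction of Y itself is only E_23. What centralises Y modulo pi^n centralises the quotient
    (Y^2 - c Y) / pi^mu modulo pi^(n-mu), hence modulo pi since mu < n. The coefficient e is there
    to make the reduction cyclic. *)
Lemma form_v_shadow_aux l i mu d a1 b1 c q e T : (i < l)%N -> (0 < mu < l - i)%N ->
  cj d = - d -> cj a1 = - a1 -> cj b1 = b1 -> cj c = - c -> cj q = q -> cj e = e ->
  kred c = 0 -> kred (a1 * dlt - b1 * q) != 0 -> kred (dlt * a1 + e * b1) != 0 ->
  min_poly_of_type kj T
    (cubic 0 (kred (dlt * b1) ^+ 2) (- (kred (dlt * b1) + kred (dlt * b1)))) ->
  shadow_has_type (associated_class eps l
    (redm l (d%:M + pi ^+ i *: form_v (pi ^+ mu) (pi ^+ mu * a1) (pi ^+ mu * b1) c))) T.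
Proof.
move=> il /andP[mu0 mun] sd sa sb sc sq se kc nzH nzg mT.
have st := cjXpi eps mu.
have kt : kred (pi ^+ mu) = 0 by rewrite -[pi ^+ mu]mulr1 kred_pi0.
have hH := herm_vP st sa sb sc sq kt kc nzH.
have sk := form_v_skew st sa sb sc sq.
have sk' := form_v_shadow_skew st sa sb sc sq se.
have SE : redk (dlt *: form_v_quot (pi ^+ mu) a1 b1 c +
      e *: form_v (pi ^+ mu) (pi ^+ mu * a1) (pi ^+ mu * b1) c) =
    mx3 0 0 (kred dlt) (kred dlt * kred a1) (kred dlt * kred b1) (kred e)
        0 0 (kred dlt * kred b1).
  move: (pi ^+ mu) kt => t kt.
  rewrite /form_v_quot /form_v !mx3Z mx3D map_mx3 /=.
  rewrite !(rmorphD kred, rmorphM kred, rmorphN kred, rmorph0 kred, rmorph1 kred) /= kt kc.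
  by congr mx3; ring.
rewrite !(rmorphD kred, rmorphM kred) /= in nzg mT.
(* The columns are e_3, S e_3 and S^2 e_3; the determinant is, up to sign, delta^2 (delta a1 + e
   b1). *)
have ug : mx3 0 (kred dlt) (kred dlt * (kred dlt * kred b1))
    0 (kred e) (kred dlt ^+ 2 * kred a1 + 2%:R * kred e * (kred dlt * kred b1))
    1 (kred dlt * kred b1) ((kred dlt * kred b1) ^+ 2) \in unitmx.
  rewrite unitmxE mx3_det unitfE.
  have nz : kred dlt * kred dlt * (kred dlt * kred a1 + kred e * kred b1) != 0.
    by rewrite !mulf_neq0 // kdlt_neq0.
  by apply: contra_neq nz => e0; rewrite -[RHS]e0; ring.
apply: (cyclic_shadow hodd il hH sd sk (skew_for_redk sk') ug _ mT).
- by rewrite SE /comp3 !mx3M; congr mx3; ring.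
- rewrite mulmxDl mulmxDr -!scalemxAl -!scalemxAr form_v_quot_comm.
  reflexivity.
move=> X cX; apply: (@comm_redk _ _ (l - i - mu)); first by rewrite subn_gt0.
have cYX := comm_mod_sym cX.
apply: comm_mod_sym; apply: comm_modD; apply: comm_modZ; last first.
  by apply: redm_le cYX; rewrite leq_subr.
(* Multiplication by pi^mu trades the lost precision for a polynomial in Y, with which X commutes
   modulo pi^(l-i). *)
rewrite /comm_mod -(redm_scale _ mu) subnKC; last exact: ltnW.
rewrite scalemxAl scalemxAr form_v_quotE.
by apply: comm_modB; [exact: comm_modM|exact: comm_modZ].
Qed.

Lemma form_v_shadow l i mu d a1 b1 c : (i < l)%N -> (0 < mu < l - i)%N ->
  cj d = - d -> cj a1 = - a1 -> cj b1 = b1 -> cj c = - c ->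
  kred c = 0 -> kred a1 != 0 \/ kred b1 != 0 ->
  shadow_has_type (associated_class eps l
    (redm l (d%:M + pi ^+ i *: form_v (pi ^+ mu) (pi ^+ mu * a1) (pi ^+ mu * b1) c)))
    (if kred b1 == 0 then TypeN else TypeM).
Proof.
move=> il mun sd sa sb sc kc ab.
(* One q serves both as the parameter of the form and as the coefficient e of S: 0 if a1 is a unit,
   and 1 otherwise, b1 then being a unit. *)
have [q [sq [nz1 nz2]]] : exists q, cj q = q /\
    (kred (a1 * dlt - b1 * q) != 0 /\ kred (dlt * a1 + q * b1) != 0).
  have dn := kdlt_neq0 eps.
  have [a0|a0] := eqVneq (kred a1) 0.
    have b0 : kred b1 != 0 by case: ab => //; rewrite a0 eqxx.
    exists 1; rewrite cj1 mulr1 mul1r rmorphB rmorphD !rmorphM /= a0 mulr0 mul0r.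
    by rewrite !add0r oppr_eq0 b0.
  exists 0; rewrite cj0 mulr0 mul0r subr0 addr0 !rmorphM /=.
  by rewrite !mulf_neq0.
apply: (form_v_shadow_aux il mun sd sa sb sc sq sq kc nz1 nz2).
have -> : cubic 0 (kred (dlt * b1) ^+ 2) (- (kred (dlt * b1) + kred (dlt * b1))) =
    ('X - 0%:P) * ('X - (kred (dlt * b1))%:P) * ('X - (kred (dlt * b1))%:P).
  by rewrite -cubic_roots; congr cubic; ring.
have sg0 : gu1 kj 0 by apply/gu1_kj; rewrite rmorph0 oppr0.
have [b0|b0] := eqVneq (kred b1) 0.
  by exists 0 => //; rewrite rmorphM /= b0 mulr0; ring.
exists 0, (kred (dlt * b1)); split=> //.
- by apply/gu1_kj; rewrite kconj_red cjM conj_dlt sb mulNr rmorphN.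
- by rewrite eq_sym rmorphM mulf_neq0 // kdlt_neq0.
- by rewrite expr2 mulrA.
Qed.

End TypeFive.

(** * Representatives *)

Section Lifts.
Variables (o : compact_dvr) (eps : nonsquare_unit o).
Hypothesis hodd : odd_residue_char o.
Variable s0 : forall n, oq o n -> o.
Hypothesis hs0 : forall n (x : oq o n), ored n (s0 x) = x.
Hypothesis hs0N : forall n (x : oq o n), s0 (- x) = - s0 x.
Local Notation O := (quadext eps).
Local Notation k2 := (residue_field eps).
Local Notation cj := (@quadext_conj o eps).
Local Notation kred := (@kred o eps).
Local Notation pi := (qunif eps).
Local Notation Ored := (@Defs.Ored o eps).
Local Notation redm m := (map_mx (@Defs.Ored o eps m)).
Local Notation repO := (@repO o eps s0 _).

Lemma Ored_pairP n (x y : O) :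
  Ored n x = Ored n y <-> ored n x.1 = ored n y.1 /\ ored n x.2 = ored n y.2.
Proof.
have cong (u v : o) : ored n u = ored n v <-> exists z, u = v + unif o ^+ n * z.
  split=> [uv|[z ->]].
    have [|z zE] := (red_eq0P (unif o ^+ n) (u - v)).1.
      by rewrite rmorphB /=; apply/eqP; rewrite subr_eq0; apply/eqP.
    by exists z; rewrite -zE addrC subrK.
  rewrite rmorphD /= [X in _ + X](_ : _ = 0) ?addr0 //.
  by apply/red_eq0P; exists z.
rewrite Ored_eqP !cong; case: x y => [a b] [c d] /=; split.
  by move=> [[u v]]; rewrite piXM => -[-> ->]; split; [exists u|exists v].
by move=> [[u ->] [v ->]]; exists (u, v); rewrite piXM.
Qed.

Lemma repOK n (x : Oq eps n) : Ored n (repO x) = x.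
Proof.
by rewrite -[RHS](Ored_qlift x); apply/Ored_pairP; rewrite /= !hs0.
Qed.

Lemma half_o (a : o) : 2%:R^-1 * (a + a) = a.
Proof. by rewrite -[a + a]mulr2n -[a *+ 2]mulr_natl mulKr ?two_unit_o. Qed.

Lemma s00 n : s0 (0 : oq o n) = 0.
Proof.
have := hs0N (0 : oq o n); rewrite oppr0 => /eqP.
rewrite -addr_eq0 -mulr2n -mulr_natl mulf_eq0 => /orP[two|/eqP //].
by have := two_unit_o hodd; rewrite (eqP two) unitr0.
Qed.

(** The real part of x is 0 in o_n since 2 is invertible, and an odd [s0] represents 0 by 0; thus
    representatives are skew over O itself. *)
Lemma repO_skew n (x : Oq eps n) : gu1 (@Oconj o eps n) x -> cj (repO x) = - repO x.
Proof.
rewrite /gu1 /= -{1 2}(Ored_qlift x) Oconj_red -rmorphD -(rmorph0 (Ored n)).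
move=> /Ored_pairP /= [e _]; rewrite /Defs.repO /quadext_conj; congr pair => /=.
suff -> : ored n (qlift x).1 = 0 by rewrite s00 oppr0.
have : ored n (2%:R^-1 * ((qlift x).1 + (qlift x).1)) = 0.
  by rewrite rmorphM /= e rmorph0 mulr0.
by rewrite half_o.
Qed.

Lemma repO_real n (x : Oq eps n) : Oconj x = x -> cj (repO x) = repO x.
Proof.
rewrite -{1 2}(Ored_qlift x) Oconj_red.
move=> /Ored_pairP /= [_ e]; rewrite /Defs.repO /quadext_conj; congr pair => /=.
suff -> : ored n (qlift x).2 = 0 by rewrite s00 oppr0.
have e2 : ored n ((qlift x).2 + (qlift x).2) = 0.
  by rewrite rmorphD /= -{1}e rmorphN addNr.
have : ored n (2%:R^-1 * ((qlift x).2 + (qlift x).2)) = 0.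
  by rewrite rmorphM /= e2 mulr0.
by rewrite half_o.
Qed.

Lemma gu1_red n (x : O) : cj x = - x -> gu1 (@Oconj o eps n) (Ored n x).
Proof. by move=> sx; rewrite /gu1 /= Oconj_red sx rmorphN addNr. Qed.

Definition is_rep n (d : O) : Prop :=
  exists2 x : Oq eps n, gu1 (@Oconj o eps n) x & d = repO x.

Lemma is_rep_skew n d : is_rep n d -> cj d = - d.
Proof. by move=> [x gx ->]; apply: repO_skew. Qed.

Lemma is_rep_inj n d d' : is_rep n d -> is_rep n d' -> Ored n d = Ored n d' -> d = d'.
Proof. by move=> [x _ ->] [y _ ->]; rewrite !repOK => ->. Qed.

Lemma is_rep_ex n d : cj d = - d -> exists2 d', is_rep n d' & Ored n d' = Ored n d.
Proof.
move=> sd; exists (repO (Ored n d)); last exact: repOK.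
by exists (Ored n d) => //; apply: gu1_red.
Qed.

Lemma Ored_pi_rep l i (x : O) : (i <= l)%N ->
  Ored l (pi ^+ i * repO (Ored (l - i) x)) = Ored l (pi ^+ i * x).
Proof.
move=> il; have /Ored_eqP[z zE] := repOK (Ored (l - i) x).
by apply/Ored_eqP; exists z; rewrite zE mulrDr mulrA -exprD subnKC.
Qed.

Lemma pi_scale_red l i p q (X : 'M[O]_(p, q)) : (i <= l)%N ->
  pi_scale s0 (redm (l - i) X) = redm l (pi ^+ i *: X).
Proof. by move=> il; apply/matrixP => r t; rewrite !mxE Ored_pi_rep. Qed.

Lemma unit_redP n (x : O) : (0 < n)%N -> is_unit (Ored n x) <-> kred x != 0.
Proof.
move=> n0; split=> [[y]|kx].
  have [z ->] : exists z, y = Ored n z by exists (repO y); rewrite repOK.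
  rewrite -rmorphM -(rmorph1 (Ored n)) => /(Ored_kred n0); rewrite rmorphM rmorph1 /=.
  by move=> e; apply/eqP => x0; move/eqP: e; rewrite x0 mul0r eq_sym oner_eq0.
by have [y yx] := unit_of_kred kx; exists (Ored n y); rewrite -rmorphM mulrC yx rmorph1.
Qed.

(** For k at most n, divisibility by pi^k can be tested on any lift, as lifts differ by multiples of
    pi^n. *)
Lemma val_redP n k (x : O) : (k <= n)%N ->
  (k <= val_Oq (Ored n x))%N <-> exists y, x = pi ^+ k * y.
Proof.
move=> kn; rewrite /val_Oq; split=> [|[y xE]].
  have P0 : `[< exists y, Ored n x = Ored n pi ^+ (ord0 : 'I_n.+1) * y >].
    by apply/asboolP; exists (Ored n x); rewrite expr0 mul1r.
  have c0 : (0 < #|[pred k : 'I_n.+1 | `[< exists y, Ored n x = Ored n pi ^+ k * y >]%R]|)%N.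
    by apply/card_gt0P; exists ord0.
  have [j /asboolP[y yE] ->] := eq_bigmax_cond (fun k : 'I_n.+1 => k : nat) c0.
  move=> kj; have jn : (j <= n)%N by rewrite -ltnS.
  move: yE; rewrite -(repOK y) -rmorphXn -rmorphM => /Ored_eqP[z ->].
  exists (pi ^+ (j - k) * repO y + pi ^+ (n - k) * z).
  by rewrite mulrDr !mulrA -!exprD !subnKC.
have kn' : (k < n.+1)%N by [].
apply: (@leq_bigmax_cond _ _ (fun k : 'I_n.+1 => k : nat) (Ordinal kn')).
by apply/asboolP; exists (Ored n y); rewrite /= -rmorphXn -rmorphM -xE.
Qed.

Lemma mx_D_red n (a : O) : mx_D (Ored n a) 0 0 = redm n (form_ii a).
Proof.
by apply/matrixP; do 2!elim/ord3P; rewrite !mxE /= ?mulr0n ?mulr1n ?rmorph0.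
Qed.

Lemma mx_E_red n (p a b c d : O) :
  mx_E (Ored n p) (Ored n a) (Ored n b) (Ored n c) (Ored n d) =
  redm n (d%:M + form_v p a b c).
Proof.
rewrite map_mxD mx3_scalar /form_v !map_mx3 mx3D.
apply/matrixP; do 2!elim/ord3P; rewrite !mxE /= ?rmorph0 ?rmorph1 ?addr0 ?add0r //.
by rewrite addrC.
Qed.

Lemma block_red n (b : 'I_2 -> O) :
  (block_mx 0 0 0 (companion (fun k => Ored n (b k))) : 'M_(1 + 2)) =
  redm n (mx3 0 0 0 0 0 (- b 0) 0 1 (- b 1)).
Proof.
have e0 : i0 = lshift 2 (0 : 'I_1) by apply: val_inj.
have e1 : i1 = rshift 1 (0 : 'I_2) by apply: val_inj.
have e2 : i2 = rshift 1 (1 : 'I_2) by apply: val_inj.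
apply/matrixP; do 2!elim/ord3P; rewrite [RHS]mxE [in RHS]mxE /=
  ?e0 ?e1 ?e2 ?(block_mxEul, block_mxEur, block_mxEdl, block_mxEdr) !mxE /=
  ?rmorph0 ?rmorph1 ?rmorphN //.
Qed.

Lemma companion3_red n (c : 'I_3 -> O) :
  companion (fun k => Ored n (c k)) = redm n (comp3 (c i0) (c i1) (c i2)).
Proof.
rewrite /comp3 map_mx3 !rmorphN rmorph0 rmorph1.
by apply/matrixP; do 2!elim/ord3P; rewrite !mxE.
Qed.

(** * The listed matrices as reductions of exact matrices over O *)

Variable l : nat.

Lemma case_iP M : case_i eps l M <-> exists2 d, is_rep l d & M = redm l d%:M.
Proof.
split=> [[d gd ->]|[d rd ->]].
  by exists (repO d); [exists d|rewrite map_scalar_mx /= repOK].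
by exists (Ored l d); [exact: gu1_red (is_rep_skew rd)|rewrite map_scalar_mx].
Qed.

Lemma case_iiP M : case_ii eps s0 l M <-> exists i d a,
  [/\ (i < l)%N, is_rep l d, cj a = - a, kred a != 0 &
      M = redm l (d%:M + pi ^+ i *: form_ii a)].
Proof.
split=> [[i [d [a [il gd ua ga ->]]]]|[i [d [a [il rd sa ka ->]]]]].
  have n0 : (0 < l - i)%N by rewrite subn_gt0.
  exists i, (repO d), (repO a); split=> //; [by exists d|exact: repO_skew| |].
    by apply/(unit_redP _ n0); rewrite repOK.
  rewrite map_mxD map_scalar_mx /= repOK -pi_scale_red 1?ltnW //.
  by rewrite -mx_D_red repOK.
exists i, (Ored l d), (Ored (l - i) a); split=> //; first exact: gu1_red (is_rep_skew rd).
- by apply/unit_redP => //; rewrite subn_gt0.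
- exact: gu1_red.
by rewrite map_mxD map_scalar_mx /= -pi_scale_red 1?ltnW // -mx_D_red.
Qed.

(* The residue class of an entry; meaningful only for [0 < n]. *)
Definition kres_of n (x : Oq eps n) : k2 := kred (qlift x).

Lemma kres_of_red n x : (0 < n)%N -> kres_of (Ored n x) = kred x.
Proof. by move=> n0; apply: (Ored_kred n0); rewrite Ored_qlift. Qed.

Lemma form_iii_split l' i j (d a b0 b1 : O) : (i <= j)%N ->
  redm l' (d%:M + pi ^+ i *: form_iii a (pi ^+ (j - i)) b0 b1) =
  redm l' d%:M + redm l' (pi ^+ i *: form_ii a) +
  redm l' (pi ^+ j *: mx3 0 0 0 0 0 (- b0) 0 1 (- b1)).
Proof.
move=> ij; have <- : pi ^+ i * pi ^+ (j - i) = pi ^+ j by rewrite -exprD subnKC.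
have -> : form_iii a (pi ^+ (j - i)) b0 b1 =
    form_ii a + pi ^+ (j - i) *: mx3 0 0 0 0 0 (- b0) 0 1 (- b1).
  by rewrite /form_iii /form_ii mx3Z mx3D; congr mx3; ring.
by rewrite scalerDr scalerA !map_mxD addrA.
Qed.

Lemma case_iiiP j C M : case_iii eps s0 l j C M <-> exists i d a b0 b1,
  [/\ [/\ (i < j)%N, (j < l)%N & is_rep j d], cj a = - a /\ kred a != 0,
      cj b0 = b0 /\ cj b1 = - b1,
      C = companion (fun k => Ored (l - j) (if k == 0 then b0 else b1)) &
      M = redm l (d%:M + pi ^+ i *: form_iii a (pi ^+ (j - i)) b0 b1)].
Proof.
split=> [[i [d [a [b [[ij jl] gd [ua ga] [CE sb1 sb0] ->]]]]]|].
  have il := ltn_trans ij jl.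
  have n0 : (0 < l - i)%N by rewrite subn_gt0.
  exists i, (repO d), (repO a), (repO (b 0)), (repO (b 1)).
  have CE' : C = companion (fun k => Ored (l - j) (if k == 0 then repO (b 0) else repO (b 1))).
    rewrite CE; congr companion; apply: functional_extensionality_dep => k.
    by case: k => [[|[|k]] hk] //=; rewrite repOK; congr b; apply: val_inj.
  split=> //.
  - by split=> //; exists d.
  - by split; [exact: repO_skew|apply/(unit_redP _ n0); rewrite repOK].
  - split; first exact: repO_real.
    by apply: repO_skew; rewrite /gu1 /= sb1 addNr.
  rewrite form_iii_split 1?ltnW // CE' -!pi_scale_red 1?ltnW // -mx_D_red repOK.
  by rewrite (block_red _ (fun k => if k == 0 then repO (b 0) else repO (b 1))) map_scalar_mx.
move=> [i [d [a [b0 [b1 [[ij jl [x gx dE]] [sa ka] [sb0 sb1] CE ->]]]]]].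
have il := ltn_trans ij jl.
exists i, x, (Ored (l - i) a), (fun k => Ored (l - j) (if k == 0 then b0 else b1)).
split=> //.
- by split; [apply/unit_redP => //; rewrite subn_gt0|exact: gu1_red].
- by split=> //=; rewrite Oconj_red ?sb0 ?sb1 ?rmorphN.
rewrite form_iii_split 1?ltnW // CE -!pi_scale_red 1?ltnW // -mx_D_red dE.
by rewrite (block_red _ (fun k => if k == 0 then b0 else b1)) map_scalar_mx.
Qed.

Lemma case_ivP i C M : case_iv eps s0 l i C M <-> exists d c0 c1 c2,
  [/\ (i < l)%N, is_rep i d, [/\ cj c0 = - c0, cj c1 = c1 & cj c2 = - c2],
      C = redm (l - i) (comp3 c0 c1 c2) &
      M = redm l (d%:M + pi ^+ i *: comp3 c0 c1 c2)].
Proof.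
split=> [[d [c [il gd CE sc ->]]]|[d [c0 [c1 [c2 [il [x gx dE] [sc0 sc1 sc2] CE ->]]]]]].
  have CE' : C = redm (l - i) (comp3 (repO (c i0)) (repO (c i1)) (repO (c i2))).
    rewrite CE -(companion3_red _ (fun k => repO (c k))); congr companion.
    by apply: functional_extensionality_dep => k; rewrite repOK.
  exists (repO d), (repO (c i0)), (repO (c i1)), (repO (c i2)); split; [exact: il|by exists d| |exact: CE'|].
  - have := (sc i0, sc i1, sc i2); rewrite /= expr0 expr1 sqrrN expr1n !mul1r mulN1r.
    move=> [[e0 e1] e2]; split; [exact: repO_skew| |exact: repO_skew].
    by apply: repO_real; apply/eqP; rewrite -subr_eq0; apply/eqP.
  by rewrite CE' pi_scale_red 1?ltnW // map_mxD map_scalar_mx.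
exists x, (fun k : 'I_3 => Ored (l - i) (if k == i0 then c0 else if k == i1 then c1 else c2)).
have CE' : C = companion (fun k : 'I_3 =>
    Ored (l - i) (if k == i0 then c0 else if k == i1 then c1 else c2)).
  by rewrite companion3_red.
split; [exact: il|exact: gx|exact: CE'| |].
- elim/ord3P; rewrite /= Oconj_red ?expr0 ?expr1 ?sqrrN ?expr1n ?mul1r ?mulN1r.
  + by rewrite sc0 rmorphN addNr.
  + by rewrite sc1 subrr.
  + by rewrite sc2 rmorphN addNr.
by rewrite CE pi_scale_red 1?ltnW // map_mxD map_scalar_mx dE.
Qed.

Lemma case_v_lift (P : forall n, 'M[Oq eps n]_3 -> Prop) M : case_v eps s0 l P M <->
  exists i d B, [/\ (i < l)%N, is_rep i d, P (l - i)%N (redm (l - i) B) &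
    M = redm l (d%:M + pi ^+ i *: B)].
Proof.
split=> [[i [d [E [il gd PE ->]]]]|[i [d [B [il [x gx ->] PB ->]]]]].
  have [B BE] := redm_lift E; exists i, (repO d), B; split=> //; first by exists d.
    by rewrite -BE.
  by rewrite BE pi_scale_red 1?ltnW // map_mxD map_scalar_mx.
exists i, x, (redm (l - i) B); split=> //.
by rewrite pi_scale_red 1?ltnW // map_mxD map_scalar_mx.
Qed.

Lemma val_pos n (c : O) : (0 < n)%N -> (0 < val_Oq (Ored n c))%N <-> kred c = 0.
Proof. by move=> n0; rewrite val_redP // expr1 kred_eq0P. Qed.

Lemma subcase_IP n (B : 'M[O]_3) : (0 < n)%N -> subcase_I eps n (redm n B) <->
  exists d c, [/\ is_rep n d, cj c = - c, kred c = 0 &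
    redm n B = redm n (d%:M + form_v 0 0 0 c)].
Proof.
move=> n0; have p0 : piq eps n n = Ored n 0.
  by rewrite /piq -rmorphXn; apply/Ored_eqP; exists 1; rewrite mulr1 add0r.
split=> [[c [d [gc gd vc ->]]]|[d [c [rd sc kc ->]]]].
  exists (repO d), (repO c); split; [by exists d|exact: repO_skew| |].
    by apply/(val_pos _ n0); rewrite repOK.
  by rewrite -mx_E_red !repOK p0 rmorph0.
exists (Ored n c), (Ored n d); split; [exact: gu1_red|exact: gu1_red (is_rep_skew rd)| |].
  exact/val_pos.
by rewrite -mx_E_red p0 rmorph0.
Qed.

Lemma val_exact n mu (b1 : O) : (mu < n)%N ->
  (val_Oq (Ored n (pi ^+ mu * b1)) = mu <-> kred b1 != 0) /\
  ((mu < val_Oq (Ored n (pi ^+ mu * b1)%R))%N <-> kred b1 = 0).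
Proof.
move=> mun.
have le : (mu <= val_Oq (Ored n (pi ^+ mu * b1)%R))%N.
  by apply/val_redP; [exact: ltnW|exists b1].
have lt : (mu < val_Oq (Ored n (pi ^+ mu * b1)%R))%N <-> kred b1 = 0.
  rewrite val_redP // kred_eq0P; split=> -[y yE]; exists y.
    by apply: (@piXI _ eps mu); rewrite yE exprSr mulrA.
  by rewrite yE exprSr mulrA.
split=> //; split=> [e|b0].
  by apply/eqP => /lt; rewrite e ltnn.
apply/eqP; rewrite eqn_leq le andbT leqNgt; apply/negP => /lt b00.
by rewrite b00 eqxx in b0.
Qed.

Lemma val_le_ex n mu (a : Oq eps n) : (mu <= n)%N -> (mu <= val_Oq a)%N ->
  exists a1, repO a = pi ^+ mu * a1.
Proof. by move=> mun; rewrite -{1}(repOK a) val_redP. Qed.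

Lemma cj_piX mu (x y : O) : x = pi ^+ mu * y ->
  (cj x = - x -> cj y = - y) /\ (cj x = x -> cj y = y).
Proof.
move=> ->; rewrite cjM cjXpi -mulrN.
by split=> [/piXI|/piXI].
Qed.

Lemma subcase_IIP n (B : 'M[O]_3) : subcase_II eps s0 n (redm n B) <->
  exists mu d a1 b1 c, [/\ (0 < mu < n)%N, is_rep mu d,
    [/\ cj a1 = - a1, cj b1 = b1 & cj c = - c], kred c = 0 /\ kred b1 != 0 &
    redm n B = redm n (d%:M + form_v (pi ^+ mu) (pi ^+ mu * a1) (pi ^+ mu * b1) c)].
Proof.
split.
  move=> [mu [a [b [c [d [mun [muE va] [sa sb] [gc vc gd] ->]]]]]].
  have /andP[mu0 mun'] := mun; have n0 := leq_ltn_trans (leq0n _) mun'.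
  have [b1 bE] : exists b1, repO b = pi ^+ mu * b1.
    by apply: val_le_ex; rewrite ?muE // -muE ltnW.
  have [a1 aE] : exists a1, repO a = pi ^+ mu * a1.
    by apply: val_le_ex; rewrite ?muE // -muE ltnW.
  exists mu, (repO d), a1, b1, (repO c); split; [exact: mun|by exists d| | |].
  - split; [apply: (cj_piX aE).1; exact: repO_skew| |exact: repO_skew].
    by apply: (cj_piX bE).2; apply/repO_real/eqP; rewrite -subr_eq0; apply/eqP.
  - split; first by apply/(val_pos _ n0); rewrite repOK.
    by apply/(proj1 (val_exact _ mun')); rewrite -bE repOK.
  by rewrite -aE -bE -mx_E_red !repOK rmorphXn.
move=> [mu [d [a1 [b1 [c [mun [x gx dE] [sa sb sc] [kc kb] ->]]]]]].
have /andP[mu0 mun'] := mun; have n0 := leq_ltn_trans (leq0n _) mun'.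
have vb : val_Oq (Ored n (pi ^+ mu * b1)) = mu by apply/(proj1 (val_exact _ mun')).
exists mu, (Ored n (pi ^+ mu * a1)), (Ored n (pi ^+ mu * b1)), (Ored n c), x.
split; [exact: mun| | | |].
- by rewrite vb; split; last by apply/val_redP; [exact: ltnW|exists a1].
- split; first by rewrite Oconj_red cjM cjXpi sa mulrN rmorphN addNr.
  by rewrite Oconj_red cjM cjXpi sb subrr.
- by split; [exact: gu1_red|exact/val_pos|exact: gx].
by rewrite -mx_E_red dE rmorphXn.
Qed.

Lemma subcase_III1P n (B : 'M[O]_3) : subcase_III1 eps s0 n (redm n B) <->
  exists mu d a1 b1 c, [/\ (0 < mu < n)%N, is_rep mu d,
    [/\ cj a1 = - a1, cj b1 = b1 & cj c = - c],
    [/\ kred c = 0, kred b1 = 0 & kred a1 != 0] &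
    redm n B = redm n (d%:M + form_v (pi ^+ mu) (pi ^+ mu * a1) (pi ^+ mu * b1) c)].
Proof.
split.
  move=> [mu [a [b [c [d [mun [muE va] [sa sb] [gc vc gd] ->]]]]]].
  have /andP[mu0 mun'] := mun; have n0 := leq_ltn_trans (leq0n _) mun'.
  have [b1 bE] : exists b1, repO b = pi ^+ mu * b1.
    by apply: val_le_ex; rewrite ?muE ltnW // -muE.
  have [a1 aE] : exists a1, repO a = pi ^+ mu * a1.
    by apply: val_le_ex; rewrite ?muE // -muE ltnW.
  exists mu, (repO d), a1, b1, (repO c); split; [exact: mun|by exists d| | |].
  - split; [apply: (cj_piX aE).1; exact: repO_skew| |exact: repO_skew].
    by apply: (cj_piX bE).2; apply/repO_real/eqP; rewrite -subr_eq0; apply/eqP.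
  - split; first by apply/(val_pos _ n0); rewrite repOK.
      by apply/(proj2 (val_exact _ mun')); rewrite -bE repOK muE.
    by apply/(proj1 (val_exact _ mun')); rewrite -aE repOK.
  by rewrite -aE -bE -mx_E_red !repOK rmorphXn.
move=> [mu [d [a1 [b1 [c [mun [x gx dE] [sa sb sc] [kc kb ka] ->]]]]]].
have /andP[mu0 mun'] := mun; have n0 := leq_ltn_trans (leq0n _) mun'.
have va : val_Oq (Ored n (pi ^+ mu * a1)) = mu by apply/(proj1 (val_exact _ mun')).
exists mu, (Ored n (pi ^+ mu * a1)), (Ored n (pi ^+ mu * b1)), (Ored n c), x.
split; [exact: mun| | | |].
- by rewrite va; split; last by apply/(proj2 (val_exact _ mun')).
- split; first by rewrite Oconj_red cjM cjXpi sa mulrN rmorphN addNr.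
  by rewrite Oconj_red cjM cjXpi sb subrr.
- by split; [exact: gu1_red|exact/val_pos|exact: gx].
by rewrite -mx_E_red dE rmorphXn.
Qed.

End Lifts.

(** * Uniqueness of the normal form *)

Section Mx3Invariants.
Variable R : comNzRingType.
Implicit Types X Z : 'M[R]_3.

Lemma det_mx3D X Z (P : R) : \det (X + P *: Z) =
  \det X + P * \tr (\adj X *m Z) + P ^+ 2 * \tr (X *m \adj Z) + P ^+ 3 * \det Z.
Proof.
have [x1 [x2 [x3 [x4 [x5 [x6 [x7 [x8 [x9 ->]]]]]]]]] := mx3_surj X.
have [z1 [z2 [z3 [z4 [z5 [z6 [z7 [z8 [z9 ->]]]]]]]]] := mx3_surj Z.
rewrite mx3Z mx3D !mx3_adj !mx3M !mx3_det !mx3_trace; ring.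
Qed.

(** The 2 x 2 minors of the rank-one part vanish, so every minor of the sum is a multiple of Q; m is
    that minor divided by Q, up to the order of its factors. *)
Lemma adj_rank1 (u1 u2 u3 v1 v2 v3 Q : R) W : exists A,
  \adj (mx3 (u1 * v1) (u1 * v2) (u1 * v3) (u2 * v1) (u2 * v2) (u2 * v3)
            (u3 * v1) (u3 * v2) (u3 * v3) + Q *: W) = Q *: A.
Proof.
have [w1 [w2 [w3 [w4 [w5 [w6 [w7 [w8 [w9 ->]]]]]]]]] := mx3_surj W.
rewrite mx3Z mx3D mx3_adj.
pose m (u v w u' v' w' a b : R) := u * v * w' + w * u' * v' + Q * w * w' - (u * v' * a + b * u' * v + Q * b * a).
exists (mx3 (m u2 v2 w5 u3 v3 w9 w8 w6) (m u1 v3 w3 u3 v2 w8 w9 w2) (m u1 v2 w2 u2 v3 w6 w5 w3)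
            (m u2 v3 w6 u3 v1 w7 w9 w4) (m u1 v1 w1 u3 v3 w9 w7 w3) (m u1 v3 w3 u2 v1 w4 w6 w1)
            (m u2 v1 w4 u3 v2 w8 w7 w5) (m u1 v2 w2 u3 v1 w7 w8 w1) (m u1 v1 w1 u2 v2 w5 w4 w2)).
rewrite mx3Z /m; congr mx3; ring.
Qed.

Lemma rank1E (u : 'cV[R]_3) (v : 'rV[R]_3) : exists u1 u2 u3 v1 v2 v3,
  u *m v = mx3 (u1 * v1) (u1 * v2) (u1 * v3) (u2 * v1) (u2 * v2) (u2 * v3)
            (u3 * v1) (u3 * v2) (u3 * v3).
Proof.
exists (u i0 0), (u i1 0), (u i2 0), (v 0 i0), (v 0 i1), (v 0 i2).
by apply/matrixP; do 2!elim/ord3P; rewrite !mxE big_ord1.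
Qed.

End Mx3Invariants.

Section Uniqueness.
Variables (o : compact_dvr) (eps : nonsquare_unit o).
Hypothesis hodd : odd_residue_char o.
Local Notation O := (quadext eps).
Local Notation k2 := (residue_field eps).
Local Notation cj := (@quadext_conj o eps).
Local Notation kred := (@kred o eps).
Local Notation pi := (qunif eps).
Local Notation Ored := (@Defs.Ored o eps).
Local Notation redm m := (map_mx (@Defs.Ored o eps m)).
Local Notation redk := (map_mx kred).

Definition simO l (M N : 'M[O]_3) : Prop :=
  exists g, g \in unitmx /\ redm l (M *m g) = redm l (g *m N).

Lemma simO_sym l M N : simO l M N -> simO l N M.
Proof.
move=> [g [ug e]]; exists (invmx g); split; first by rewrite unitmx_inv.
rewrite -[N in LHS](mulKmx ug) -(mulmxA (invmx g)) map_mxM.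
have -> : redm l (g *m N *m invmx g) = redm l M.
  by rewrite map_mxM -e -map_mxM (mulmxK ug).
by rewrite -map_mxM.
Qed.

Lemma simO_le l k M N : (k <= l)%N -> simO l M N -> simO k M N.
Proof. by move=> kl [g [ug e]]; exists g; split=> //; apply: redm_le e. Qed.

Lemma simO_exact l M N : simO l M N -> exists g Z,
  g \in unitmx /\ N = invmx g *m M *m g + pi ^+ l *: Z.
Proof.
move=> [g [ug e]]; exists g.
have /redm_eqP[Z ZE] : redm l N = redm l (invmx g *m M *m g).
  by rewrite -mulmxA map_mxM e -map_mxM (mulKmx ug).
by exists Z.
Qed.

Lemma simO_affine i n d B C : simO (i + n) (d%:M + pi ^+ i *: B) (d%:M + pi ^+ i *: C) ->
  simO n B C.
Proof.
by move=> [g [ug e]]; exists g; split; [exact: ug|apply/(redm_affine_mul i n d)].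
Qed.

Lemma simO_scalar k x M N : simO k M N -> redm k M = redm k x%:M -> redm k N = redm k x%:M.
Proof.
move=> /simO_exact[g [Z [ug ->]]] /redm_eqP[W ->].
apply/redm_eqP; exists (invmx g *m W *m g + Z).
rewrite mulmxDr mulmxDl -scalemxAr -scalemxAl scalar_mxC -(mulmxA x%:M) (mulVmx ug) mulmx1.
by rewrite scalerDr addrA.
Qed.

Definition rank1_mod k x (X : 'M[O]_3) : Prop :=
  exists (u : 'cV[O]_3) (v : 'rV[O]_3), redm k X = redm k (x%:M + u *m v).

Lemma rank1_sim k x M N : simO k M N -> rank1_mod k x M -> rank1_mod k x N.
Proof.
move=> /simO_exact[g [Z [ug ->]]] [u [v /redm_eqP[W ->]]].
exists (invmx g *m u), (v *m g); apply/redm_eqP; exists (invmx g *m W *m g + Z).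
rewrite !mulmxDr !mulmxDl -scalemxAr -scalemxAl scalar_mxC -(mulmxA x%:M) (mulVmx ug) mulmx1.
by rewrite scalerDr addrA !mulmxA.
Qed.

Lemma rank1_minor k x X i i' j j' : rank1_mod k x X ->
  Ored k ((X - x%:M) i j * (X - x%:M) i' j') = Ored k ((X - x%:M) i j' * (X - x%:M) i' j).
Proof.
move=> [u [v /redm_eqP[W ->]]].
have e r s : (x%:M + u *m v + pi ^+ k *: W - x%:M) r s = u r 0 * v 0 s + pi ^+ k * W r s.
  by rewrite !mxE big_ord1; ring.
rewrite !e; apply/Ored_eqP.
exists (u i 0 * v 0 j * W i' j' + W i j * (u i' 0 * v 0 j' + pi ^+ k * W i' j') -
  (u i 0 * v 0 j' * W i' j + W i j' * (u i' 0 * v 0 j + pi ^+ k * W i' j))).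
ring.
Qed.

Lemma simO_trace n X Y : simO n X Y -> Ored n (\tr X) = Ored n (\tr Y).
Proof.
move=> /simO_exact[g [Z [ug ->]]]; apply/Ored_eqP; exists (- \tr Z).
by rewrite mxtraceD mxtrace_mulC mulmxA (mulmxV ug) mul1mx mxtraceZ; ring.
Qed.

Lemma simO_sqr n X Y : simO n X Y -> simO n (X *m X) (Y *m Y).
Proof.
move=> [g [ug e]]; exists g; split=> //.
by rewrite -mulmxA map_mxM e -map_mxM mulmxA map_mxM e -map_mxM mulmxA.
Qed.

(** The linear term of det(Y + pi^n Z) is pi^n tr(adj(Y) Z), and adj(Y) vanishes modulo pi^k; the
    later terms contain pi^(2n), and k is at most n. *)
Lemma simO_det n k X Y : (k <= n)%N -> simO n X Y -> rank1_mod k 0 X ->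
  Ored (n + k) (\det X) = Ored (n + k) (\det Y).
Proof.
move=> kn XY r1X; have r1Y := rank1_sim (simO_le kn XY) r1X.
have /simO_exact[g [Z [ug XE]]] := simO_sym XY.
have [u [v /redm_eqP[W YE]]] := r1Y.
have [u1 [u2 [u3 [v1 [v2 [v3 uvE]]]]]] := rank1E (invmx g *m u) (v *m g).
have [A AE] := adj_rank1 u1 u2 u3 v1 v2 v3 (pi ^+ k) (invmx g *m W *m g).
have detg : \det (invmx g *m Y *m g) = \det Y.
  by rewrite !det_mulmx mulrAC -det_mulmx (mulVmx ug) det1 mul1r.
have YgE : invmx g *m Y *m g = (invmx g *m u) *m (v *m g) + pi ^+ k *: (invmx g *m W *m g).
  rewrite YE (_ : 0%:M = 0) ?add0r; last exact: raddf0.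
  by rewrite mulmxDr mulmxDl -scalemxAr -scalemxAl !mulmxA.
rewrite XE det_mx3D detg YgE uvE AE.
move: (mx3 _ _ _ _ _ _ _ _ _ + _) => T.
apply/Ored_eqP; exists (\tr (A *m Z) + pi ^+ (n - k) * (\tr (T *m \adj Z) + pi ^+ n * \det Z)).
rewrite -scalemxAl mxtraceZ !exprD.
have -> : pi ^+ n = pi ^+ (n - k) * pi ^+ k by rewrite -exprD subnK.
ring.
Qed.

Lemma rank1_mod0 x X : rank1_mod 0 x X.
Proof.
exists 0, 0; apply/redm_eqP; exists (X - (x%:M + (0 : 'cV_3) *m (0 : 'rV_3))).
by rewrite expr0 scale1r addrC subrK.
Qed.

Definition scalar_modpi (B : 'M[O]_3) : Prop := exists x, redm 1 B = redm 1 x%:M.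

Lemma base_congr i l d d' B B' : (i <= l)%N ->
  simO l (d%:M + pi ^+ i *: B) (d'%:M + pi ^+ i *: B') -> Ored i d = Ored i d'.
Proof.
move=> il /(simO_le il) /(@simO_scalar _ d) h.
have /redm_eqP[Z ZE] : redm i (d'%:M + pi ^+ i *: B') = redm i d%:M.
  by apply: h; apply/redm_eqP; exists B.
apply/Ored_eqP; exists (B' i0 i0 - Z i0 i0).
have /matrixP/(_ i0 i0) := ZE; rewrite !mxE /= !mulr1n => e.
by rewrite mulrBr addrA e; ring.
Qed.

(** If i < i', the second matrix and hence the first would be scalar modulo pi^(i+1), which makes B
    scalar modulo pi. *)
Lemma level_le i i' l d d' B B' : (i < l)%N -> (i' <= l)%N -> ~ scalar_modpi B ->
  simO l (d%:M + pi ^+ i *: B) (d'%:M + pi ^+ i' *: B') -> (i' <= i)%N.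
Proof.
move=> il il' nB sMM; rewrite leqNgt; apply/negP => ii'; apply: nB.
have := simO_scalar (x := d') (simO_sym (simO_le il sMM)).
have e : pi ^+ i' *: B' = pi ^+ i.+1 *: (pi ^+ (i' - i.+1) *: B').
  by rewrite scalerA -exprD subnKC.
rewrite e => h; have {}h : redm i.+1 (d%:M + pi ^+ i *: B) = redm i.+1 d'%:M.
  by apply: h; apply/redm_eqP; eexists.
have /Ored_eqP[f fE] : Ored i d' = Ored i d.
  have /matrixP/(_ i0 i0) := h; rewrite !mxE /= !mulr1n => /(Ored_le (leqnSn i)) <-.
  by apply/Ored_eqP; exists (B i0 i0).
exists f; apply/(redm_scale 1 i); move: h; rewrite addn1 fE.
have -> : (d + pi ^+ i * f)%:M = d%:M + pi ^+ i *: f%:M :> 'M[O]_3.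
  by rewrite raddfD /= scale_scalar_mx.
by rewrite 2!map_mxD => /addrI.
Qed.

Lemma base_shift i n d d' f B B' : d = d' + pi ^+ i * f ->
  simO (i + n) (d%:M + pi ^+ i *: B) (d'%:M + pi ^+ i *: B') -> simO n (f%:M + B) B'.
Proof.
move=> dE h; apply: (@simO_affine i n d').
have <- : d%:M + pi ^+ i *: B = d'%:M + pi ^+ i *: (f%:M + B); last exact: h.
by rewrite dE raddfD /= scalerDr addrA scale_scalar_mx.
Qed.

Lemma comp3_nonscalar c0 c1 c2 : ~ scalar_modpi (comp3 c0 c1 c2).
Proof.
move=> [x]; rewrite /comp3 mx3_scalar !map_mx3 => /mx3_inj[_ [e _ _] _].
by have /eqP := Ored_kred (ltn0Sn 0) e; rewrite rmorph1 rmorph0 oner_eq0.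
Qed.

Lemma form_iii_nonscalar a p b0 b1 : kred a != 0 -> ~ scalar_modpi (form_iii a p b0 b1).
Proof.
move=> ka [x]; rewrite /form_iii mx3_scalar !map_mx3 => /mx3_inj[[e _ _] [_ e' _] _].
have := Ored_kred (ltn0Sn 0) e; rewrite -(Ored_kred (ltn0Sn 0) e') rmorph0 => a0.
by rewrite a0 eqxx in ka.
Qed.

Lemma form_v_nonscalar t a b c : ~ scalar_modpi (form_v t a b c).
Proof.
move=> [x]; rewrite /form_v mx3_scalar !map_mx3 => /mx3_inj[_ [_ _ e] _].
by have /eqP := Ored_kred (ltn0Sn 0) e; rewrite rmorph1 rmorph0 oner_eq0.
Qed.

Lemma comp3_rank x c0 c1 c2 : ~ rank1_mod 1 x (comp3 c0 c1 c2).
Proof.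
(* The minor of C - x in the last two rows and first two columns is 1. *)
move=> /(rank1_minor i1 i2 i0 i1); rewrite !mxE /= !mulr0n !subr0 mulr1 mulr0.
by move=> /(Ored_kred (ltn0Sn 0)) /eqP; rewrite rmorph1 rmorph0 oner_eq0.
Qed.

Lemma form_iii_rank1 r f a b0 b1 :
  rank1_mod r f (f%:M + form_iii a (pi ^+ r) b0 b1).
Proof.
exists (\col_i (if i == i0 then 1 else 0)), (\row_i (if i == i0 then a else 0)).
apply/redm_eqP; exists (mx3 0 0 0 0 0 (- b0) 0 1 (- b1)).
rewrite -addrA; congr (_ + _); apply/matrixP; do 2!elim/ord3P;
  by rewrite !mxE big_ord1 !mxE /=; ring.
Qed.

Lemma form_v_rank1 mu f a1 b1 c :
  rank1_mod mu f (f%:M + form_v (pi ^+ mu) (pi ^+ mu * a1) (pi ^+ mu * b1) c).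
Proof.
exists (\col_i (if i == i0 then 0 else if i == i1 then 1 else c)).
exists (\row_i (if i == i2 then 1 else 0)).
apply/redm_eqP; exists (mx3 0 1 0 0 0 0 a1 b1 0).
rewrite -addrA; congr (_ + _); apply/matrixP; do 2!elim/ord3P;
  by rewrite !mxE big_ord1 !mxE /=; ring.
Qed.

Lemma Ored_cancel n (a x y : O) : kred a != 0 -> Ored n (a * x) = Ored n (a * y) ->
  Ored n x = Ored n y.
Proof.
move=> /unit_of_kred[b ba] e.
by rewrite -[x]mul1r -[y]mul1r -ba -!mulrA !(rmorphM (Ored n) b) /= e.
Qed.

Lemma piX_dvd r s z : pi ^+ r = pi ^+ s * z -> (s <= r)%N.
Proof.
rewrite leqNgt => e; apply/negP => rs.
have : 1 = pi ^+ (s - r) * z :> O.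
  by apply: (@piXI _ eps r); rewrite mulr1 mulrA -exprD subnKC // ltnW.
move=> /(congr1 kred); rewrite kred_pi0 ?subn_gt0 // rmorph1 => /eqP.
by rewrite oner_eq0.
Qed.

(** Rank one modulo pi^r kills (a' - f) f and (a' - f) pi^r'. The minor of the lower block shows
    that f vanishes modulo pi, so a' - f is a unit and both remaining factors vanish modulo pi^r. *)
Lemma form_iii_shift r r' f a a' b0 b1 b0' b1' : (0 < r)%N -> (0 < r')%N -> kred a' != 0 ->
  simO r (f%:M + form_iii a (pi ^+ r) b0 b1) (form_iii a' (pi ^+ r') b0' b1') ->
  (r <= r')%N /\ Ored r f = 0.
Proof.
move=> r0 r0' ka' h; have {}h := rank1_sim h (form_iii_rank1 r f a b0 b1).
have m1 := rank1_minor i0 i1 i0 i1 h; have m2 := rank1_minor i0 i2 i0 i1 h.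
have m3 := rank1_minor i1 i2 i1 i2 h.
rewrite !mxE /= !mulr1n !mulr0n in m1 m2 m3.
have kf : kred f = 0.
  have : kred (f * f + pi ^+ r' * (f * b1')) = kred (pi ^+ r' * (- (b0' * pi ^+ r'))).
    by move: (Ored_kred r0 m3); congr (kred _ = kred _); ring.
  rewrite rmorphD /= !kred_pi0 // addr0 rmorphM => /eqP.
  by rewrite mulf_eq0 orbb => /eqP.
have kaf : kred (a' - f) != 0 by rewrite rmorphB /= kf subr0.
have f0 : Ored r f = 0.
  have e : Ored r (- f) = Ored r 0.
    by apply: (Ored_cancel kaf); move: m1; congr (Ored r _ = Ored r _); ring.
  by rewrite -[f]opprK rmorphN /= e rmorph0 oppr0.
split=> //; have : Ored r (pi ^+ r') = 0.
  rewrite -(rmorph0 (Ored r)); apply: (Ored_cancel kaf).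
  by move: m2; congr (Ored r _ = Ored r _); ring.
by move=> /Ored_eq0[z /piX_dvd].
Qed.

(** The entry 1 in position (2, 3), with 0 above it, turns two of the minors into - f and pi^mu'. *)
Lemma form_v_shift mu mu' f a1 b1 c a1' b1' c' :
  simO mu (f%:M + form_v (pi ^+ mu) (pi ^+ mu * a1) (pi ^+ mu * b1) c)
    (form_v (pi ^+ mu') (pi ^+ mu' * a1') (pi ^+ mu' * b1') c') ->
  (mu <= mu')%N /\ Ored mu f = 0.
Proof.
move=> h; have {}h := rank1_sim h (form_v_rank1 mu f a1 b1 c).
have m1 := rank1_minor i0 i1 i0 i2 h; have m2 := rank1_minor i0 i1 i1 i2 h.
rewrite !mxE /= !mulr1n !mulr0n in m1 m2.
have f0 : Ored mu f = 0.
  have e : Ored mu (- f) = Ored mu 0.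
    by move: m1; congr (Ored mu _ = Ored mu _); ring.
  by rewrite -[f]opprK rmorphN /= e rmorph0 oppr0.
split=> //; have : Ored mu (pi ^+ mu') = 0.
  rewrite -(rmorph0 (Ored mu)).
  by move: m2; congr (Ored mu _ = Ored mu _); ring.
by move=> /Ored_eq0[z /piX_dvd].
Qed.

(** Separates the two families that are scalar plus rank one modulo pi: here f and f + a are
    eigenvalues modulo pi that differ by a unit, whereas [form_v] has square zero there. *)
Lemma form_iii_square_nonzero f a r b0 b1 : (0 < r)%N -> kred a != 0 ->
  redm 1 ((f%:M + form_iii a (pi ^+ r) b0 b1) *m (f%:M + form_iii a (pi ^+ r) b0 b1)) <> redm 1 0.
Proof.
move=> r0 ka; rewrite mx3_scalar mx3_0 /form_iii mx3D mx3M !map_mx3.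
move=> /mx3_inj[[e0 _ _] [_ e1 _] _].
have kf : kred f = 0.
  have := Ored_kred (ltn0Sn 0) e1.
  rewrite (_ : _ + _ + _ = f * f + pi ^+ r * (- b0 * pi ^+ r)); last by ring.
  by rewrite rmorphD /= kred_pi0 // addr0 rmorphM rmorph0 => /eqP; rewrite mulf_eq0 orbb => /eqP.
have := Ored_kred (ltn0Sn 0) e0.
rewrite (_ : _ + _ + _ = (f + a) * (f + a)); last by ring.
rewrite rmorphM rmorph0 => /eqP; rewrite mulf_eq0 orbb rmorphD /= kf add0r.
by rewrite (negPf ka).
Qed.

Lemma form_v_square mu a1 b1 c : (0 < mu)%N -> kred c = 0 ->
  redm 1 (form_v (pi ^+ mu) (pi ^+ mu * a1) (pi ^+ mu * b1) c *m
    form_v (pi ^+ mu) (pi ^+ mu * a1) (pi ^+ mu * b1) c) = redm 1 0.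
Proof.
case: mu => // mu _ /kred_eq0P[z ->]; apply/redm_eqP.
rewrite /form_v mx3M; set p := pi ^+ mu.
exists (mx3 0 0 p (p * a1) (p * b1) z (pi * z * p * a1) (p * a1 * pi * p + pi * z * p * b1) (p * b1 + z * pi * z)).
by rewrite add0r expr1 mx3Z !exprS -/p; congr mx3; ring.
Qed.

End Uniqueness.

(** * Normal forms and the uniqueness of their parameters *)

Section NormalFormUniqueness.
Variables (o : compact_dvr) (eps : nonsquare_unit o).
Hypothesis hodd : odd_residue_char o.
Local Notation O := (quadext eps).
Local Notation cj := (@quadext_conj o eps).
Local Notation kred := (@kred o eps).
Local Notation pi := (qunif eps).
Local Notation Ored := (@Defs.Ored o eps).
Local Notation redm m := (map_mx (@Defs.Ored o eps m)).

Lemma Ored_two n (x y : O) : Ored n (2%:R * x) = Ored n (2%:R * y) -> Ored n x = Ored n y.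
Proof. by apply: Ored_cancel; rewrite -unitOE two_unit. Qed.

Lemma Ored_piX n k (x y : O) :
  Ored (n + k) (pi ^+ k * x) = Ored (n + k) (pi ^+ k * y) -> Ored n x = Ored n y.
Proof.
move=> /Ored_eqP[z zE]; apply/Ored_eqP; exists z; apply: (@piXI _ eps k).
by rewrite zE mulrDr mulrA -exprD (addnC k).
Qed.

Lemma rank1_mod_le k m x (X : 'M[O]_3) : (m <= k)%N -> rank1_mod k x X -> rank1_mod m x X.
Proof. by move=> mk [u [v e]]; exists u, v; apply: redm_le e. Qed.

Lemma comp3_unique n c0 c1 c2 c0' c1' c2' :
  simO n (comp3 c0 c1 c2 : 'M[O]_3) (comp3 c0' c1' c2') ->
  redm n (comp3 c0 c1 c2) = redm n (comp3 c0' c1' c2').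
Proof.
move=> h; have t := simO_trace h; have t2 := simO_trace (simO_sqr h).
have := simO_det (leq0n n) h (rank1_mod0 0 _); rewrite addn0 => d.
move: t t2 d; rewrite /comp3 !mx3M !mx3_trace !mx3_det => t t2 d.
have e2 : Ored n (- c2) = Ored n (- c2').
  by move: t; congr (Ored n _ = Ored n _); ring.
have e0 : Ored n (- c0) = Ored n (- c0').
  by move: d; congr (Ored n _ = Ored n _); ring.
have e1 : Ored n (- c1) = Ored n (- c1').
  apply: Ored_two; have e22 : Ored n (c2 * c2) = Ored n (c2' * c2').
    have -> : c2 * c2 = (- c2) * (- c2) by ring.
    have -> : c2' * c2' = (- c2') * (- c2') by ring.
    by rewrite !(rmorphM (Ored n)) /= e2.
  have t2' : Ored n (c2 * c2 - 2%:R * c1) = Ored n (c2' * c2' - 2%:R * c1').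
    by move: t2; congr (Ored n _ = Ored n _); ring.
  move: t2'; rewrite !rmorphB /= e22 => /addrI.
  by rewrite !mulrN !rmorphN.
by rewrite !map_mx3 /= e0 e1 e2.
Qed.

Lemma form_v_unique n mu a1 b1 c a1' b1' c' (p := pi ^+ mu) : (mu <= n)%N ->
  simO n (form_v p (p * a1) (p * b1) c) (form_v p (p * a1') (p * b1') c') ->
  redm n (form_v p (p * a1) (p * b1) c) = redm n (form_v p (p * a1') (p * b1') c').
Proof.
move=> mun h; have t := simO_trace h; have t2 := simO_trace (simO_sqr h).
have r1 : rank1_mod mu 0 (form_v p (p * a1) (p * b1) c).
  by have := form_v_rank1 mu 0 a1 b1 c; rewrite raddf0 add0r.
have d := simO_det mun h r1.
move: t t2 d; rewrite /form_v !mx3M !mx3_trace !mx3_det => t t2 d.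
have ec : Ored n c = Ored n c'.
  by move: t; congr (Ored n _ = Ored n _); ring.
(* The determinant is pi^(2 mu) a1, known modulo pi^(n+mu): just enough to determine pi^mu a1 modulo
   pi^n. *)
have ea : Ored n (p * a1) = Ored n (p * a1').
  apply: (@Ored_piX n mu); rewrite -/p.
  by move: d; congr (Ored (n + mu) _ = Ored (n + mu) _); ring.
have eb : Ored n (p * b1) = Ored n (p * b1').
  apply: Ored_two; have e22 : Ored n (c * c) = Ored n (c' * c').
    by rewrite !(rmorphM (Ored n)) /= ec.
  have t2' : Ored n (c * c + 2%:R * (p * b1)) = Ored n (c' * c' + 2%:R * (p * b1')).
    by move: t2; congr (Ored n _ = Ored n _); ring.
  by move: t2'; rewrite !rmorphD /= e22 => /addrI.
by rewrite !map_mx3 /= ea eb ec.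
Qed.

(** The hypotheses say that (t - a)(t^2 + p b1 t + p^2 b0) and its primed version coincide. So a' is
    a root of the former, and the quadratic factor is a unit at a'. *)
Lemma root_transfer (R : comPzRingType) (a a' p b0 b1 b0' b1' u : R) :
  a - p * b1 = a' - p * b1' ->
  - a * p * b1 + p * p * b0 = - a' * p * b1' + p * p * b0' ->
  a * p * p * b0 = a' * p * p * b0' ->
  u * (a' * a' + p * b1 * a' + p * p * b0) = 1 -> a' = a.
Proof.
move=> t e d uE; apply/eqP; rewrite -subr_eq0 -[a' - a]mul1r -uE -mulrA; apply/eqP.
have -> : (a' * a' + p * b1 * a' + p * p * b0) * (a' - a) =
    a' * a' * a' - (a - p * b1) * (a' * a') +
    (- a * p * b1 + p * p * b0) * a' - a * p * p * b0 by ring.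
by rewrite t e d; ring.
Qed.

Lemma form_iii_unique n r a b0 b1 a' b0' b1' (p := pi ^+ r) : (0 < r <= n)%N ->
  kred a != 0 -> kred a' != 0 ->
  simO n (form_iii a p b0 b1) (form_iii a' p b0' b1') ->
  redm n (form_iii a p b0 b1) = redm n (form_iii a' p b0' b1').
Proof.
move=> /andP[r0 rn] ka ka' h; have n0 := leq_trans r0 rn.
have t := simO_trace h; have t2 := simO_trace (simO_sqr h).
have r1 : rank1_mod r 0 (form_iii a p b0 b1).
  by have := form_iii_rank1 r 0 a b0 b1; rewrite raddf0 add0r.
have d := simO_det rn h r1.
move: t t2 d; rewrite /form_iii !mx3M !mx3_trace !mx3_det => t t2 d.
have T : Ored n (a - p * b1) = Ored n (a' - p * b1').
  by move: t; congr (Ored n _ = Ored n _); ring.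
have D1 : Ored n (a * p * b0) = Ored n (a' * p * b0').
  apply: (@Ored_piX n r); rewrite -/p.
  by move: d; congr (Ored (n + r) _ = Ored (n + r) _); ring.
have D : Ored n (a * p * p * b0) = Ored n (a' * p * p * b0').
  have -> : a * p * p * b0 = a * p * b0 * p by ring.
  have -> : a' * p * p * b0' = a' * p * b0' * p by ring.
  by rewrite !(rmorphM (Ored n) _ p) /= D1.
have E : Ored n (- a * p * b1 + p * p * b0) = Ored n (- a' * p * b1' + p * p * b0').
  apply: Ored_two.
  have -> : 2%:R * (- a * p * b1 + p * p * b0) =
      (a - p * b1) * (a - p * b1) - (a * a + (p * b1) * (p * b1) - 2%:R * p * p * b0) by ring.
  have -> : 2%:R * (- a' * p * b1' + p * p * b0') =
      (a' - p * b1') * (a' - p * b1') - (a' * a' + (p * b1') * (p * b1') - 2%:R * p * p * b0') by ring.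
  have S : Ored n (a * a + (p * b1) * (p * b1) - 2%:R * p * p * b0) =
      Ored n (a' * a' + (p * b1') * (p * b1') - 2%:R * p * p * b0').
    by move: t2; congr (Ored n _ = Ored n _); ring.
  rewrite (rmorphB (Ored n) ((a - _) * _)) (rmorphB (Ored n) ((a' - _) * _)) /=.
  by rewrite S (rmorphM (Ored n) (a - _)) (rmorphM (Ored n) (a' - _)) /= T.
have [u uE] : exists u, u * (a' * a' + p * b1 * a' + p * p * b0) = 1.
  apply: unit_of_kred; have -> : a' * a' + p * b1 * a' + p * p * b0 =
    a' * a' + pi ^+ r * (b1 * a' + p * b0) by rewrite -/p; ring.
  by rewrite rmorphD /= kred_pi0 // addr0 rmorphM mulf_neq0.
have ea : Ored n a' = Ored n a.
  have {}uE := congr1 (Ored n) uE.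
  rewrite !(rmorphD, rmorphB, rmorphM, rmorphN, rmorph1) /= in T E D uE.
  exact: (root_transfer T E D uE).
have eb1 : Ored n (p * b1) = Ored n (p * b1').
  by move: T; rewrite !rmorphB /= ea => /addrI /oppr_inj.
have eb0 : Ored n (p * b0) = Ored n (p * b0').
  apply: (Ored_cancel ka); move: D1; rewrite -!mulrA.
  by rewrite !(rmorphM (Ored n) a) (rmorphM (Ored n) a') /= ea.
by rewrite !map_mx3 /= (rmorphN (Ored n) (p * b0)) (rmorphN (Ored n) (p * b1))
  (rmorphN (Ored n) (p * b0')) (rmorphN (Ored n) (p * b1')) /= ea eb1 eb0.
Qed.

Variable s0 : forall n, oq o n -> o.
Hypothesis hs0 : forall n (x : oq o n), ored n (s0 x) = x.
Hypothesis hs0N : forall n (x : oq o n), s0 (- x) = - s0 x.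
Local Notation is_rep := (is_rep s0).
Variable l : nat.

Definition nf1 (M : 'M[O]_3) : Prop := exists2 d, is_rep l d & M = d%:M.

Definition nf2 (M : 'M[O]_3) : Prop := exists i j d a b0 b1,
  [/\ (i < j <= l)%N, is_rep j d, cj a = - a /\ kred a != 0, cj b0 = b0 /\ cj b1 = - b1 &
      M = d%:M + pi ^+ i *: form_iii a (pi ^+ (j - i)) b0 b1].

Definition nf3 (M : 'M[O]_3) : Prop := exists i d c0 c1 c2,
  [/\ (i < l)%N, is_rep i d, [/\ cj c0 = - c0, cj c1 = c1 & cj c2 = - c2] &
      M = d%:M + pi ^+ i *: comp3 c0 c1 c2].

Definition nf4 (M : 'M[O]_3) : Prop := exists i d mu e a1 b1 c,
  [/\ (i < l)%N /\ (0 < mu <= l - i)%N, is_rep i d /\ is_rep mu e,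
      [/\ cj a1 = - a1, cj b1 = b1 & cj c = - c], kred c = 0 &
      M = (d + pi ^+ i * e)%:M +
          pi ^+ i *: form_v (pi ^+ mu) (pi ^+ mu * a1) (pi ^+ mu * b1) c].

Definition nf M := [\/ nf1 M, nf2 M, nf3 M | nf4 M].

Lemma redm_affine i n d (B C : 'M[O]_3) : redm n B = redm n C ->
  redm (i + n) (d%:M + pi ^+ i *: B) = redm (i + n) (d%:M + pi ^+ i *: C).
Proof. by move=> /(redm_scale n i) e; rewrite !map_mxD e. Qed.

Lemma affine_unique i d (B C : 'M[O]_3) : (i < l)%N ->
  (simO (l - i) B C -> redm (l - i) B = redm (l - i) C) ->
  simO l (d%:M + pi ^+ i *: B) (d%:M + pi ^+ i *: C) ->
  redm l (d%:M + pi ^+ i *: B) = redm l (d%:M + pi ^+ i *: C).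
Proof.
move=> il; have [n ->] : exists n, l = (i + n)%N by exists (l - i)%N; rewrite subnKC // ltnW.
by rewrite addKn => BC /simO_affine /BC /redm_affine.
Qed.

Lemma nf1_scalar M N : nf1 M -> simO l M N -> redm l M = redm l N.
Proof. by move=> [d _ ->] h; symmetry; apply: (simO_scalar h). Qed.

Lemma nonscalar_level M : nf2 M \/ nf3 M \/ nf4 M -> exists i d B,
  [/\ (i < l)%N, ~ scalar_modpi B & M = d%:M + pi ^+ i *: B].
Proof.
case=> [[i [j [d [a [b0 [b1 [/andP[ij jl] _ [_ ka] _ ->]]]]]]]|[]].
- exists i, d, (form_iii a (pi ^+ (j - i)) b0 b1); split; last reflexivity.
    exact: (leq_trans ij jl).
  exact: form_iii_nonscalar ka.
- move=> [i [d [c0 [c1 [c2 [il _ _ ->]]]]]].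
  exists i, d, (comp3 c0 c1 c2); split; [exact: il|exact: comp3_nonscalar|reflexivity].
move=> [i [d [mu [e [a1 [b1 [c [[il _] _ _ _ ->]]]]]]]].
exists i, (d + pi ^+ i * e), (form_v (pi ^+ mu) (pi ^+ mu * a1) (pi ^+ mu * b1) c).
by split; [exact: il|exact: form_v_nonscalar|reflexivity].
Qed.

Lemma nf1_other M N : nf1 M -> nf2 N \/ nf3 N \/ nf4 N -> ~ simO l M N.
Proof.
move=> [d _ ->] /nonscalar_level[i [e [B [il nB ->]]]] h; have {}h := simO_sym h.
have dE : d%:M = d%:M + pi ^+ l *: (0 : 'M[O]_3) by rewrite scaler0 addr0.
rewrite dE in h; have := level_le il (leqnn l) nB h.
by rewrite leqNgt il.
Qed.

Lemma same_level i i' d d' B B' : (i < l)%N -> (i' < l)%N ->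
  ~ scalar_modpi B -> ~ scalar_modpi B' ->
  simO l (d%:M + pi ^+ i *: B) (d'%:M + pi ^+ i' *: B') ->
  i = i' /\ exists2 f, d = d' + pi ^+ i * f & simO (l - i) (f%:M + B) B'.
Proof.
move=> il il' nB nB' h.
have ii : i = i'.
  apply/eqP; rewrite eqn_leq (level_le il (ltnW il') nB h) andbT.
  exact: (level_le il' (ltnW il) nB' (simO_sym h)).
split=> //; rewrite -ii in h; have /Ored_eqP[f fE] := base_congr (ltnW il) h.
exists f => //; apply: (base_shift fE); rewrite subnKC //; exact: ltnW.
Qed.

Lemma nf2_unique M N : nf2 M -> nf2 N -> simO l M N -> redm l M = redm l N.
Proof.
move=> [i [j [d [a [b0 [b1 [/andP[ij jl] rd [_ ka] _ ->]]]]]]].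
move=> [i' [j' [d' [a' [b0' [b1' [/andP[ij' jl'] rd' [_ ka'] _ ->]]]]]]] h.
have il := leq_trans ij jl; have il' := leq_trans ij' jl'.
have [ii [f fE sf]] := same_level il il' (@form_iii_nonscalar _ _ _ _ _ _ ka)
  (@form_iii_nonscalar _ _ _ _ _ _ ka') h.
have [_ [f' fE' sf']] := same_level il' il (@form_iii_nonscalar _ _ _ _ _ _ ka')
  (@form_iii_nonscalar _ _ _ _ _ _ ka) (simO_sym h).
rewrite -ii in ij' il' h sf sf' fE'.
have lej k : (k <= l)%N -> (k - i <= l - i)%N by move=> kl; apply: leq_sub2r.
(* Each matrix is scalar plus rank one to its own precision, so the two directions of similarity
   give opposite inequalities. *)
have [jj f0] : (j - i <= j' - i)%N /\ Ored (j - i) f = 0.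
  by apply: (form_iii_shift _ _ ka' (simO_le (lej _ jl) sf)); rewrite subn_gt0.
have [jj' _] : (j' - i <= j - i)%N /\ Ored (j' - i) f' = 0.
  by apply: (form_iii_shift _ _ ka (simO_le (lej _ jl') sf')); rewrite subn_gt0.
have jE : j = j'.
  rewrite -(subnKC (ltnW ij)) -(subnKC (ltnW ij')); congr (_ + _)%N.
  by apply/eqP; rewrite eqn_leq jj jj'.
have dE : d = d'.
  rewrite -jE in rd'; apply: (is_rep_inj hs0 rd rd'); apply/Ored_eqP.
  have /Ored_eq0[z zE] := f0; exists z.
  by rewrite fE zE mulrA -exprD subnKC // ltnW.
rewrite -jE -ii -dE in h *.
apply: affine_unique h => //; apply: form_iii_unique => //.
by rewrite subn_gt0 ij lej.
Qed.

Lemma nf3_unique M N : nf3 M -> nf3 N -> simO l M N -> redm l M = redm l N.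
Proof.
move=> [i [d [c0 [c1 [c2 [il rd _ ->]]]]]] [i' [d' [c0' [c1' [c2' [il' rd' _ ->]]]]]] h.
have [ii [f fE _]] := same_level il il' (@comp3_nonscalar _ _ _ _ _)
  (@comp3_nonscalar _ _ _ _ _) h.
rewrite -ii in h rd' *; have dE : d = d'.
  by apply: (is_rep_inj hs0 rd rd'); apply/Ored_eqP; exists f.
by rewrite -dE in h *; apply: affine_unique h => //; apply: comp3_unique.
Qed.

Lemma nf4_unique M N : nf4 M -> nf4 N -> simO l M N -> redm l M = redm l N.
Proof.
move=> [i [d [mu [e [a1 [b1 [c [[il /andP[_ mul]] [rd re] _ _ ->]]]]]]]].
move=> [i' [d' [mu' [e' [a1' [b1' [c' [[il' /andP[_ mul']] [rd' re'] _ _ ->]]]]]]]] h.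
have [ii [f fE sf]] := same_level il il' (@form_v_nonscalar _ _ _ _ _ _)
  (@form_v_nonscalar _ _ _ _ _ _) h.
have [_ [f' fE' sf']] := same_level il' il (@form_v_nonscalar _ _ _ _ _ _)
  (@form_v_nonscalar _ _ _ _ _ _) (simO_sym h).
rewrite -ii in h rd' mul' fE fE' sf' *.
(* Modulo pi^i the merged scalar determines the representative d; the shift f is then exactly e -
   e'. *)
have dE : d = d'.
  apply: (is_rep_inj hs0 rd rd'); apply/Ored_eqP; exists (e' + f - e).
  by apply: (addIr (pi ^+ i * e)); rewrite fE; ring.
have eE : e = e' + f.
  by apply: (@piXI _ eps i); apply: (addrI d'); rewrite -{1}dE fE; ring.
have [mm f0] := form_v_shift (simO_le mul sf).
have [mm' _] := form_v_shift (simO_le mul' sf').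
have muE : mu = mu' by apply/eqP; rewrite eqn_leq mm mm'.
have ee : e = e'.
  rewrite -muE in re'; apply: (is_rep_inj hs0 re re'); apply/Ored_eqP.
  by have /Ored_eq0[z zE] := f0; exists z; rewrite -zE.
rewrite -muE -dE -ee in h *.
by apply: affine_unique h => //; apply: form_v_unique.
Qed.

Lemma nf3_other M N : nf3 M -> nf2 N \/ nf4 N -> ~ simO l M N.
Proof.
move=> [i [d [c0 [c1 [c2 [il _ _ ->]]]]]] nN h.
have [i' [d' [B' [il' nB' NE r1]]]] : exists i' d' B', [/\ (i' < l)%N, ~ scalar_modpi B',
    N = d'%:M + pi ^+ i' *: B' & forall f, i' = i -> rank1_mod 1 f (f%:M + B')].
  case: nN => [[i' [j' [d' [a [b0 [b1 [/andP[ij jl] _ [_ ka] _ ->]]]]]]]|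
    [i' [d' [mu [e [a1 [b1 [c [[il' /andP[mu0 _]] _ _ _ ->]]]]]]]]].
    exists i', d', (form_iii a (pi ^+ (j' - i')) b0 b1); split=> //.
    - exact: (leq_trans ij jl).
    - exact: form_iii_nonscalar ka.
    - move=> f _; apply: (rank1_mod_le (k := (j' - i')%N)); first by rewrite subn_gt0.
      exact: form_iii_rank1.
  exists i', (d' + pi ^+ i' * e), (form_v (pi ^+ mu) (pi ^+ mu * a1) (pi ^+ mu * b1) c); split=> //.
  - exact: form_v_nonscalar.
  - by move=> f _; apply: (rank1_mod_le (k := mu)) => //; exact: form_v_rank1.
rewrite NE in h.
have [ii [f _ sf]] := same_level il' il nB' (@comp3_nonscalar _ _ _ _ _) (simO_sym h).
apply: (@comp3_rank _ _ f c0 c1 c2); apply: (rank1_sim (k := 1)); last exact: (r1 f ii).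
by apply: simO_le sf; rewrite subn_gt0.
Qed.

Lemma nf2_nf4 M N : nf2 M -> nf4 N -> ~ simO l M N.
Proof.
move=> [i [j [d [a [b0 [b1 [/andP[ij jl] rd [_ ka] _ ->]]]]]]].
move=> [i' [d' [mu [e [a1 [b1' [c [[il' /andP[mu0 _]] _ _ kc ->]]]]]]]] h.
have il := leq_trans ij jl.
have [ii [f _ sf]] := same_level il il' (@form_iii_nonscalar _ _ _ _ _ _ ka)
  (@form_v_nonscalar _ _ _ _ _ _) h.
have ji : (0 < j - i)%N by rewrite subn_gt0.
apply: (form_iii_square_nonzero (f := f) (b0 := b0) (b1 := b1) ji ka).
have s2 := simO_sqr (simO_sym (simO_le (k := 1) _ sf)).
have := simO_scalar (x := 0) (s2 _); rewrite raddf0; apply; first by rewrite subn_gt0.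
exact: form_v_square.
Qed.

Theorem nf_unique M N : nf M -> nf N -> simO l M N -> redm l M = redm l N.
Proof.
move=> [] mM [] mN h; have h' := simO_sym h.
- exact: nf1_scalar.
- by case: (nf1_other mM _ h); auto.
- by case: (nf1_other mM _ h); auto.
- by case: (nf1_other mM _ h); auto.
- by case: (nf1_other mN _ h'); auto.
- exact: nf2_unique.
- by case: (nf3_other mN _ h'); auto.
- by case: (nf2_nf4 mM mN h).
- by case: (nf1_other mN _ h'); auto.
- by case: (nf3_other mM _ h); auto.
- exact: nf3_unique.
- by case: (nf3_other mM _ h); auto.
- by case: (nf1_other mN _ h'); auto.
- by case: (nf2_nf4 mN mM h').
- by case: (nf3_other mN _ h'); auto.
- exact: nf4_unique.
Qed.

End NormalFormUniqueness.

(** * Existence of the normal form *)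

Section CyclicBasis.
Variable R : comUnitRingType.

Lemma mx3_unit a b c d e f g h k :
  (mx3 a b c d e f g h k \in unitmx) =
  (a * (e * k - f * h) - b * (d * k - f * g) + c * (d * h - e * g) \is a @GRing.unit R).
Proof. by rewrite unitmxE mx3_det. Qed.

Lemma basis_change (g B : 'M[R]_3) : g \in unitmx -> exists B', B *m g = g *m B'.
Proof. by move=> ug; exists (invmx g *m B *m g); rewrite !mulmxA (mulmxV ug) mul1mx. Qed.

Lemma next_col (g B B' : 'M[R]_3) (i j : 'I_3) : g \in unitmx -> B *m g = g *m B' ->
  (forall r, (B *m g) r i = g r j) -> forall r, B' r i = (r == j)%:R.
Proof.
move=> ug e c r.
have -> : B' = invmx g *m (B *m g) by rewrite e (mulKmx ug).
have := mulVmx ug => /matrixP/(_ r j); rewrite !mxE => <-.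
by apply: eq_bigr => t _; rewrite c.
Qed.

Definition cyclic_basis (B g : 'M[R]_3) : Prop := [/\ g \in unitmx,
  forall r, (B *m g) r i0 = g r i1 & forall r, (B *m g) r i1 = g r i2].

Lemma cyclic_basisP B g : cyclic_basis B g -> exists c0 c1 c2, B *m g = g *m comp3 c0 c1 c2.
Proof.
move=> [ug h0 h1]; have [B' e] := basis_change B ug.
have e0 := next_col ug e h0; have e1 := next_col ug e h1.
exists (- B' i0 i2), (- B' i1 i2), (- B' i2 i2); rewrite e; congr (_ *m _).
by rewrite [LHS]mx3_ex !e0 !e1 /= /comp3 !opprK.
Qed.

Definition orbit_mx (B : 'M[R]_3) (v : 'cV[R]_3) : 'M[R]_3 :=
  \matrix_(i, j) match nat_of_ord j with
    | 0%N => v i 0 | 1%N => (B *m v) i 0 | _ => (B *m (B *m v)) i 0 end.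

Definition col3 (x y z : R) : 'cV[R]_3 :=
  \col_t if t == i0 then x else if t == i1 then y else z.

Lemma orbit_mxE a b c d e f g h k x y z (B := mx3 a b c d e f g h k)
    (u := a * x + b * y + c * z) (v := d * x + e * y + f * z) (w := g * x + h * y + k * z) :
  orbit_mx B (col3 x y z) = mx3 x u (a * u + b * v + c * w)
    y v (d * u + e * v + f * w) z w (g * u + h * v + k * w).
Proof.
have e1 : B *m col3 x y z = col3 u v w.
  by apply/matrixP; elim/ord3P => j; rewrite !mxE sum3 !mxE.
have e2 : B *m col3 u v w = col3 (a * u + b * v + c * w) (d * u + e * v + f * w)
    (g * u + h * v + k * w).
  by apply/matrixP; elim/ord3P => j; rewrite !mxE sum3 !mxE.
by apply/matrixP; do 2!elim/ord3P; rewrite [LHS]mxE [RHS]mxE /= ?e1 ?e2 ?mxE.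
Qed.

Lemma orbit_mx_cyclic B v : orbit_mx B v \in unitmx -> cyclic_basis B (orbit_mx B v).
Proof.
move=> u; split=> // r; rewrite [RHS]mxE [RHS]/= mxE [RHS]mxE; apply: eq_bigr => t _;
  by congr (_ * _); rewrite mxE.
Qed.

End CyclicBasis.

(** * Non-scalar 3 x 3 matrices over a field *)

Section Trichotomy.
Variable F : fieldType.

(** A vector that is not an eigenvector is wanted as first column. The basis vectors detect
    off-diagonal entries, and sums of two of them detect unequal diagonal entries. *)
Lemma nonscalar_pair (B : 'M[F]_3) : (forall x, B <> x%:M) ->
  exists g, g \in unitmx /\ forall r, (B *m g) r i0 = g r i1.
Proof.
have [a [b [c [d [e [f [p [q [s ->]]]]]]]]] := mx3_surj B => nB.
have unit x y z (x' y' z' x'' y'' z'' : F) : x * (y' * z'' - y'' * z') - x' * (y * z'' - y'' * z) + x'' * (y * z' - y' * z) != 0 ->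
  mx3 x x' x'' y y' y'' z z' z'' \in unitmx by rewrite mx3_unit unitfE.
have fin x y z x' y' z' g : g = mx3 x (a * x + b * y + c * z) x' y (d * x + e * y + f * z) y' z (p * x + q * y + s * z) z' ->
  g \in unitmx -> exists g, g \in unitmx /\ forall r, (mx3 a b c d e f p q s *m g) r i0 = g r i1.
  move=> gE ug; exists g; split=> //; rewrite gE mx3M.
  by elim/ord3P; rewrite !mxE.
have [d0|/eqP d0] := eqVneq d 0; last first.
  by apply: (fin 1 0 0 0 0 1 _ erefl); apply: unit; apply/eqP=> E; apply: d0; rewrite -E; ring.
have [p0|/eqP p0] := eqVneq p 0; last first.
  by apply: (fin 1 0 0 0 1 0 _ erefl); apply: unit; apply/eqP=> E; apply: p0; rewrite -[LHS]opprK -(oppr0 F) -E; ring.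
have [b0|/eqP b0] := eqVneq b 0; last first.
  by apply: (fin 0 1 0 0 0 1 _ erefl); apply: unit; apply/eqP=> E; apply: b0; rewrite -[LHS]opprK -(oppr0 F) -E; ring.
have [q0|/eqP q0] := eqVneq q 0; last first.
  by apply: (fin 0 1 0 1 0 0 _ erefl); apply: unit; apply/eqP=> E; apply: q0; rewrite -E; ring.
have [c0|/eqP c0] := eqVneq c 0; last first.
  by apply: (fin 0 0 1 0 1 0 _ erefl); apply: unit; apply/eqP=> E; apply: c0; rewrite -E; ring.
have [f0|/eqP f0] := eqVneq f 0; last first.
  by apply: (fin 0 0 1 1 0 0 _ erefl); apply: unit; apply/eqP=> E; apply: f0; rewrite -[LHS]opprK -(oppr0 F) -E; ring.
rewrite {}d0 {}p0 {}b0 {}q0 {}c0 {}f0 in nB fin *.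
have [ae|/eqP ae] := eqVneq a e; last first.
  apply: (fin 1 1 0 0 0 1 _ erefl); apply: unit; apply/eqP=> E; apply: ae.
  by apply/eqP; rewrite -subr_eq0; apply/eqP; rewrite -[LHS]opprK -(oppr0 F) -E; ring.
have [es|/eqP es] := eqVneq e s; last first.
  apply: (fin 0 1 1 1 0 0 _ erefl); apply: unit; apply/eqP=> E; apply: es.
  by apply/eqP; rewrite -subr_eq0; apply/eqP; rewrite -[LHS]opprK -(oppr0 F) -E; ring.
by case: (nB s); rewrite ae es mx3_scalar.
Qed.

(** N - f has rank one and trace g - f; it is diagonalisable if the trace is non-zero and nilpotent
    otherwise. *)
Lemma rank1_trichotomy (f g e : F) (N := mx3 0 (- (f * g)) (- (f * e)) 1 (f + g) e 0 0 f) :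
  (exists h x t, [/\ h \in unitmx, t != 0 & N *m h = h *m mx3 (x + t) 0 0 0 x 0 0 0 x]) \/
  (exists h x, h \in unitmx /\ N *m h = h *m mx3 x 0 0 0 x 1 0 0 x).
Proof.
have [t0|t0] := eqVneq (g - f) 0.
  right; exists (mx3 (- e) (- f) 1 0 1 0 1 0 0), f; split.
    rewrite mx3_unit unitfE; rewrite (_ : _ + _ = -1); last by ring.
    by rewrite oppr_eq0 oner_eq0.
  have gf : g = f by apply/eqP; rewrite -subr_eq0; apply/eqP.
  by rewrite /N gf !mx3M; congr mx3; ring.
left; exists (mx3 (- f) (- g) (- e) 1 1 0 0 0 1), f, (g - f); split=> //.
  rewrite mx3_unit unitfE; rewrite (_ : _ + _ = g - f) //; ring.
by rewrite /N !mx3M; congr mx3; ring.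
Qed.

(** If c is non-zero, e_1 is cyclic. If c = 0, then N - f sends (x, y, 1) to (y1, y2, 0), and (x, y,
    1) is cyclic when X, the determinant of (y1, y2) and its image under the upper block, is
    non-zero. What remains is N - f of rank one. *)
Lemma cyclic_or_rank1 (a b c d e f : F) (N := mx3 0 a d 1 b e 0 c f) :
  (exists h, cyclic_basis N h) \/
  (exists g, N = mx3 0 (- (f * g)) (- (f * e)) 1 (f + g) e 0 0 f).
Proof.
have cyc (x y z X : F) : let y1 := d - f * x + a * y in let y2 := e + x + (b - f) * y in
   (c = 0 /\ z = 1 /\ X = y1 * y1 + b * y1 * y2 - a * y2 * y2) \/
   (x = 1 /\ y = 0 /\ z = 0 /\ X = c) -> X != 0 -> exists h, cyclic_basis N h.
  move=> y1 y2 HX X0; exists (orbit_mx N (col3 x y z)); apply: orbit_mx_cyclic.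
  rewrite /N orbit_mxE.
  rewrite mx3_unit unitfE.
  case: HX => [[c0 [z1 XE]]|[x1 [y0 [z0 XE]]]]; last first.
    by rewrite x1 y0 z0 (_ : _ + _ = X) // XE; ring.
  rewrite c0 z1 (_ : _ + _ = X) // XE /y1 /y2. ring.
have [c0|c0] := eqVneq c 0; last by left; apply: (cyc 1 0 0 c _ c0); right.
(* This is the characteristic polynomial of the upper block at f. Where it is non-zero, x and y are
   solved for so that (y1, y2) = (1, 0). *)
have [D0|D0] := eqVneq (f * (f - b) - a) 0; last first.
  left; pose D := f * (f - b) - a.
  apply: (cyc (((1 - d) * (b - f) + a * e) / D) ((f * e - (1 - d)) / D) 1 1 _ (oner_neq0 _)).
  left; split=> //; split=> //.
  have -> : d - f * (((1 - d) * (b - f) + a * e) / D) + a * ((f * e - (1 - d)) / D) = 1.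
    by rewrite /D; field.
  have -> : e + ((1 - d) * (b - f) + a * e) / D + (b - f) * ((f * e - (1 - d)) / D) = 0.
    by rewrite /D; field.
  by ring.
(* Now f and g are the eigenvalues of the block, and X = (y1 + f y2)(y1 + g y2). *)
pose g := b - f.
have bE : b = f + g by rewrite /g; ring.
have aE : a = - (f * g) by apply/eqP; rewrite -subr_eq0 -oppr_eq0 -D0; apply/eqP; rewrite /g; ring.
have [df|df] := eqVneq (d + f * e) 0.
  right; exists g; rewrite /N c0 aE bE; congr mx3.
  by apply/eqP; rewrite -subr_eq0 -[X in _ == X]df; apply/eqP; ring.
left; have [dg|dg] := eqVneq (d + g * e) 0.
  have gf : g - f != 0.
    apply: contra df; rewrite subr_eq0 => /eqP <-; by rewrite dg.
  apply: (cyc 1 0 1 ((d + f * e) * (g - f)) _ (mulf_neq0 df gf)); left; split=> //; split=> //.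
  have -> : (d + f * e) * (g - f) = (d + f * e) * (d + g * e + (g - f)) by rewrite dg add0r.
  by rewrite aE bE; ring.
apply: (cyc 0 0 1 ((d + f * e) * (d + g * e)) _ (mulf_neq0 df dg)); left; split=> //; split=> //.
by rewrite aE bE; ring.
Qed.

Lemma nonscalar_trichotomy (B : 'M[F]_3) : (forall x, B <> x%:M) ->
  [\/ exists g, cyclic_basis B g,
      exists g x t, [/\ g \in unitmx, t != 0 & B *m g = g *m mx3 (x + t) 0 0 0 x 0 0 0 x] |
      exists g x, g \in unitmx /\ B *m g = g *m mx3 x 0 0 0 x 1 0 0 x].
Proof.
move=> /nonscalar_pair[g [ug gc]]; have [N NE] := basis_change B ug.
have e0 := next_col ug NE gc.
have NE' : N = mx3 0 (N i0 i1) (N i0 i2) 1 (N i1 i1) (N i1 i2) 0 (N i2 i1) (N i2 i2).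
  by rewrite {1}[N]mx3_ex !e0.
have tr (h X : 'M[F]_3) : N *m h = h *m X -> B *m (g *m h) = g *m h *m X.
  by move=> e; rewrite mulmxA NE -(mulmxA g N h) e mulmxA.
have uM (h : 'M[F]_3) : h \in unitmx -> g *m h \in unitmx by rewrite unitmx_mul ug.
move: (cyclic_or_rank1 (N i0 i1) (N i1 i1) (N i2 i1) (N i0 i2) (N i1 i2) (N i2 i2)); rewrite -NE'.
case=> [[h [uh c1 c2]]|[q NR]].
  apply: Or31; exists (g *m h); split; first exact: uM.
  - by move=> r; rewrite mulmxA NE -(mulmxA g N h) mxE [RHS]mxE; apply: eq_bigr => t _; rewrite c1.
  - by move=> r; rewrite mulmxA NE -(mulmxA g N h) mxE [RHS]mxE; apply: eq_bigr => t _; rewrite c2.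
have := rank1_trichotomy (N i2 i2) q (N i1 i2); rewrite -NR.
case=> [[h [x [t [uh t0 e]]]]|[h [x [uh e]]]].
  by apply: Or32; exists (g *m h), x, t; split; [exact: uM|exact: t0|exact: tr].
by apply: Or33; exists (g *m h), x; split; [exact: uM|exact: tr].
Qed.

End Trichotomy.

Lemma opp_sum_swap (V : zmodType) (u v w t : V) : u + v = - (w + t) -> w + u = - (v + t).
Proof. by move=> e; rewrite -[u](addrK v) e !opprD; rewrite !addrA subrr add0r addrC. Qed.

(** * Invariants of matrices that are skew for a hermitian form *)

Section SkewMatrices.
Variables (o : compact_dvr) (eps : nonsquare_unit o).
Hypothesis hodd : odd_residue_char o.
Local Notation O := (quadext eps).
Local Notation k2 := (residue_field eps).
Local Notation cj := (@quadext_conj o eps).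
Local Notation kj := (@kconj o eps).
Local Notation kred := (@kred o eps).
Local Notation pi := (qunif eps).
Local Notation Ored := (@Defs.Ored o eps).
Local Notation redm m := (map_mx (@Defs.Ored o eps m)).
Local Notation redk := (map_mx (@Defs.kred o eps)).

Lemma redm_simO n (M N : 'M[O]_3) : redm n M = redm n N -> simO n M N.
Proof.
by move=> e; exists 1%:M; split; [exact: unitmx1|rewrite mulmx1 mul1mx].
Qed.

Lemma conj_simO n (g M N : 'M[O]_3) : g \in unitmx -> M *m g = g *m N -> simO n M N.
Proof. by move=> ug e; exists g; split=> //; rewrite e. Qed.

Lemma simO_trans n (M N P : 'M[O]_3) : simO n M N -> simO n N P -> simO n M P.
Proof.
move=> [g [ug e]] [h [uh f]]; exists (g *m h); split; first by rewrite unitmx_mul ug.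
by rewrite (mulmxA M) (map_mxM _ (M *m g)) e -map_mxM -(mulmxA g N) (map_mxM _ g) f -map_mxM mulmxA.
Qed.

Lemma affine_simO i n d (B C : 'M[O]_3) : simO n B C ->
  simO (i + n) (d%:M + pi ^+ i *: B) (d%:M + pi ^+ i *: C).
Proof.
by move=> [g [ug e]]; exists g; split; [exact: ug|apply/redm_affine_mul].
Qed.

Lemma conj_affine g d (c : O) (B C : 'M[O]_3) : B *m g = g *m C ->
  (d%:M + c *: B) *m g = g *m (d%:M + c *: C).
Proof.
by move=> e; rewrite mulmxDl mulmxDr -scalemxAl -scalemxAr mul_scalar_mx mul_mx_scalar e.
Qed.

Lemma skew_basis (H B g C : 'M[O]_3) : g \in unitmx -> B *m g = g *m C ->
  herm_form H -> skew_for H B ->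
  herm_form (star cj g *m H *m g) /\ skew_for (star cj g *m H *m g) C.
Proof.
move=> ug e [sH uH] sB; split.
  split; first by rewrite !starM starK sH mulmxA.
  rewrite !unitmx_mul uH ug !andbT.
  have e1 : star cj g *m star cj (invmx g) = 1%:M by rewrite -starM (mulVmx ug) star1.
  exact: (proj1 (mulmx1_unit e1)).
rewrite /skew_for -!mulmxA -e !mulmxA -starM -e starM.
by rewrite -!mulmxA (mulmxA (star cj B)) sB !mulNmx !mulmxN -!mulmxA.
Qed.

Lemma skew_sub d (H B : 'M[O]_3) : cj d = - d -> skew_for H B -> skew_for H (B - d%:M).
Proof.
move=> sd; rewrite /skew_for starB star_scalar sd mulmxBl mulmxBr => ->.
rewrite mul_scalar_mx mul_mx_scalar scaleNr opprB opprK addrC; congr (_ + _).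
Qed.

Lemma skew_similar (H B : 'M[O]_3) : herm_form H -> skew_for H B ->
  star cj B = H *m (- B) *m invmx H.
Proof.
by move=> [_ uH] sB; rewrite mulmxN -sB (mulmxK uH).
Qed.

Lemma skew_trace (H B : 'M[O]_3) : herm_form H -> skew_for H B -> cj (\tr B) = - \tr B.
Proof.
move=> hH sB; have <- : \tr (star cj B) = cj (\tr B).
  by rewrite /star trace_map_mx mxtrace_tr.
rewrite (skew_similar hH sB) mxtrace_mulC mulmxA (mulVmx (proj2 hH)) mul1mx.
by rewrite raddfN.
Qed.

Lemma skew_trace_sqr (H B : 'M[O]_3) : herm_form H -> skew_for H B ->
  cj (\tr (B *m B)) = \tr (B *m B).
Proof.
move=> hH sB; have <- : \tr (star cj (B *m B)) = cj (\tr (B *m B)).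
  by rewrite /star trace_map_mx mxtrace_tr.
rewrite starM (skew_similar hH sB) mxtrace_mulC !mulmxA (mulmxKV (proj2 hH)).
rewrite -!mulmxA mxtrace_mulC !mulmxA (mulmxKV (proj2 hH)).
by rewrite mulmxN mulNmx opprK.
Qed.

Lemma skew_det (H B : 'M[O]_3) : herm_form H -> skew_for H B -> cj (\det B) = - \det B.
Proof.
move=> hH sB; have <- : \det (star cj B) = cj (\det B).
  by rewrite /star det_map_mx det_tr.
have uH : \det H \is a GRing.unit by rewrite -unitmxE (proj2 hH).
rewrite (skew_similar hH sB) !det_mulmx det_inv mulrAC mulrV // mul1r.
rewrite -scaleN1r detZ; ring.
Qed.

(** Skewness makes (x + conj x) H vanish modulo pi^n, and H is invertible; so x may be replaced by
    (x - conj x)/2. *)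
Lemma scalar_skew n (H B : 'M[O]_3) x : herm_form H -> skew_for H B ->
  redm n B = redm n x%:M -> exists x', cj x' = - x' /\ redm n B = redm n x'%:M.
Proof.
move=> [sH uH] sB BE; exists (half eps * (x - cj x)); split.
  by rewrite cjM (conj_half eps hodd) cjD cjN conjK -mulrN opprB.
rewrite BE; have /redm_eqP[Z ZE] := BE.
have e : (x + cj x) *: H = - (pi ^+ n *: (star cj Z *m H + H *m Z)).
  move: sB; rewrite /skew_for ZE starD star_scalar starZ cjXpi mulmxDl mulmxDr.
  rewrite mul_scalar_mx mul_mx_scalar -scalemxAl -scalemxAr.
  by move=> /opp_sum_swap e; rewrite scalerDl scalerDr; exact: e.
have [W WE] : exists W, (x + cj x)%:M = pi ^+ n *: W :> 'M[O]_3.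
  exists (- ((star cj Z *m H + H *m Z) *m invmx H)).
  by rewrite scalerN scalemxAl -mulNmx -e -scalemxAl (mulmxV uH) scalemx1.
apply/redm_eqP; exists ((half eps) *: W).
have hE : half eps * (x - cj x) + half eps * (x + cj x) = x.
  rewrite -mulrDr (_ : x - cj x + (x + cj x) = 2%:R * x); last by ring.
  by rewrite mulrA (mulrC _ 2%:R) (half2 eps hodd) mul1r.
rewrite scalerA (mulrC (pi ^+ n)) -scalerA -WE scale_scalar_mx -[in LHS]hE.
by rewrite raddfD.
Qed.

End SkewMatrices.

Section Existence.
Variables (o : compact_dvr) (eps : nonsquare_unit o).
Hypothesis hodd : odd_residue_char o.
Local Notation O := (quadext eps).
Local Notation k2 := (residue_field eps).
Local Notation cj := (@quadext_conj o eps).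
Local Notation kj := (@kconj o eps).
Local Notation kred := (@kred o eps).
Local Notation pi := (qunif eps).
Local Notation Ored := (@Defs.Ored o eps).
Local Notation redm m := (map_mx (@Defs.Ored o eps m)).
Local Notation redk := (map_mx (@Defs.kred o eps)).

Lemma half_cancel (x y : O) : 2%:R * x = 2%:R * y -> x = y.
Proof.
by move=> e; rewrite -[x]mul1r -[y]mul1r -(half2 eps hodd) (mulrC 2%:R) -!mulrA e.
Qed.

Lemma cj_nat n : cj n%:R = n%:R.
Proof. exact: rmorph_nat. Qed.

Lemma comp3_skew H c0 c1 c2 : herm_form H -> skew_for H (comp3 c0 c1 c2) ->
  [/\ cj c0 = - c0, cj c1 = c1 & cj c2 = - c2].
Proof.
move=> hH sC; have t := skew_trace hH sC; have t2 := skew_trace_sqr hH sC.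
have d := skew_det hH sC; move: t t2 d; rewrite /comp3 !mx3M !mx3_trace !mx3_det => t t2 d.
have e2 : cj c2 = - c2.
  apply: oppr_inj; rewrite -cjN; move: t; rewrite (_ : _ + _ = - c2) => [|]; [by []|by ring].
have e0 : cj c0 = - c0.
  apply: oppr_inj; rewrite -cjN; move: d; rewrite (_ : _ + _ = - c0) => [|]; [by []|by ring].
split=> //; apply: half_cancel; apply: oppr_inj.
have: cj (c2 * c2 - 2%:R * c1) = c2 * c2 - 2%:R * c1.
  by move: t2; congr (cj _ = _); ring.
by rewrite cjD cjN !cjM cj_nat e2 mulrNN => /addrI.
Qed.

(** The determinant is pi^(2 mu) a1 and the trace of the square is c^2 + 2 pi^mu b1; over O the
    powers of pi cancel exactly. *)
Lemma form_v_skew_coef H mu a1 b1 c (p := pi ^+ mu) : herm_form H ->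
  skew_for H (form_v p (p * a1) (p * b1) c) -> [/\ cj a1 = - a1, cj b1 = b1 & cj c = - c].
Proof.
move=> hH sC; have t := skew_trace hH sC; have t2 := skew_trace_sqr hH sC.
have d := skew_det hH sC; move: t t2 d; rewrite /form_v !mx3M !mx3_trace !mx3_det => t t2 d.
have ec : cj c = - c by move: t; rewrite (_ : _ + _ = c) => [|]; [by []|by ring].
have ea : cj a1 = - a1.
  apply: (@piXI _ eps mu); apply: (@piXI _ eps mu); rewrite -/p.
  have: cj (p * (p * a1)) = - (p * (p * a1)) by move: d; congr (cj _ = - _); ring.
  by rewrite !cjM cjXpi !mulrN.
split=> //; apply: (@piXI _ eps mu); rewrite -/p; apply: half_cancel.
have: cj (c * c + 2%:R * (p * b1)) = c * c + 2%:R * (p * b1).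
  by move: t2; congr (cj _ = _); ring.
by rewrite cjD !cjM cj_nat cjXpi ec mulrNN => /addrI.
Qed.

Lemma cyclic_branch H B : herm_form H -> skew_for H B ->
  (exists g, cyclic_basis (redk B) g) ->
  exists g c0 c1 c2, [/\ g \in unitmx, B *m g = g *m comp3 c0 c1 c2 &
    [/\ cj c0 = - c0, cj c1 = c1 & cj c2 = - c2]].
Proof.
move=> hH sB [g [ug g1 g2]]; have [V VE] := redk_lift (\col_i g i i0).
have VE' r : kred (V r 0) = g r i0 by move/matrixP/(_ r 0): VE; rewrite !mxE.
have BV r : kred ((B *m V) r 0) = g r i1.
  rewrite -g1 !mxE rmorph_sum; apply: eq_bigr => t _.
  by rewrite rmorphM /= VE' mxE.
have BBV r : kred ((B *m (B *m V)) r 0) = g r i2.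
  rewrite -g2 !mxE rmorph_sum; apply: eq_bigr => t _.
  by rewrite rmorphM /= BV mxE.
have gE : redk (orbit_mx B V) = g.
  by apply/matrixP => r; elim/ord3P; rewrite mxE [orbit_mx _ _ _ _]mxE /=.
have uG : orbit_mx B V \in unitmx by rewrite unitmx_redk gE.
have [c0 [c1 [c2 e]]] := cyclic_basisP (orbit_mx_cyclic uG).
exists (orbit_mx B V), c0, c1, c2; split=> //.
by have [hH' sC] := skew_basis uG e hH sB; apply: comp3_skew hH' sC.
Qed.

Variable s0 : forall n, oq o n -> o.
Hypothesis hs0 : forall n (x : oq o n), ored n (s0 x) = x.
Hypothesis hs0N : forall n (x : oq o n), s0 (- x) = - s0 x.
Local Notation is_rep := (is_rep s0).

Lemma skew_rep n d : cj d = - d -> exists d' z, [/\ is_rep n d', d = d' + pi ^+ n * z & cj z = - z].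
Proof.
move=> sd; have [d' rd] := is_rep_ex hs0 n sd.
move=> /esym /Ored_eqP[z zE]; exists d', z; split=> //.
apply: (@piXI _ eps n); apply: (addrI (cj d')).
rewrite -{1}(cjXpi eps n) -cjM -cjD -zE sd (is_rep_skew hodd hs0N rd) zE; ring.
Qed.

(** As long as M is scalar modulo pi^l, the scalar may be taken skew and replaced by its
    representative; the quotient by pi^l is again skew for H. The level i is where this quotient
    first fails to be scalar modulo pi. *)
Lemma level_decomp l H M : herm_form H -> skew_for H M ->
  (exists2 d, cj d = - d & redm l M = redm l d%:M) \/
  exists i d B, [/\ (i < l)%N, is_rep i d, skew_for H B, ~ scalar_modpi B &
    M = d%:M + pi ^+ i *: B].
Proof.
move=> hH sM; elim: l => [|l [[d sd e]|[i [d [B [il rd sB nB ME]]]]]].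
- left; exists 0; first by rewrite cj0 oppr0.
  by apply/redm_eqP; exists (M - 0%:M); rewrite expr0 scale1r addrC subrK.
- have [d' [z [rd dE sz]]] := skew_rep l sd; have sd' := is_rep_skew hodd hs0N rd.
  have /redm_eqP[Z ME] := e.
  have [B BE] : exists B, M = d'%:M + pi ^+ l *: B.
    by exists (z%:M + Z); rewrite ME dE raddfD /= scalerDr addrA scale_scalar_mx.
  have sB : skew_for H B.
    have := skew_sub sd' sM; rewrite BE addrAC subrr add0r /skew_for.
    rewrite starZ cjXpi -scalemxAl -scalemxAr -scalerN => /matrixP eB.
    apply/matrixP => r s; apply: (@piXI _ eps l).
    by have := eB r s; rewrite mxE [RHS]mxE.
  have [[x Bx]|nB] := pselect (scalar_modpi B); last first.
    by right; exists l, d', B; split.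
  have [x' [sx' Bx']] := scalar_skew hodd hH sB Bx.
  left; exists (d' + pi ^+ l * x'); first by rewrite cjD cjM cjXpi sd' sx' mulrN opprD.
  have -> : (d' + pi ^+ l * x')%:M = d'%:M + pi ^+ l *: x'%:M :> 'M[O]_3.
    by rewrite raddfD /= scale_scalar_mx.
  by rewrite BE -(addn1 l); apply: redm_affine.
by right; exists i, d, B; split=> //; apply: ltnW.
Qed.

End Existence.

(** * Reduction similar to x + t E_11: splitting off an eigenvector *)

Section EigenvalueBranch.
Variables (o : compact_dvr) (eps : nonsquare_unit o).
Hypothesis hodd : odd_residue_char o.
Local Notation O := (quadext eps).
Local Notation k2 := (residue_field eps).
Local Notation cj := (@quadext_conj o eps).
Local Notation kj := (@kconj o eps).
Local Notation kred := (@kred o eps).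
Local Notation pi := (qunif eps).
Local Notation Ored := (@Defs.Ored o eps).
Local Notation redm m := (map_mx (@Defs.Ored o eps m)).
Local Notation redk := (map_mx (@Defs.kred o eps)).

Lemma redk_basis (g B B' : 'M[O]_3) : redk g = 1%:M -> B *m g = g *m B' -> redk B' = redk B.
Proof.
move=> g1 /(congr1 redk) e.
by rewrite (map_mxM _ B) (map_mxM _ g) /= g1 mulmx1 mul1mx in e.
Qed.

Lemma herm_mx3 (H : 'M[O]_3) : herm_form H -> exists a b c e f k,
  [/\ H = mx3 a b c (cj b) e f (cj c) (cj f) k, cj a = a, cj e = e & cj k = k].
Proof.
move=> [sH _]; have [a [b [c [d [e [f [p [q [k HE]]]]]]]]] := mx3_surj H.
move: sH; rewrite HE star_mx3 => /mx3_inj[[ea eb ec] [ed ee ef] [ep eq ek]].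
by exists a, b, c, e, f, k; split=> //; rewrite ed ep eq.
Qed.

Lemma kskew_split (x t a b c e f k : k2)
  (B := mx3 (x + t) 0 0 0 x 0 0 0 x) (H := mx3 a b c (kj b) e f (kj c) (kj f) k) :
  t != 0 -> \det H != 0 -> star kj B *m H = - (H *m B) ->
  [/\ kj x = - x, b = 0, c = 0 & a != 0].
Proof.
move=> t0 dH; rewrite /B /H kstar_mx3 !mx3M mx3N !rmorph0.
move=> /mx3_inj[[e00 e01 e02] [e10 e11 e12] [e20 e21 e22]].
rewrite ?(mul0r, mulr0, addr0, add0r) in e01 e02 e11 e12 e22.
rewrite rmorphD /= in e01 e02.
have cancel (y h : k2) : y * h = - (h * x) -> h != 0 -> y = - x.
  by move=> E h0; apply: (mulIf h0); rewrite E mulNr mulrC.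
(* As H is non-degenerate, its lower block has a non-zero entry, and the corresponding equation
   forces this. *)
have sx : kj x = - x.
  have [e0|/(cancel _ _ e11) //] := eqVneq e 0.
  have [f0|/(cancel _ _ e12) //] := eqVneq f 0.
  have [k0|/(cancel _ _ e22) //] := eqVneq k 0.
  by case/eqP: dH; rewrite /H mx3_det e0 f0 k0; ring.
have kt : kj t != 0 by rewrite fmorph_eq0.
have shift (h : k2) : (kj x + kj t) * h = - (h * x) -> h = 0.
  move=> E; apply: (mulfI kt); rewrite mulr0 -(addNr (h * x)) -E sx; ring.
have b0 := shift _ e01; have c0 := shift _ e02.
split=> //; apply: contraNneq dH => a0.
by rewrite /H mx3_det a0 b0 c0; apply/eqP; ring.
Qed.

Lemma eigen_step (R : comPzRingType) (a b c s e f u h k p X Y S U : R) :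
  s + e * X + f * Y - X * a - p * X * (b * X + c * Y) = S ->
  u + h * X + k * Y - Y * a - p * Y * (b * X + c * Y) = U ->
  mx3 a b c (p * s) e f (p * u) h k *m mx3 1 0 0 (p * X) 1 0 (p * Y) 0 1 =
  mx3 1 0 0 (p * X) 1 0 (p * Y) 0 1 *m
    mx3 (a + p * (b * X + c * Y)) b c (p * S) (e - p * X * b) (f - p * X * c)
        (p * U) (h - p * Y * b) (k - p * Y * c).
Proof. by move=> <- <-; rewrite !mx3M; congr mx3; ring. Qed.

(** The eigenvector for x + t is lifted one power of pi at a time: modulo pi the corrections X and Y
    have to solve s - t X = 0 and u - t Y = 0, and t is invertible. *)
Lemma eigen_lift (B : 'M[O]_3) x t n : redk B = mx3 (x + t) 0 0 0 x 0 0 0 x -> t != 0 ->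
  exists g a b c s e f u h k, [/\ g \in unitmx, redk g = 1%:M &
    B *m g = g *m mx3 a b c (pi ^+ n.+1 * s) e f (pi ^+ n.+1 * u) h k].
Proof.
move=> BE t0; elim: n => [|n [g [a [b [c [s [e [f [u [h [k [ug g1 Bg]]]]]]]]]]]].
  have [a [b [c [d [e [f [p [h [k BE']]]]]]]]] := mx3_surj B.
  move: BE; rewrite BE' map_mx3 => /mx3_inj[_ [/kred_eq0P[s ->] _ _] [/kred_eq0P[u ->] _ _]].
  exists 1%:M, a, b, c, s, e, f, u, h, k; split; [exact: unitmx1|exact: map_mx1|].
  by rewrite expr1 mulmx1 mul1mx.
have := redk_basis g1 Bg; rewrite BE map_mx3.
move=> /mx3_inj[[ka kb kc] [_ ke kf] [_ kh kk]].
have [T TE] := kred_surj t; have [w wT] : exists w, w * T = 1.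
  by apply: unit_of_kred; rewrite -TE.
have wt : kred w * t = 1 by rewrite TE -rmorphM wT rmorph1.
pose X := w * s; pose Y := w * u.
have bracket (S y y' : O) : kred y + kred y' = kred S * kred w * x ->
  exists z, S + y + y' - w * S * a - pi ^+ n.+1 * (w * S) * (b * X + c * Y) = pi * z.
  move=> E; apply/kred_eq0P; rewrite -[pi ^+ _ * _ * _]mulrA.
  rewrite !rmorphB /= (kred_pi0 _ (ltn0Sn n)) subr0 -addrA (rmorphD kred S) /= rmorphD /= E.
  rewrite !rmorphM /= ka.
  have -> : kred S + kred S * kred w * x - kred w * kred S * (x + t) =
    kred S - kred S * (kred w * t) by ring.
  by rewrite wt mulr1 subrr.
have [S SE] : exists z, s + e * X + f * Y - X * a - pi ^+ n.+1 * X * (b * X + c * Y) = pi * z.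
  by apply: bracket; rewrite !rmorphM /= ke kf; ring.
have [U UE] : exists z, u + h * X + k * Y - Y * a - pi ^+ n.+1 * Y * (b * X + c * Y) = pi * z.
  by apply: bracket; rewrite !rmorphM /= kh kk; ring.
have pE (z : O) : pi ^+ n.+1 * (pi * z) = pi ^+ n.+2 * z by rewrite mulrA -exprSr.
pose v := mx3 1 0 0 (pi ^+ n.+1 * X) 1 0 (pi ^+ n.+1 * Y) 0 1.
have v1 : redk v = 1%:M.
  by rewrite /v map_mx3 /= (kred_pi0 X (ltn0Sn n)) (kred_pi0 Y (ltn0Sn n)) rmorph0 rmorph1 mx3_scalar.
have uv : v \in unitmx by rewrite unitmx_redk v1 unitmx1.
have e' := eigen_step SE UE; rewrite -/v !pE in e'.
exists (g *m v); do 9!eexists; split.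
- by rewrite unitmx_mul ug uv.
- by rewrite map_mxM g1 v1 mulmx1.
- rewrite (mulmxA B) Bg -[LHS](mulmxA g) e' (mulmxA g); reflexivity.
Qed.

(** For an orthogonal sum of a line and a plane the equations decouple: those off the blocks express
    the first row through the first column, and the others say that the block-diagonal part is
    skew. *)
Lemma block_skew (R : comPzRingType) (c : {rmorphism R -> R}) (a b b' d d' e f h k E p q r v : R) :
  mx3 (c a) (c d) (c d') (c b) (c e) (c h) (c b') (c f) (c k) *m mx3 E 0 0 0 p q 0 r v =
    - (mx3 E 0 0 0 p q 0 r v *m mx3 a b b' d e f d' h k) ->
  [/\ c a * E = - (E * a), c d * p + c d' * r = - (E * b), c d * q + c d' * v = - (E * b') &
  mx3 (c a) 0 0 0 (c e) (c h) 0 (c f) (c k) *m mx3 E 0 0 0 p q 0 r v =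
    - (mx3 E 0 0 0 p q 0 r v *m mx3 a 0 0 0 e f 0 h k)].
Proof.
rewrite !mx3M !mx3N => /mx3_inj[[e0 e1 e2] [_ e4 e5] [_ e7 e8]].
split; [move: e0|move: e1|move: e2|congr mx3]; try (congr (_ = _); ring); try ring;
  [move: e0|move: e4|move: e5|move: e7|move: e8]; congr (_ = _); ring.
Qed.

Lemma tau_branch H B n : herm_form H -> skew_for H B -> (0 < n)%N ->
  (exists g x t, [/\ g \in unitmx, t != 0 & redk B *m g = g *m mx3 (x + t) 0 0 0 x 0 0 0 x]) ->
  exists H' b e f h k, let B' := mx3 b 0 0 0 e f 0 h k in
    [/\ herm_form H', skew_for H' B', simO n B B',
      [/\ kred b != kred e, kred f = 0, kred h = 0 & kred k = kred e] & cj b = - b].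
Proof.
move=> hH sB; case: n => // n _ [g0 [x [t [ug0 t0 Bg0]]]].
have [g gE] := redk_lift g0; have ug : g \in unitmx by rewrite unitmx_redk -gE.
have [B1 B1E] := basis_change B ug.
have [hH1 sB1] := skew_basis ug B1E hH sB.
have rB1 : redk B1 = mx3 (x + t) 0 0 0 x 0 0 0 x.
  have e := congr1 redk B1E; rewrite (map_mxM _ B) (map_mxM _ g) /= -gE Bg0 in e.
  by rewrite -[LHS](mulKmx ug0) -e (mulKmx ug0).
have [v [a [b [c [s [e [f [u [h [k [uv v1 B1v]]]]]]]]]]] := eigen_lift n rB1 t0.
have [hH2 sB2] := skew_basis uv B1v hH1 sB1.
have rB2 := redk_basis v1 B1v; rewrite rB1 in rB2.
move: (star cj v *m _ *m v) hH2 sB2 => H2 hH2 sB2.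
have [E [p [q [r [y [z [HE sE sr sz]]]]]]] := herm_mx3 hH2.
have dH : \det (redk H2) != 0 by rewrite -unitfE -unitmxE -unitmx_redk (proj2 hH2).
have := skew_for_redk sB2; rewrite rB2.
rewrite HE map_mx3 /= -!kconj_red in dH * => /(kskew_split t0 dH)[sx kp kq kE].
have [w wE] := unit_of_kred kE.
(* Gram-Schmidt: e_2 and e_3 are made orthogonal to e_1, whose norm E has the inverse w. As p and q
   vanish modulo pi, the residue is unchanged. *)
pose m := mx3 1 (- (w * p)) (- (w * q)) 0 1 0 0 0 1.
have m1 : redk m = 1%:M.
  by rewrite /m map_mx3 !rmorphN !rmorphM /= kp kq !mulr0 oppr0 rmorph0 rmorph1 mx3_scalar.
have um : m \in unitmx by rewrite unitmx_redk m1 unitmx1.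
have [B3 B3E] := basis_change (mx3 a b c (pi ^+ n.+1 * s) e f (pi ^+ n.+1 * u) h k) um.
have [hH3 sB3] := skew_basis um B3E hH2 sB2.
have rB3 := redk_basis m1 B3E; rewrite rB2 in rB3.
have [p' [q' [r' [v' H3E]]]] : exists p' q' r' v',
    star cj m *m H2 *m m = mx3 E 0 0 0 p' q' 0 r' v'.
  have Ew : E * w = 1 by rewrite mulrC.
  have sw : E * cj w = 1 by rewrite -{1}sE -cjM Ew cj1.
  do 4!eexists; rewrite HE /m star_mx3 !mx3M !cjN !cjM cj0 cj1.
  congr mx3; try reflexivity.
  - by rewrite mulr1 !mulr0 !addr0 !mul1r !mul0r !addr0.
  - by transitivity (p - E * w * p); [ring|rewrite Ew mul1r subrr].
  - by transitivity (q - E * w * q); [ring|rewrite Ew mul1r subrr].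
  - by transitivity (cj p - E * cj w * cj p); [ring|rewrite sw mul1r subrr].
  - by transitivity (cj q - E * cj w * cj q); [ring|rewrite sw mul1r subrr].
have [a3 [b3 [c3 [d3 [e3 [f3 [g3 [h3 [k3 B3E']]]]]]]]] := mx3_surj B3.
have [d3E g3E] : d3 = pi ^+ n.+1 * s /\ g3 = pi ^+ n.+1 * u.
  move: B3E; rewrite B3E' /m !mx3M => /mx3_inj[_ [e1 _ _] [e2 _ _]].
  by move: e1 e2; rewrite !(mulr0, mulr1, addr0, mul0r, add0r, mul1r).
move: sB3 hH3; rewrite H3E B3E' /skew_for star_mx3 => /(@block_skew _ cj)[ea eb ec eB] hH3.
have Eu X : E * X = 0 -> X = 0 by move=> E0; rewrite -[X]mul1r -wE -mulrA E0 mulr0.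
exists (mx3 E 0 0 0 p' q' 0 r' v'), a3, e3, f3, h3, k3.
move: rB3; rewrite B3E' map_mx3 => /mx3_inj[[ka _ _] [_ ke kf] [_ kh kk]]; split.
- exact: hH3.
- by rewrite /skew_for star_mx3 cj0.
(* Below the diagonal the first column is divisible by pi^(n+1), and skewness carries this over to
   the first row. Both are dropped modulo pi^(n+1), leaving an exactly skew block matrix. *)
- apply: (simO_trans (conj_simO _ ug B1E)); apply: (simO_trans (conj_simO _ uv B1v)).
  apply: (simO_trans (conj_simO _ um B3E)); apply: redm_simO; rewrite B3E'.
  have ex (X Y Z : O) : cj d3 * X + cj g3 * Y = - (E * Z) -> exists W, Z = pi ^+ n.+1 * W.
    rewrite d3E g3E !cjM cjXpi => E'; exists (- (w * (cj s * X + cj u * Y))).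
    rewrite -[Z]mul1r -wE -mulrA -[E * Z]opprK -E'; ring.
  have [b' bE] := ex _ _ _ eb; have [c' cE] := ex _ _ _ ec.
  apply/redm_eqP; exists (mx3 0 b' c' s 0 0 u 0 0).
  by rewrite bE cE d3E g3E mx3Z mx3D !mulr0 !addr0 !add0r.
- split; [|exact: kf|exact: kh|by rewrite kk ke].
  by rewrite ka ke -subr_eq0 addrC addKr.
- apply/eqP; rewrite -addr_eq0; apply/eqP/Eu.
  by rewrite mulrDr -[E * a3]opprK -ea mulrC subrr.
Qed.

End EigenvalueBranch.

(** * Listed representatives for reductions x + t E_11 *)

Section ExistenceSplit.
Variables (o : compact_dvr) (eps : nonsquare_unit o).
Hypothesis hodd : odd_residue_char o.
Local Notation O := (quadext eps).
Local Notation k2 := (residue_field eps).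
Local Notation cj := (@quadext_conj o eps).
Local Notation kj := (@kconj o eps).
Local Notation kred := (@kred o eps).
Local Notation pi := (qunif eps).
Local Notation Ored := (@Defs.Ored o eps).
Local Notation redm m := (map_mx (@Defs.Ored o eps m)).
Local Notation redk := (map_mx (@Defs.kred o eps)).

(** The common power of pi, capped at n so that it exists also when all three entries are zero. *)
Lemma content3 n (u f h : O) : exists m u' f' h',
  [/\ (m <= n)%N, u = pi ^+ m * u', f = pi ^+ m * f', h = pi ^+ m * h' &
      (m < n)%N -> [|| kred u' != 0, kred f' != 0 | kred h' != 0]].
Proof.
elim: n => [|n [m [u' [f' [h' [mn uE fE hE nz]]]]]].
  by exists 0%N, u, f, h; rewrite expr0 !mul1r.
case: (ltnP m n) => [{}mn|nm].
  by exists m, u', f', h'; split=> //; [exact: (leqW (ltnW mn))|move=> _; exact: nz].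
have {mn nm nz} mE : m = n by apply/eqP; rewrite eqn_leq mn.
rewrite mE in uE fE hE.
case: (boolP [|| kred u' != 0, kred f' != 0 | kred h' != 0]) => [nz|].
  by exists n, u', f', h'; split.
rewrite !negb_or !negbK => /and3P[/eqP/kred_eq0P[u1 u1E] /eqP/kred_eq0P[f1 f1E] /eqP/kred_eq0P[h1 h1E]].
exists n.+1, u1, f1, h1; split=> //; last by rewrite ltnn.
- by rewrite uE u1E mulrA -exprSr.
- by rewrite fE f1E mulrA -exprSr.
- by rewrite hE h1E mulrA -exprSr.
Qed.

(** A traceless block that is non-zero modulo pi has a cyclic vector among e_3, e_2 and e_2 + e_3;
    the last serves when only u is a unit, its determinant being h - f - 2 u. *)
Lemma block_cyclic (u f h : O) : [|| kred u != 0, kred f != 0 | kred h != 0] ->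
  exists g : 'M[O]_3, g \in unitmx /\ forall a p : O,
    mx3 a 0 0 0 (p * u) (p * f) 0 (p * h) (- (p * u)) *m g =
    g *m form_iii a p (- (u * u + f * h)) 0.
Proof.
have fin x y x' y' : x' = u * x + f * y -> y' = h * x - u * y -> kred (x * y' - x' * y) != 0 ->
    exists g : 'M[O]_3, g \in unitmx /\ forall a p : O,
    mx3 a 0 0 0 (p * u) (p * f) 0 (p * h) (- (p * u)) *m g =
    g *m form_iii a p (- (u * u + f * h)) 0.
  move=> xE yE D; exists (mx3 1 0 0 0 x x' 0 y y'); split.
    rewrite mx3_unit unitOE; congr (kred _ != 0) : D; ring.
  by move=> a p; rewrite /form_iii !mx3M xE yE; congr mx3; ring.
move=> nz; have [f0|f0] := eqVneq (kred f) 0; last first.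
  apply: (fin 0 1 _ _ erefl erefl); rewrite (_ : _ - _ = - f); last by ring.
  by rewrite rmorphN oppr_eq0.
have [h0|h0] := eqVneq (kred h) 0; last first.
  by apply: (fin 1 0 _ _ erefl erefl); congr (kred _ != 0) : h0; ring.
rewrite f0 h0 eqxx !orbF in nz; apply: (fin 1 1 _ _ erefl erefl).
have -> : 1 * (h * 1 - u * 1) - (u * 1 + f * 1) * 1 = h - f - 2%:R * u by ring.
rewrite !rmorphB /= h0 f0 subr0 sub0r oppr_eq0 rmorphM /= mulf_eq0 negb_or nz andbT.
by rewrite -unitOE two_unit.
Qed.

(** Absorbing p z replaces t by t - z in t^2 + b0; this frees the scalar to be the chosen
    representative modulo pi^j. *)
Lemma form_iii_translate (a p b0 z : O) : exists g : 'M[O]_3, g \in unitmx /\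
  ((p * z)%:M + form_iii a p b0 0) *m g =
  g *m form_iii (a + p * z) p (z * z + b0) (- (2%:R * z)).
Proof.
exists (mx3 1 0 0 0 1 z 0 0 1); split.
  by rewrite mx3_unit (_ : _ + _ = 1) ?unitr1 //; ring.
by rewrite mx3_scalar /form_iii mx3D !mx3M; congr mx3; ring.
Qed.

Variable s0 : forall n, oq o n -> o.
Hypothesis hs0 : forall n (x : oq o n), ored n (s0 x) = x.
Hypothesis hs0N : forall n (x : oq o n), s0 (- x) = - s0 x.
Local Notation is_rep := (is_rep s0).
Variable l : nat.

Definition has_listed (M : 'M[O]_3) : Prop :=
  exists N, listed eps s0 l (redm l N) /\ simO l M N.

Lemma has_listed_sim M N : simO l M N -> has_listed N -> has_listed M.
Proof. by move=> MN [P [lP NP]]; exists P; split=> //; apply: simO_trans MN NP. Qed.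

Lemma level_sim i d (B C : 'M[O]_3) : (i <= l)%N -> simO (l - i) B C ->
  simO l (d%:M + pi ^+ i *: B) (d%:M + pi ^+ i *: C).
Proof. by move=> il /(affine_simO i d); rewrite subnKC. Qed.

Lemma level_scalar i (d e : O) (C : 'M[O]_3) :
  d%:M + pi ^+ i *: (e%:M + C) = (d + pi ^+ i * e)%:M + pi ^+ i *: C.
Proof. by rewrite scalerDr addrA scale_scalar_mx -raddfD. Qed.

Lemma listed_ii i D a : (i < l)%N -> cj D = - D -> cj a = - a -> kred a != 0 ->
  has_listed (D%:M + pi ^+ i *: form_ii a).
Proof.
move=> il sD sa ka; have [d [z [rd DE _]]] := skew_rep hodd hs0 hs0N l sD.
exists (d%:M + pi ^+ i *: form_ii a); split.
  by right; left; apply/(case_iiP hodd hs0 hs0N); exists i, d, a; split.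
apply: redm_simO; apply/redm_eqP; exists z%:M.
by rewrite DE raddfD /= scale_scalar_mx addrAC.
Qed.

Lemma listed_iii i m D a b0 : (i < l)%N -> (0 < m < l - i)%N -> cj D = - D ->
  cj a = - a -> kred a != 0 -> cj b0 = b0 ->
  has_listed (D%:M + pi ^+ i *: form_iii a (pi ^+ m) b0 0).
Proof.
move=> il /andP[m0 ml] sD sa ka sb0.
have [d [z [rd DE sz]]] := skew_rep hodd hs0 hs0N (i + m) sD.
have [g [ug e]] := form_iii_translate a (pi ^+ m) b0 z.
have DE' : D%:M + pi ^+ i *: form_iii a (pi ^+ m) b0 0 =
    d%:M + pi ^+ i *: ((pi ^+ m * z)%:M + form_iii a (pi ^+ m) b0 0).
  by rewrite level_scalar DE exprD mulrA.
rewrite DE'; apply: has_listed_sim (conj_simO l ug (conj_affine d (pi ^+ i) e)) _.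
set N := _ + _; exists N; split; last exact: redm_simO.
right; right; left.
exists (i + m)%N, (companion (fun k : 'I_2 => Ored (l - (i + m)) (if k == 0 then z * z + b0 else - (2%:R * z)))).
apply/(case_iiiP hodd hs0 hs0N); exists i, d, (a + pi ^+ m * z), (z * z + b0), (- (2%:R * z)); split.
- by split; [rewrite -[X in (X < _)%N]addn0 ltn_add2l|rewrite -ltn_subRL|exact: rd].
- split; first by rewrite cjD cjM cjXpi sa sz mulrN opprD.
  by rewrite rmorphD /= (kred_pi0 z m0) addr0.
- split; first by rewrite cjD cjM sz sb0 mulrNN.
  by rewrite cjN cjM cj_nat sz mulrN.
- reflexivity.
- by rewrite addKn.
Qed.

Lemma listed_tau i d H B : (i < l)%N -> is_rep i d -> herm_form H -> skew_for H B ->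
  (exists g x t, [/\ g \in unitmx, t != 0 & redk B *m g = g *m mx3 (x + t) 0 0 0 x 0 0 0 x]) ->
  has_listed (d%:M + pi ^+ i *: B).
Proof.
move=> il rd hH sB; have n0 : (0 < l - i)%N by rewrite subn_gt0.
have sd := is_rep_skew hodd hs0N rd.
move=> /(tau_branch hH sB n0)[H' [b [e [f [h [k [hH' sB' BB [kbe kf kh kk] sb]]]]]]].
apply: has_listed_sim (level_sim d (ltnW il) BB) _.
(* Half the trace of the plane block goes into the scalar, so that the block becomes traceless. *)
pose d0 := half eps * (e + k); pose u := half eps * (e - k); pose a := b - d0.
have h2 x : half eps * x + half eps * x = x.
  by rewrite -mulr2n -mulr_natl mulrA (half2 eps hodd) mul1r.
have eE : e = d0 + u.
  by rewrite /d0 /u -mulrDr (_ : e + k + (e - k) = e + e) ?mulrDr ?h2 //; ring.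
have kE : k = d0 - u.
  by rewrite /d0 /u -mulrBr (_ : e + k - (e - k) = k + k) ?mulrDr ?h2 //; ring.
have sd0 : cj d0 = - d0.
  have := skew_trace hH' sB'; rewrite mx3_trace -addrA cjD sb opprD => /addrI ek.
  by rewrite /d0 cjM (conj_half eps hodd) ek mulrN.
have sa : cj a = - a by rewrite /a cjD cjN sb sd0 opprD.
have ku : kred u = 0 by rewrite /u rmorphM rmorphB /= kk subrr mulr0.
have ka : kred a != 0.
  have -> : a = b - e + u by rewrite eE /a; ring.
  by rewrite rmorphD rmorphB /= ku addr0 subr_eq0.
have BE : mx3 b 0 0 0 e f 0 h k = d0%:M + mx3 a 0 0 0 u f 0 h (- u).
  by rewrite mx3_scalar mx3D eE kE /a; congr mx3; ring.
rewrite BE level_scalar; have sD : cj (d + pi ^+ i * d0) = - (d + pi ^+ i * d0).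
  by rewrite cjD cjM cjXpi sd sd0 mulrN opprD.
have [m [u' [f' [h' [mn uE fE hE nz]]]]] := content3 (l - i) u f h.
case: (ltngtP m (l - i)) mn => // [mn _|mE _]; last first.
  apply: has_listed_sim (listed_ii il sD sa ka); apply: (level_sim _ (ltnW il)).
  apply: redm_simO; apply/redm_eqP; exists (mx3 0 0 0 0 u' f' 0 h' (- u')).
  by rewrite /form_ii mx3Z mx3D uE fE hE mE; congr mx3; ring.
have {}nz := nz mn; have m0 : (0 < m)%N.
  case: (m) uE fE hE nz => // uE fE hE; rewrite expr0 !mul1r in uE fE hE.
  by rewrite -uE -fE -hE ku kf kh eqxx.
have [g [ug ge]] := block_cyclic nz.
have {}ge := ge a (pi ^+ m); rewrite -uE -fE -hE in ge.
apply: has_listed_sim (conj_simO l ug (conj_affine _ (pi ^+ i) ge)) _.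
apply: listed_iii => //; first by rewrite m0.
have sB0 : skew_for H' (mx3 a 0 0 0 u f 0 h (- u)).
  by have := skew_sub sd0 sB'; rewrite BE addrAC subrr add0r.
have := skew_trace_sqr hH' sB0; rewrite mx3M mx3_trace uE fE hE => t2.
have {}t2 : cj (a * a + pi ^+ m * (pi ^+ m * (2%:R * (u' * u' + f' * h')))) =
    a * a + pi ^+ m * (pi ^+ m * (2%:R * (u' * u' + f' * h'))).
  by move: t2; congr (cj _ = _); ring.
rewrite cjN; congr (- _); apply: (half_cancel hodd).
apply: (@piXI _ eps m); apply: (@piXI _ eps m).
move: t2; rewrite cjD !(cjM a) sa mulrNN => /addrI.
by rewrite (cjM (pi ^+ m)) (cjM (pi ^+ m)) (cjM 2%:R) cjXpi cj_nat.
Qed.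

End ExistenceSplit.

(** * Reduction similar to x + E_23: bases adapted to the plane and its complement *)

Section NilpotentForms.
Variable R : comUnitRingType.

(* [form_v] over an arbitrary ring. *)
Definition mx_v (t a b c : R) : 'M[R]_3 := mx3 0 t 0 0 0 1 a b c.

(* For s = 0 the new basis is e1 - x e3, Y e3 - g2 e3, e3. *)
Lemma nil_normal (s t x g2 y g0 : R) : exists g : 'M[R]_3, g \in unitmx /\
  mx3 (- (s * t)) t 0 x g2 1 y g0 0 *m g =
  g *m mx_v t (y + s * g0) (g0 + t * (x + s * g2)) (g2 - s * t).
Proof.
exists (mx3 1 0 0 s 1 0 (- (x + s * g2)) (- (g2 - s * t)) 1); split.
  by rewrite mx3_unit (_ : _ + _ = 1) ?unitr1 //; ring.
by rewrite /mx_v !mx3M; congr mx3; ring.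
Qed.

(* The basis e1, Y (e1 + e3), e1 + e3, used when t has larger valuation than g0. *)
Lemma nil_twist (t x g2 y g0 r : R) (G := (1 + x) * g2 + y) : r * (1 + x) = 1 ->
  exists g : 'M[R]_3, g \in unitmx /\
  mx3 0 t 0 x g2 1 y g0 0 *m g =
  g *m mx3 (- (r * y)) ((1 + x) * (t - g0) + G * r * y) 0 (x * r) (G * r) 1
           (r * y) ((1 + x) * g0 - G * r * y) 0.
Proof.
move=> rx; exists (mx3 1 0 1 0 (1 + x) 0 0 y 1); split.
  rewrite mx3_unit (_ : _ + _ = 1 + x); last by ring.
  by apply/unitrP; exists r; rewrite rx mulrC rx.
rewrite !mx3M; congr mx3; rewrite -?/G; try ring.
- by transitivity (x * (r * (1 + x))); [rewrite rx; ring|ring].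
- by transitivity (G * (r * (1 + x))); [rewrite rx /G; ring|ring].
- by transitivity (y * (r * (1 + x))); [rewrite rx; ring|ring].
Qed.

Lemma form_v_rescale (w p a b c : R) : w \is a GRing.unit ->
  exists g : 'M[R]_3, g \in unitmx /\
  mx_v (p * w) a b c *m g = g *m mx_v p (w * a) b c.
Proof.
move=> uw; exists (mx3 w 0 0 0 1 0 0 0 1); split.
  by rewrite mx3_unit (_ : _ + _ = w) //; ring.
by rewrite /mx_v !mx3M; congr mx3; ring.
Qed.

(** A scalar divisible by p can be absorbed without leaving the shape; its trace 3 p z goes into c.
    This frees the scalar to be the chosen representative modulo pi^mu. *)
Lemma form_v_translate (p a1 b1 c z : R) : exists g : 'M[R]_3, g \in unitmx /\
  ((p * z)%:M + mx_v p (p * a1) (p * b1) c) *m g =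
  g *m mx_v p (p * (a1 - z * (b1 - z * (c + p * z))))
    (p * (b1 - z * (c + p * z) - z * (2%:R * p * z + c))) (c + 3%:R * p * z).
Proof.
exists (mx3 1 0 0 (- z) 1 0 (p * z * z) (- (2%:R * p * z)) 1); split.
  by rewrite mx3_unit (_ : _ + _ = 1) ?unitr1 //; ring.
by rewrite mx3_scalar /mx_v mx3D !mx3M; congr mx3; ring.
Qed.

End NilpotentForms.

Section NilpotentBranch.
Variables (o : compact_dvr) (eps : nonsquare_unit o).
Hypothesis hodd : odd_residue_char o.
Local Notation O := (quadext eps).
Local Notation k2 := (residue_field eps).
Local Notation cj := (@quadext_conj o eps).
Local Notation kj := (@kconj o eps).
Local Notation kred := (@kred o eps).
Local Notation pi := (qunif eps).
Local Notation Ored := (@Defs.Ored o eps).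
Local Notation redm m := (map_mx (@Defs.Ored o eps m)).
Local Notation redk := (map_mx (@Defs.kred o eps)).

Lemma kskew_nil (x a b c e f k : k2)
  (B := mx3 x 0 0 0 x 1 0 0 x) (H := mx3 a b c (kj b) e f (kj c) (kj f) k) :
  \det H != 0 -> star kj B *m H = - (H *m B) -> [/\ b = 0, e = 0, a != 0 & f != 0].
Proof.
move=> dH; rewrite /B /H kstar_mx3 !mx3M mx3N !rmorph0 rmorph1.
move=> /mx3_inj[[e00 e01 e02] [e10 e11 e12] _].
rewrite ?(mul0r, mulr0, addr0, add0r, mulr1) in e00 e01 e02 e11 e12.
have cancel (h : k2) : kj x != - x -> kj x * h = - (h * x) -> h = 0.
  move=> nx E; apply/eqP; apply: contraNT nx => h0.
  by apply/eqP/(mulIf h0); rewrite E mulNr mulrC.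
have sx : kj x = - x.
  have [//|nx] := eqVneq (kj x) (- x); case/eqP: dH.
  by rewrite /H mx3_det (cancel a nx e00) (cancel b nx e01) (cancel e nx e11) rmorph0; ring.
have shift (u h : k2) : kj x * h = - (u + h * x) -> u = 0.
  by move=> E; rewrite -[u](addrK (h * x)) -[u + _]opprK -E sx; ring.
have b0 := shift _ _ e02; have e0 := shift _ _ e12.
have dE : \det H = - (a * (f * kj f)) by rewrite /H mx3_det b0 e0 rmorph0; ring.
rewrite dE oppr_eq0 !mulf_eq0 !negb_or in dH.
by have /and3P[a0 f0 _] := dH; split.
Qed.

Lemma redk_basis_comm (g B B' : 'M[O]_3) : g \in unitmx ->
  redk B *m redk g = redk g *m redk B -> B *m g = g *m B' -> redk B' = redk B.
Proof.
move=> ug c /(congr1 redk) e; rewrite (map_mxM _ B) (map_mxM _ g) /= c in e.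
have uk : redk g \in unitmx by rewrite -unitmx_redk.
by rewrite -[LHS](mulKmx uk) -e (mulKmx uk).
Qed.

(** Cramer's rule for the projection of e_1 onto the plane of e_2 and e_3; 1/w is the discriminant
    of the plane. *)
Lemma orthogonal_pair (r y y' z p q w : O) : w * (r * z - y' * y) = 1 ->
  let M := w * (p * z - q * y') in let N := w * (r * q - y * p) in
  p - M * r - N * y' = 0 /\ q - M * y - N * z = 0.
Proof.
move=> wE M N; split.
  by transitivity (p - w * (r * z - y' * y) * p); [rewrite /M /N; ring|rewrite wE; ring].
by transitivity (q - w * (r * z - y' * y) * q); [rewrite /M /N; ring|rewrite wE; ring].
Qed.

(** The new second basis vector is B e_3 without its e_3-component, which modulo pi is e_2. *)
Lemma nil_straighten (B : 'M[O]_3) x : redk B = mx3 x 0 0 0 x 1 0 0 x ->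
  exists g B', [/\ g \in unitmx, redk g = 1%:M, B *m g = g *m B' &
    B' i0 i2 = 0 /\ B' i1 i2 = 1].
Proof.
have [a [b [c [d [e [f [p [q [k BE]]]]]]]]] := mx3_surj B.
rewrite BE map_mx3 => /mx3_inj[[_ _ kc] [_ _ kf] _].
pose g := mx3 1 c 0 0 f 0 0 0 1.
have g1 : redk g = 1%:M by rewrite /g map_mx3 /= kc kf rmorph0 rmorph1 mx3_scalar.
have ug : g \in unitmx by rewrite unitmx_redk g1 unitmx1.
have [B' B'E] := basis_change (mx3 a b c d e f p q k) ug.
exists g, B'; split=> //; have [a' [b' [c' [d' [e' [f' [p' [q' [k' B'E']]]]]]]]] := mx3_surj B'.
move: B'E; rewrite B'E' /g !mx3M => /mx3_inj[[_ _ e0] [_ _ e1] [_ _ e2]].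
rewrite ?(mul0r, mulr0, addr0, add0r, mulr1, mul1r) in e0 e1 e2.
have [w wf] : exists w, w * f = 1 by apply: unit_of_kred; rewrite kf oner_neq0.
have f1 : f' = 1 by rewrite -[f']mul1r -wf -mulrA -e1 wf.
rewrite !mxE /=; split=> //.
by move/esym: e0; rewrite f1 mulr1 -[RHS]add0r => /addIr.
Qed.

(** The relation between U and V says that y and t have the same valuation: once e_1 is orthogonal
    to the plane, skewness ties the first row to the first column. *)
Lemma nil_branch H B : herm_form H -> skew_for H B ->
  (exists g x, g \in unitmx /\ redk B *m g = g *m mx3 x 0 0 0 x 1 0 0 x) ->
  exists g d t x g2 y g0 U V, [/\ g \in unitmx, cj d = - d,
    B *m g = g *m (d%:M + mx3 0 t 0 x g2 1 y g0 0),
    [/\ kred t = 0, kred x = 0, kred g2 = 0, kred y = 0 & kred g0 = 0] &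
    [/\ kred U != 0, kred V != 0 & U * cj y = V * t]].
Proof.
move=> hH sB [g0 [x [ug0 Bg0]]].
have [g gE] := redk_lift g0; have ug : g \in unitmx by rewrite unitmx_redk -gE.
have [B1 B1E] := basis_change B ug.
have [hH1 sB1] := skew_basis ug B1E hH sB.
have rB1 : redk B1 = mx3 x 0 0 0 x 1 0 0 x.
  have e := congr1 redk B1E; rewrite (map_mxM _ B) (map_mxM _ g) /= -gE Bg0 in e.
  by rewrite -[LHS](mulKmx ug0) -e (mulKmx ug0).
have [v [B2 [uv v1 B2E [c0 c1]]]] := nil_straighten rB1.
have [hH2 sB2] := skew_basis uv B2E hH1 sB1.
have rB2 := redk_basis v1 B2E; rewrite rB1 in rB2.
move: (star cj v *m _ *m v) hH2 sB2 => H2 hH2 sB2.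
have [E [p [q [r [y [z [HE sE sr sz]]]]]]] := herm_mx3 hH2.
have dH : \det (redk H2) != 0 by rewrite -unitfE -unitmxE -unitmx_redk (proj2 hH2).
have := skew_for_redk sB2; rewrite rB2.
rewrite HE map_mx3 /= -!kconj_red in dH * => /(kskew_nil dH)[kp kr kE ky].
have ky' : kred (cj y) != 0 by rewrite -kconj_red fmorph_eq0.
pose D := r * z - cj y * y.
have kD : kred D != 0.
  by rewrite /D rmorphB !rmorphM /= kr mul0r sub0r oppr_eq0 mulf_neq0.
have [w wD] := unit_of_kred kD; have [M0 N0] := orthogonal_pair p q wD.
move: M0 N0; set M := w * _; set N := w * _ => M0 N0.
have kN : kred N = 0 by rewrite /N rmorphM rmorphB !rmorphM /= kr kp mul0r mulr0 subrr mulr0.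
pose m := mx3 1 0 0 (- cj M) 1 0 (- cj N) 0 1.
have km : redk m = mx3 1 0 0 (- kred (cj M)) 1 0 0 0 1.
  have kcN : kred (cj N) = 0 by rewrite -kconj_red kN; exact: rmorph0.
  by rewrite /m map_mx3 !rmorphN /= kcN oppr0 rmorph0 rmorph1.
have um : m \in unitmx by rewrite /m mx3_unit (_ : _ + _ = 1) ?unitr1 //; ring.
have [B3 B3E] := basis_change B2 um.
have [hH3 sB3] := skew_basis um B3E hH2 sB2.
have rB3 : redk B3 = redk B2.
  apply: (redk_basis_comm um _ B3E); rewrite rB2 km !mx3M; congr mx3; ring.
rewrite rB2 in rB3.
have [E' H3E] : exists E', star cj m *m H2 *m m = mx3 E' 0 0 0 r y 0 (cj y) z.
  have M1 : cj p - cj M * r - cj N * y = 0.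
    by have := congr1 cj M0; rewrite !(cjD, cjN, cjM) conjK sr cj0.
  have N1 : cj q - cj M * cj y - cj N * z = 0.
    by have := congr1 cj N0; rewrite !(cjD, cjN, cjM) sz cj0.
  eexists; rewrite HE /m star_mx3 !mx3M !cjN !conjK cj0 cj1.
  congr mx3; try reflexivity; try ring.
  - by rewrite -[RHS]M0; ring.
  - by rewrite -[RHS]N0; ring.
  - by rewrite -[RHS]M1; ring.
  - by rewrite -[RHS]N1; ring.
have [d [t [c [s [e [f [u [h [k B3E']]]]]]]]] := mx3_surj B3.
have [cE fE] : c = 0 /\ f = 1.
  have [a2 [b2 [c2' [d2 [e2 [f2 [p2 [q2 [k2'' B2E']]]]]]]]] := mx3_surj B2.
  move: B3E c0 c1; rewrite B2E' B3E' /m !mx3M !mxE /= => /mx3_inj[[_ _ e0] [_ _ e1] _] c20 f21.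
  rewrite ?(mul0r, mulr0, addr0, add0r, mulr1, mul1r) c20 f21 in e0 e1.
  by rewrite -e0 in e1 *; rewrite mulr0 add0r in e1.
rewrite {}cE {}fE in B3E'.
move: hH3 sB3; rewrite H3E B3E' /skew_for star_mx3 => hH3 /(@block_skew _ cj)[ed et e0 _].
have kE' : kred E' != 0.
  have := proj2 hH3; rewrite mx3_unit unitOE.
  have -> : E' * (r * z - y * cj y) - 0 * (0 * z - y * 0) + 0 * (0 * cj y - r * 0) = E' * D.
    by rewrite /D; ring.
  by rewrite rmorphM mulf_eq0 negb_or => /andP[].
have [w' wE'] := unit_of_kred kE'.
have sd : cj d = - d.
  have Ed : E' * (cj d + d) = 0 by rewrite mulrDr -[E' * d]opprK -ed (mulrC E') subrr.
  by apply/eqP; rewrite -addr_eq0 -[_ + _]mul1r -wE' -mulrA Ed mulr0.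
move: rB3; rewrite B3E' map_mx3 => /mx3_inj[[kd kt _] [ks ke _] [ku kh kk]].
(* Adding a e_3 to e_2 clears the last diagonal entry. *)
pose a := k - d; have ka : kred a = 0 by rewrite /a rmorphB /= kk kd subrr.
pose n := mx3 1 0 0 0 1 0 0 a 1.
have un : n \in unitmx by rewrite /n mx3_unit (_ : _ + _ = 1) ?unitr1 //; ring.
exists (g *m v *m m *m n), d, t, s, (e - d + a), (u - s * a), (h - (e - d) * a).
exists (y * D), ((y + z * cj a) * E' * y); split.
- by rewrite !unitmx_mul ug uv um un.
- exact: sd.
- have e3 : B3 *m n = n *m (d%:M + mx3 0 t 0 s (e - d + a) 1 (u - s * a) (h - (e - d) * a) 0).
    by rewrite B3E' /n mx3_scalar mx3D !mx3M /a; congr mx3; ring.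
  rewrite B3E' in B3E e3.
  rewrite (mulmxA B) (mulmxA B) (mulmxA B) B1E -(mulmxA g B1) B2E (mulmxA g v).
  by rewrite -(mulmxA (g *m v) B2) B3E (mulmxA _ m) -(mulmxA (g *m v *m m) _ n) e3 !mulmxA.
- split=> //; first by rewrite rmorphD rmorphB /= ke kd ka subrr addr0.
    by rewrite rmorphB rmorphM /= ku ks mul0r subrr.
  by rewrite rmorphB rmorphM /= kh ka mulr0 subrr.
- split.
  + by rewrite rmorphM; apply: mulf_neq0; [exact: ky|exact: kD].
  + rewrite 2!rmorphM; apply: mulf_neq0; last exact: ky.
    apply: mulf_neq0; last exact: kE'.
    rewrite rmorphD rmorphM /=.
    have -> : kred (cj a) = 0 by rewrite -kconj_red ka; exact: rmorph0.
    by rewrite mulr0 addr0; exact: ky.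
  + have sy : cj s * y = - (cj u * z).
      by apply/eqP; rewrite -addr_eq0; apply/eqP; rewrite e0 mulr0 oppr0.
    rewrite cjD cjN cjM.
    transitivity (D * (cj u * y - cj s * y * cj a)); first by ring.
    rewrite sy; transitivity ((y + z * cj a) * (D * cj u)); first by ring.
    (* Elimination of conj s from the two skewness relations [et] and [e0]. *)
    have -> : D * cj u = E' * y * t.
      transitivity (- (y * (cj s * r + cj u * cj y)) + r * (cj s * y + cj u * z)).
        by rewrite /D; ring.
      by rewrite et e0; ring.
    by ring.
Qed.

End NilpotentBranch.

(** * Listed representatives for reductions x + E_23, and existence *)

Section ExistenceMain.
Variables (o : compact_dvr) (eps : nonsquare_unit o).
Hypothesis hodd : odd_residue_char o.
Local Notation O := (quadext eps).
Local Notation k2 := (residue_field eps).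
Local Notation cj := (@quadext_conj o eps).
Local Notation kj := (@kconj o eps).
Local Notation kred := (@kred o eps).
Local Notation pi := (qunif eps).
Local Notation Ored := (@Defs.Ored o eps).
Local Notation redm m := (map_mx (@Defs.Ored o eps m)).
Local Notation redk := (map_mx (@Defs.kred o eps)).

Lemma nil_form_plain (m : nat) (t x g2 y g0 : O) (p := pi ^+ m) : exists g,
  g \in unitmx /\ mx3 0 (p * t) 0 x g2 1 (p * y) (p * g0) 0 *m g =
    g *m mx_v (p * t) (p * y) (p * (g0 + t * x)) g2.
Proof.
have [g [ug e]] := nil_normal 0 (p * t) x g2 (p * y) (p * g0).
exists g; split; first exact: ug.
move: e; rewrite !mul0r oppr0 !addr0 => ->; congr (_ *m mx_v _ _ _ _).
by rewrite mulrDr mulrA.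
Qed.

(** For t and y of larger valuation than g0: [nil_twist] produces an entry p w with w congruent to -
    g0, a unit. With v the inverse of w, s = v r y is what fits the corner entry to the shape of
    [nil_normal]. *)
Lemma nil_form_twisted (m : nat) (t x g2 y g0 : O) (p := pi ^+ m) : (0 < m)%N ->
  kred x = 0 -> kred g2 = 0 -> kred t = 0 -> kred y = 0 -> kred g0 != 0 ->
  exists g w a1 b1 c, [/\ g \in unitmx,
    mx3 0 (p * t) 0 x g2 1 (p * y) (p * g0) 0 *m g = g *m mx_v (p * w) (p * a1) (p * b1) c,
    kred w != 0, kred c = 0 & kred b1 != 0].
Proof.
move=> m0 kx k2 kt ky kg.
have [r rx] : exists r, r * (1 + x) = 1.
  by apply: unit_of_kred; rewrite rmorphD rmorph1 /= kx addr0 oner_eq0.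
have [g [ug e]] := nil_twist (p * t) g2 (p * y) (p * g0) rx.
pose G := (1 + x) * g2 + p * y.
have kG : kred G = 0 by rewrite /G rmorphD rmorphM /= k2 mulr0 add0r /p kred_pi0.
pose w := (1 + x) * (t - g0) + G * r * y; pose b := (1 + x) * g0 - G * r * y.
have kb : kred b = kred g0.
  by rewrite /b rmorphB !rmorphM /= kG !mul0r subr0 rmorphD rmorph1 /= kx addr0 mul1r.
have kw : kred w = - kred g0.
  rewrite /w rmorphD !rmorphM /= kG !mul0r addr0 rmorphD rmorph1 /= kx addr0 mul1r.
  by rewrite rmorphB /= kt sub0r.
have [v vw] : exists v, v * w = 1 by apply: unit_of_kred; rewrite kw oppr_eq0.
have [h [uh f]] := nil_normal (v * r * y) (p * w) (x * r) (G * r) (r * (p * y)) (p * b).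
have e' : mx3 0 (p * t) 0 x g2 1 (p * y) (p * g0) 0 *m g = g *m
    mx3 (- (v * r * y * (p * w))) (p * w) 0 (x * r) (G * r) 1 (r * (p * y)) (p * b) 0.
  rewrite e; congr (g *m mx3 _ _ 0 _ _ 1 _ _ 0).
  - by transitivity (- (v * w * (r * (p * y)))); [rewrite vw mul1r|ring].
  - by rewrite /w /G; ring.
  - by rewrite /b /G; ring.
exists (g *m h), w, (r * y + v * r * y * b), (b + w * (x * r + v * r * y * (G * r))).
exists (G * r - v * r * y * (p * w)); split.
- by rewrite unitmx_mul ug.
- rewrite (mulmxA _ g) e' -(mulmxA g) f mulmxA; congr (_ *m mx_v _ _ _ _); ring.
- by rewrite kw oppr_eq0.
- by rewrite rmorphB !rmorphM /= kG ky mulr0 !mul0r subrr.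
- have kz : kred (x * r + v * r * y * (G * r)) = 0.
    by rewrite rmorphD !rmorphM /= kx ky mulr0 !mul0r addr0.
  by rewrite rmorphD rmorphM /= kz mulr0 addr0 kb.
Qed.

Variable s0 : forall n, oq o n -> o.
Hypothesis hs0 : forall n (x : oq o n), ored n (s0 x) = x.
Hypothesis hs0N : forall n (x : oq o n), s0 (- x) = - s0 x.
Local Notation is_rep := (is_rep s0).
Variable l : nat.
Local Notation has_listed := (has_listed s0 l).

Lemma listed_cyclic i d H B : (i < l)%N -> is_rep i d -> herm_form H -> skew_for H B ->
  (exists g, cyclic_basis (redk B) g) -> has_listed (d%:M + pi ^+ i *: B).
Proof.
move=> il rd hH sB /(cyclic_branch hodd hH sB)[g [c0 [c1 [c2 [ug e sc]]]]].
exists (d%:M + pi ^+ i *: comp3 c0 c1 c2); split.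
  right; right; right; left; exists i, (redm (l - i) (comp3 c0 c1 c2)).
  apply/(case_ivP hodd hs0 hs0N); exists d, c0, c1, c2; split=> //.
exact: conj_simO ug (conj_affine d (pi ^+ i) e).
Qed.

Lemma listed_nil_scalar i d e c : (i < l)%N -> is_rep i d -> cj e = - e -> cj c = - c ->
  kred c = 0 -> has_listed (d%:M + pi ^+ i *: (e%:M + mx_v 0 0 0 c)).
Proof.
move=> il rd se sc kc; have n0 : (0 < l - i)%N by rewrite subn_gt0.
have [e' [z [re eE _]]] := skew_rep hodd hs0 hs0N (l - i) se.
exists (d%:M + pi ^+ i *: (e'%:M + form_v 0 0 0 c)); split.
  do 4!right; left; apply/(case_v_lift hs0).
  exists i, d, (e'%:M + form_v 0 0 0 c); split=> //.
  by apply: (proj2 (subcase_IP hodd hs0 hs0N _ n0)); exists e', c; split.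
apply: (level_sim d (ltnW il)); apply: redm_simO; apply/redm_eqP; exists z%:M.
by rewrite eE raddfD /= scale_scalar_mx addrAC; reflexivity.
Qed.

Lemma listed_nil_form i d H e m a1 b1 c : (i < l)%N -> is_rep i d -> herm_form H ->
  (0 < m < l - i)%N -> cj e = - e -> skew_for H (e%:M + mx_v (pi ^+ m) (pi ^+ m * a1) (pi ^+ m * b1) c) ->
  kred c = 0 -> kred a1 != 0 \/ kred b1 != 0 ->
  has_listed (d%:M + pi ^+ i *: (e%:M + mx_v (pi ^+ m) (pi ^+ m * a1) (pi ^+ m * b1) c)).
Proof.
move=> il rd hH mn se sB kc nz; have /andP[m0 _] := mn.
have [e' [z [re eE sz]]] := skew_rep hodd hs0 hs0N m se.
have se' := is_rep_skew hodd hs0N re.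
have [g [ug f]] := form_v_translate (pi ^+ m) a1 b1 c z.
set a' := a1 - _ in f; set b' := _ - _ in f; set c' := c + _ in f.
have sB' : skew_for H ((pi ^+ m * z)%:M + mx_v (pi ^+ m) (pi ^+ m * a1) (pi ^+ m * b1) c).
  have := skew_sub se' sB; rewrite eE raddfD /=.
  by rewrite addrAC (addrAC e'%:M) subrr add0r.
have [hH' sF] := skew_basis ug f hH sB'.
have [sa sb sc] := form_v_skew_coef hodd hH' sF.
have kp x : kred (pi ^+ m * x) = 0 by apply: kred_pi0.
have kc' : kred c' = 0.
  by rewrite /c' rmorphD /= kc add0r -mulrA mulrCA kp.
have kb' : kred b' = kred b1.
  rewrite /b' !rmorphB !rmorphM rmorphD /= kc kp addr0 mulr0 subr0.
  by rewrite rmorphD /= kc addr0 -!mulrA mulrCA kp mulr0 subr0.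
have ka' : kred b1 = 0 -> kred a' = kred a1.
  move=> kb; rewrite /a' rmorphB rmorphM rmorphB /= kb rmorphM rmorphD /= kc kp addr0.
  by rewrite mulr0 subr0 mulr0 subr0.
have eM : d%:M + pi ^+ i *: (e%:M + mx_v (pi ^+ m) (pi ^+ m * a1) (pi ^+ m * b1) c) =
  (d + pi ^+ i * e')%:M + pi ^+ i *: ((pi ^+ m * z)%:M + mx_v (pi ^+ m) (pi ^+ m * a1) (pi ^+ m * b1) c).
  have -> : e%:M = e'%:M + (pi ^+ m * z)%:M :> 'M[O]_3 by rewrite eE raddfD.
  by rewrite -addrA level_scalar.
rewrite eM; apply: has_listed_sim (conj_simO l ug (conj_affine _ (pi ^+ i) f)) _.
rewrite -level_scalar; set N := _ + mx_v _ _ _ _.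
exists (d%:M + pi ^+ i *: N); split; last exact: redm_simO.
do 5!right; have [b0|b0] := eqVneq (kred b') 0.
  right; apply/(case_v_lift hs0); exists i, d, N; split; [exact: il|exact: rd| |reflexivity].
  apply: (proj2 (subcase_III1P hodd hs0 hs0N _ _)); exists m, e', a', b', c'.
  split; [exact: mn|exact: re|by split| |reflexivity]; split; [exact: kc'|exact: b0|].
  rewrite kb' in b0; rewrite (ka' b0).
  by case: nz => [ka|kb]; [exact: ka|move: kb; rewrite b0 eqxx].
left; apply/(case_v_lift hs0); exists i, d, N; split; [exact: il|exact: rd| |reflexivity].
apply: (proj2 (subcase_IIP hodd hs0 hs0N _ _)); exists m, e', a', b', c'.
by split; [exact: mn|exact: re|split|split|reflexivity].
Qed.

Lemma listed_nil i d H B : (i < l)%N -> is_rep i d -> herm_form H -> skew_for H B ->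
  (exists g x, g \in unitmx /\ redk B *m g = g *m mx3 x 0 0 0 x 1 0 0 x) ->
  has_listed (d%:M + pi ^+ i *: B).
Proof.
move=> il rd hH sB; have n0 : (0 < l - i)%N by rewrite subn_gt0.
move=> /(nil_branch hH sB)[g [e [t [x [g2 [y [g0 [U [V [ug se Bg ks [kU kV UV]]]]]]]]]]].
apply: has_listed_sim (conj_simO l ug (conj_affine d (pi ^+ i) Bg)) _.
have [hH' sB'] := skew_basis ug Bg hH sB.
have {ks} [kt kx kg ky kg0] := ks.
(* Only t and g0 are divided here, with 0 as filler: y follows t because U and V are units. *)
have [m [t' [g0' [z' [mn tE g0E zE nz]]]]] := content3 (l - i) t g0 0.
have {}zE : z' = 0 by apply: (@piXI _ eps m); rewrite -zE mulr0.
rewrite {}zE rmorph0 eqxx orbF in nz.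
have [y' [yE ky']] : exists y', y = pi ^+ m * y' /\ (kred y' != 0) = (kred t' != 0).
  have [u uU] := unit_of_kred kU; have kcu : kred (cj (u * V)) != 0.
    rewrite -kconj_red fmorph_eq0 rmorphM mulf_neq0 //.
    by apply: contraTneq (oner_neq0 k2) => u0; rewrite -(rmorph1 kred) -uU rmorphM /= u0 mul0r eqxx.
  exists (cj (u * V * t')); split.
    rewrite -[y]conjK -[cj y]mul1r -uU -mulrA UV tE.
    by rewrite (_ : u * _ = pi ^+ m * (u * V * t')); [rewrite cjM cjXpi|ring].
  rewrite cjM rmorphM mulf_eq0 negb_or kcu /=.
  by rewrite -kconj_red fmorph_eq0.
move: Bg hH' sB' nz; rewrite tE g0E yE => Bg hH' sB' nz.
have sK := skew_sub se sB'; rewrite addrAC subrr add0r in sK.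
(* If m = l - i, then t, y and g0 vanish to full precision, which is subcase (I). *)
case: (ltngtP m (l - i)) mn => // [mn _|mE _]; last first.
  have [h [uh f]] := nil_form_plain m t' x g2 y' g0'.
  have [hH2 sF] := skew_basis uh f hH' sK.
  have sg : cj g2 = - g2.
    have := skew_trace hH2 sF; rewrite mx3_trace !add0r; exact.
  have f' := conj_affine e 1 f; rewrite !scale1r in f'.
  apply: has_listed_sim (conj_simO l uh (conj_affine d (pi ^+ i) f')) _.
  apply: has_listed_sim (listed_nil_scalar il rd se sg kg).
  apply: (level_sim d (ltnW il)); apply: redm_simO; apply/redm_eqP.
  exists (mx3 0 t' 0 0 0 0 y' (g0' + t' * x) 0).
  by rewrite -addrA /mx_v mx3Z mx3D mE; congr (_ + mx3 _ _ _ _ _ _ _ _ _); ring.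
have {}nz := nz mn; have m0 : (0 < m)%N.
  case: (m) tE g0E nz => // tE' g0E'; rewrite expr0 !mul1r in tE' g0E'.
  by rewrite -tE' -g0E' kt kg0 !eqxx.
have [h [w [a1 [b1 [c [uh f kw [kc ab]]]]]]] : exists h w a1 b1 c, [/\ h \in unitmx,
    mx3 0 (pi ^+ m * t') 0 x g2 1 (pi ^+ m * y') (pi ^+ m * g0') 0 *m h =
      h *m mx_v (pi ^+ m * w) (pi ^+ m * a1) (pi ^+ m * b1) c,
    kred w != 0 & kred c = 0 /\ (kred a1 != 0 \/ kred b1 != 0)].
  (* If t' is a unit, so is y', which becomes a1. Otherwise g0' is a unit, and the twist is needed
     to bring entry (1, 2) to valuation m. *)
  have [kt'|kt'] := eqVneq (kred t') 0; last first.
    have [h [uh f]] := nil_form_plain m t' x g2 y' g0'.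
    exists h, t', y', (g0' + t' * x), g2; split; [exact: uh|exact: f|exact: kt'|].
    by split; [exact: kg|left; rewrite ky'].
  have ky0 : kred y' = 0 by apply/eqP; rewrite -[_ == _]negbK ky' kt' eqxx.
  rewrite kt' eqxx /= in nz.
  have [h [w [a1 [b1 [c [uh f kw kc kb]]]]]] := nil_form_twisted m0 kx kg kt' ky0 nz.
  by exists h, w, a1, b1, c; split; [exact: uh|exact: f|exact: kw|split; [exact: kc|right]].
have [h' [uh' f']] := @form_v_rescale O w (pi ^+ m) (pi ^+ m * a1) (pi ^+ m * b1) c kw.
rewrite (mulrCA w) in f'.
have ff : mx3 0 (pi ^+ m * t') 0 x g2 1 (pi ^+ m * y') (pi ^+ m * g0') 0 *m (h *m h') =
    (h *m h') *m mx_v (pi ^+ m) (pi ^+ m * (w * a1)) (pi ^+ m * b1) c.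
  by rewrite mulmxA f -[LHS](mulmxA h) f' (mulmxA h).
have uhh : h *m h' \in unitmx by rewrite unitmx_mul uh.
have f1 := conj_affine e 1 ff; rewrite !scale1r in f1.
apply: has_listed_sim (conj_simO l uhh (conj_affine d (pi ^+ i) f1)) _.
have [hH2 sF] := skew_basis uhh f1 hH' sB'.
apply: listed_nil_form il rd hH2 _ se sF kc _; first by rewrite m0.
case: ab => [ka|kb]; [left|by right].
by rewrite rmorphM mulf_neq0.
Qed.

Theorem existence (H M : 'M[O]_3) : herm_form H -> skew_for H M -> has_listed M.
Proof.
move=> hH sM; case: (level_decomp hodd hs0 hs0N l hH sM) => [[d sd e]|].
  have [d' [z [rd dE _]]] := skew_rep hodd hs0 hs0N l sd.
  exists d'%:M; split; first by left; apply/(case_iP hodd hs0 hs0N); exists d'.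
  apply: redm_simO; rewrite e; apply/redm_eqP; exists z%:M.
  by rewrite dE raddfD /= scale_scalar_mx.
move=> [i [d [B [il rd sB nB ->]]]].
have nB' x : redk B <> x%:M.
  move=> Bx; apply: nB; have [y yE] := kred_surj x; exists y.
  have /redk_eqP[Z ->] : redk B = redk y%:M by rewrite Bx yE map_scalar_mx.
  by apply/redm_eqP; exists Z; rewrite expr1.
case: (nonscalar_trichotomy nB') => br.
- exact: listed_cyclic il rd hH sB br.
- exact: (listed_tau hodd hs0 hs0N il rd hH sB br).
- exact: listed_nil il rd hH sB br.
Qed.

End ExistenceMain.

(** * The classification *)

Section Classification.
Variables (o : compact_dvr) (eps : nonsquare_unit o).
Hypothesis hodd : odd_residue_char o.
Local Notation O := (quadext eps).
Local Notation k2 := (residue_field eps).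
Local Notation cj := (@quadext_conj o eps).
Local Notation kj := (@kconj o eps).
Local Notation kred := (@kred o eps).
Local Notation pi := (qunif eps).
Local Notation Ored := (@Defs.Ored o eps).
Local Notation redm m := (map_mx (@Defs.Ored o eps m)).
Local Notation redk := (map_mx (@Defs.kred o eps)).
Variable s0 : forall n, oq o n -> o.
Hypothesis hs0 : forall n (x : oq o n), ored n (s0 x) = x.
Hypothesis hs0N : forall n (x : oq o n), s0 (- x) = - s0 x.
Local Notation is_rep := (is_rep s0).
Variable l : nat.
Hypothesis l0 : (0 < l)%N.
Local Notation nf := (nf s0 l).
Local Notation listed := (listed eps s0 l).

Definition skewable (M : 'M[O]_3) : Prop := exists H, herm_form H /\ skew_for H M.

Lemma skewable_affine i d B : cj d = - d -> skewable B -> skewable (d%:M + pi ^+ i *: B).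
Proof.
by move=> sd [H [hH sB]]; exists H; split; [exact: hH|exact: skew_for_affine].
Qed.

Lemma herm1 : herm_form (1%:M : 'M[O]_3).
Proof. by split; [exact: star1|exact: unitmx1]. Qed.

Lemma form_iii_skewable a p b0 b1 : cj a = - a -> cj p = p -> cj b0 = b0 -> cj b1 = - b1 ->
  skewable (form_iii a p b0 b1).
Proof.
move=> sa sp sb0 sb1; exists (herm_iii b1); split; first exact: (herm_iiiP sb1).
exact: form_iii_skew.
Qed.

Lemma form_v_skewable mu a1 b1 c : (0 < mu)%N -> cj a1 = - a1 -> cj b1 = b1 -> cj c = - c ->
  kred c = 0 -> kred a1 != 0 \/ kred b1 != 0 ->
  skewable (form_v (pi ^+ mu) (pi ^+ mu * a1) (pi ^+ mu * b1) c).
Proof.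
move=> m0 sa sb sc kc ab; have kp : kred (pi ^+ mu) = 0 by rewrite -[pi ^+ mu]mulr1 kred_pi0.
have sp := cjXpi eps mu.
suff [q [sq kq]] : exists q, cj q = q /\ kred (a1 * dlt eps - b1 * q) != 0.
  exists (herm_v (pi ^+ mu) a1 b1 c q); split; first exact: herm_vP sp sa sb sc sq kp kc kq.
  exact: form_v_skew.
have [ka|ka] := eqVneq (kred a1) 0.
  have kb : kred b1 != 0 by case: ab => //; rewrite ka eqxx.
  by exists 1; rewrite cj1 mulr1 rmorphB rmorphM /= ka mul0r sub0r oppr_eq0.
exists 0; rewrite cj0 mulr0 subr0 rmorphM mulf_neq0 //; exact: kdlt_neq0.
Qed.

Lemma nf4_level i d B mu e a1 b1 c : (i < l)%N -> (0 < mu <= l - i)%N -> is_rep i d ->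
  is_rep mu e -> cj a1 = - a1 -> cj b1 = b1 -> cj c = - c -> kred c = 0 ->
  kred a1 != 0 \/ kred b1 != 0 ->
  redm (l - i) B = redm (l - i) (e%:M + form_v (pi ^+ mu) (pi ^+ mu * a1) (pi ^+ mu * b1) c) ->
  exists N, [/\ nf N, redm l (d%:M + pi ^+ i *: B) = redm l N & skewable N].
Proof.
move=> il mn rd re sa sb sc kc ab BE; have /andP[m0 _] := mn.
exists ((d + pi ^+ i * e)%:M +
   pi ^+ i *: form_v (pi ^+ mu) (pi ^+ mu * a1) (pi ^+ mu * b1) c); split.
- apply: Or44; exists i, d, mu, e, a1, b1, c.
  by split; [split|split|split|exact: kc|reflexivity].
- rewrite -level_scalar; have lE : (i + (l - i))%N = l by rewrite subnKC // ltnW.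
  by have := redm_affine i d BE; rewrite lE.
- apply: skewable_affine; last exact: form_v_skewable.
  have sd := is_rep_skew hodd hs0N rd; have se := is_rep_skew hodd hs0N re.
  by rewrite cjD cjM cjXpi sd se mulrN opprD.
Qed.

Lemma listed_nf M : listed M -> exists N, [/\ nf N, M = redm l N & skewable N].
Proof.
case=> [/(case_iP hodd hs0 hs0N)[d rd ->]|].
  exists d%:M; split=> //; first by apply: Or41; exists d.
  exists 1%:M; split; first exact: herm1.
  rewrite /skew_for star_scalar (is_rep_skew hodd hs0N rd) mulmx1 mul1mx.
  by rewrite raddfN.
case=> [/(case_iiP hodd hs0 hs0N)[i [d [a [il rd sa ka ->]]]]|].
  exists (d%:M + pi ^+ i *: form_iii a (pi ^+ (l - i)) 0 0); split.
  - apply: Or42; exists i, l, d, a, 0, 0; split; [by rewrite il leqnn|exact: rd|by split|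
      by rewrite cj0 oppr0|reflexivity].
  - have lE : (i + (l - i))%N = l by rewrite subnKC // ltnW.
    have h : redm (l - i) (form_ii a) = redm (l - i) (form_iii a (pi ^+ (l - i)) 0 0).
      apply/redm_eqP; exists (mx3 0 0 0 0 0 0 0 (- 1) 0).
      by rewrite /form_iii mx3Z mx3D /form_ii; congr mx3; ring.
    by have := redm_affine i d h; rewrite lE.
  - apply: skewable_affine (is_rep_skew hodd hs0N rd) _.
    by apply: form_iii_skewable => //; rewrite ?cjXpi ?cj0 ?oppr0.
case=> [[j [C /(case_iiiP hodd hs0 hs0N)]]|].
  move=> [i [d [a [b0 [b1 [[ij jl rd] [sa ka] [sb0 sb1] _ ->]]]]]].
  exists (d%:M + pi ^+ i *: form_iii a (pi ^+ (j - i)) b0 b1); split; [|reflexivity|].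
    apply: Or42; exists i, j, d, a, b0, b1.
    by split; [rewrite ij ltnW|exact: rd|split|split|reflexivity].
  apply: skewable_affine (is_rep_skew hodd hs0N rd) _.
  by apply: form_iii_skewable => //; rewrite cjXpi.
case=> [[i [C /(case_ivP hodd hs0 hs0N)]]|].
  move=> [d [c0 [c1 [c2 [il rd [sc0 sc1 sc2] _ ->]]]]].
  exists (d%:M + pi ^+ i *: comp3 c0 c1 c2); split; [|reflexivity|].
    apply: Or43; exists i, d, c0, c1, c2.
    by split; [exact: il|exact: rd|split|reflexivity].
  apply: skewable_affine (is_rep_skew hodd hs0N rd) _.
  by exists (herm_iv c1 c2); apply: form_iv_skew.
have level i B d mu e a1 b1 c : (i < l)%N -> is_rep i d -> (0 < mu <= l - i)%N ->
  is_rep mu e -> [/\ cj a1 = - a1, cj b1 = b1 & cj c = - c] -> kred c = 0 ->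
  kred a1 != 0 \/ kred b1 != 0 ->
  redm (l - i) B = redm (l - i) (e%:M + form_v (pi ^+ mu) (pi ^+ mu * a1) (pi ^+ mu * b1) c) ->
  M = redm l (d%:M + pi ^+ i *: B) -> exists N, [/\ nf N, M = redm l N & skewable N].
  move=> il rd mn re [sa sb sc] kc ab BE ->.
  have [N [nN NE sN]] := nf4_level il mn rd re sa sb sc kc ab BE.
  by exists N; split; [exact: nN|exact: NE|exact: sN].
case=> [/(case_v_lift hs0)[i [d [B [il rd /(subcase_IP hodd hs0 hs0N) IB ME]]]]|].
  have n0 : (0 < l - i)%N by rewrite subn_gt0.
  have [e [c [re sc kc BE]]] := IB n0.
  (* For mu = l - i the entries with pi^mu vanish, so a1 can be chosen freely; the unit delta makes
     the adapted form non-degenerate. *)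
  apply: (level i B d (l - i)%N e (dlt eps) 0 c il rd _ re _ kc _ _ ME).
  - by rewrite n0 leqnn.
  - by split; [exact: conj_dlt|exact: cj0|].
  - left; exact: kdlt_neq0.
  - rewrite BE; apply/redm_eqP; exists (mx3 0 (- 1) 0 0 0 0 (- dlt eps) 0 0).
    by rewrite -addrA /form_v mx3Z mx3D; congr (_ + mx3 _ _ _ _ _ _ _ _ _); ring.
case=> /(case_v_lift hs0)[i [d [B [il rd PB ME]]]].
  have [mu [e [a1 [b1 [c [/andP[m0 mn] re sabc [kc kb] BE]]]]]] := (subcase_IIP hodd hs0 hs0N _ _).1 PB.
  apply: (level i B d mu e a1 b1 c il rd _ re sabc kc _ BE ME); last by right.
  by rewrite m0 ltnW.
have [mu [e [a1 [b1 [c [/andP[m0 mn] re sabc [kc kb ka] BE]]]]]] := (subcase_III1P hodd hs0 hs0N _ _).1 PB.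
apply: (level i B d mu e a1 b1 c il rd _ re sabc kc _ BE ME); last by left.
by rewrite m0 ltnW.
Qed.

Lemma listed_gu3 M : listed M -> exists A, gu3 eps l A /\ GL_similar M A.
Proof.
move=> /listed_nf[N [_ -> [H [hH sN]]]]; have [K [uK _ sA]] := skew_conj hodd hH sN.
exists (redm l (K *m N *m invmx K)); split; first exact: gu3_redm.
apply/(GL_similarP l0); exists (invmx K); split; first by rewrite unitmx_inv.
by rewrite !mulmxA (mulVmx uK) mul1mx.
Qed.

Lemma listed_unique M M' : listed M -> listed M' -> GL_similar M M' -> M = M'.
Proof.
move=> /listed_nf[N [nN -> _]] /listed_nf[N' [nN' -> _]] /(GL_similarP l0) h.
by apply: (nf_unique hodd hs0) nN nN' h.
Qed.

Lemma gu3_listed A : gu3 eps l A -> exists M, listed M /\ GL_similar A M.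
Proof.
move=> /(gu3_lift hodd)[A' [sA ->]].
have sk : skew_for 1%:M A' by rewrite /skew_for mulmx1 mul1mx.
have [N [lN h]] := existence hodd hs0 hs0N l herm1 sk.
by exists (redm l N); split; [exact: lN|apply/(GL_similarP l0)].
Qed.

Lemma associated_bij : set_bij listed (Ad_orbits eps l) (associated_class eps l).
Proof.
split.
- move=> M /listed_gu3[A [gA MA]]; exists A; first exact: gA.
  by rewrite (class_orbit hodd l0 gA MA).
- move=> M M' /set_mem lM /set_mem lM' e; have [A [gA MA]] := listed_gu3 lM.
  have : associated_class eps l M A by split; [exact: GL_similar_sym MA|exact: gA].
  rewrite e => -[AM' _]; exact: (listed_unique lM lM' (GL_similar_trans MA AM')).
- move=> _ [A gA <-]; have [M [lM AM]] := gu3_listed gA.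
  exists M; first exact: lM.
  exact: (class_orbit hodd l0 gA (GL_similar_sym AM)).
Qed.

Lemma listed_exists_unique (X : 'M[Oq eps l]_3) : sim_class X `&` gu3 eps l !=set0 ->
  exists! M, listed M /\ sim_class X M.
Proof.
move=> [A [AX gA]]; have [M [lM AM]] := gu3_listed gA.
have MX := GL_similar_trans (GL_similar_sym AM) AX.
exists M; split=> [|M' [lM' M'X]]; first by split; [exact: lM|exact: MX].
exact: (listed_unique lM lM' (GL_similar_trans MX (GL_similar_sym M'X))).
Qed.

(** The eigenvalue s is quantified rather than taken from the matrix, so that the type depends on C
    alone. *)
Definition type_iii n (C : 'M[Oq eps n]_2) T : Prop :=
  let b0 := kres_of (- C 0 1) in let b1 := kres_of (- C 1 1) in
  exists s : k2, [/\ kj s = - s, s ^+ 2 + b1 * s + b0 != 0,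
    List.In T [:: TypeT1; TypeT2; TypeM] &
    min_poly_of_type kj T (cubic (- (s * b0)) (b0 - s * b1) (b1 - s))].

Lemma type_iii_ex (b0 b1 : k2) : kj b1 = - b1 -> kj b0 = b0 ->
  exists T s, [/\ kj s = - s, s ^+ 2 + b1 * s + b0 != 0,
    List.In T [:: TypeT1; TypeT2; TypeM] &
    min_poly_of_type kj T (cubic (- (s * b0)) (b0 - s * b1) (b1 - s))].
Proof.
move=> sb1 sb0; have [r1 [r2 [b1E b0E rr]]] := quadratic_roots hodd sb1 sb0.
have [s [ss s1 s2]] := skew_avoiding hodd r1 r2.
have [T inT mT] := root_pair_type ss rr s1 s2; exists T, s; split=> //.
  have -> : s ^+ 2 + b1 * s + b0 = (s - r1) * (s - r2) by rewrite b1E b0E; ring.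
  by rewrite mulf_neq0 // subr_eq0.
move: mT; rewrite -cubic_roots b0E b1E.
by congr (min_poly_of_type _ _ (cubic _ _ _)); ring.
Qed.

Definition type_iv n (C : 'M[Oq eps n]_3) T : Prop :=
  List.In T [:: TypeT1; TypeT2; TypeT3; TypeM; TypeN] /\
  min_poly_of_type kj T
    (cubic (kres_of (- C i0 i2)) (kres_of (- C i1 i2)) (kres_of (- C i2 i2))).

(** Choice turns the existence of a type into a function of C; the default [TypeG] is not reached
    for any C that occurs. *)
Definition choose_type (P : shadow_type -> Prop) : shadow_type :=
  if pselect (exists T, P T) is left h then sval (cid h) else TypeG.

Lemma choose_typeP (P : shadow_type -> Prop) T : P T -> P (choose_type P).
Proof.
move=> PT; rewrite /choose_type; case: pselect => [h|[]]; last by exists T.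
exact: svalP (cid h).
Qed.

Lemma case_iii_shadow j C M : case_iii eps s0 l j C M ->
  let T := choose_type (@type_iii (l - j) C) in
  List.In T [:: TypeT1; TypeT2; TypeM] /\ shadow_has_type (associated_class eps l M) T.
Proof.
move=> /(case_iiiP hodd hs0 hs0N)[i [d [a [b0 [b1 [[ij jl rd] [sa ka] [sb0 sb1] CE ->]]]]]].
have n0 : (0 < l - j)%N by rewrite subn_gt0.
have C0 : kres_of (- C 0 1) = kred b0 by rewrite CE mxE /= opprK kres_of_red.
have C1 : kres_of (- C 1 1) = kred b1 by rewrite CE mxE /= opprK kres_of_red.
have [] := @type_iii_ex (kred b0) (kred b1); [by rewrite kconj_red sb1 rmorphN|by rewrite kconj_red sb0|].
move=> T0; rewrite -C0 -C1 => hT0 T; have [s] : type_iii C T by apply: (choose_typeP (T := T0)).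
rewrite C0 C1 => -[ss qs inT mT]; split; first exact: inT.
have sd := is_rep_skew hodd hs0N rd; have il := ltn_trans ij jl.
apply: (form_iii_shadow hodd il _ sd sa ka sb0 sb1 ss qs mT).
by rewrite subn_gt0 ij; apply: ltn_sub2r.
Qed.

Lemma case_iv_shadow i C M : case_iv eps s0 l i C M ->
  let T := choose_type (@type_iv (l - i) C) in
  List.In T [:: TypeT1; TypeT2; TypeT3; TypeM; TypeN] /\
  shadow_has_type (associated_class eps l M) T.
Proof.
move=> /(case_ivP hodd hs0 hs0N)[d [c0 [c1 [c2 [il rd [sc0 sc1 sc2] CE ->]]]]].
have n0 : (0 < l - i)%N by rewrite subn_gt0.
have C0 : kres_of (- C i0 i2) = kred c0 by rewrite CE /comp3 map_mx3 mxE /= rmorphN opprK kres_of_red.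
have C1 : kres_of (- C i1 i2) = kred c1 by rewrite CE /comp3 map_mx3 mxE /= rmorphN opprK kres_of_red.
have C2 : kres_of (- C i2 i2) = kred c2 by rewrite CE /comp3 map_mx3 mxE /= rmorphN opprK kres_of_red.
have [] := @cubic_type _ _ hodd (kred c0) (kred c1) (kred c2).
- by rewrite kconj_red sc0 rmorphN.
- by rewrite kconj_red sc1.
- by rewrite kconj_red sc2 rmorphN.
move=> T0 inT0 mT0 T; have [inT] : type_iv C T.
  by apply: (choose_typeP (T := T0)); rewrite /type_iv C0 C1 C2.
rewrite C0 C1 C2 => mT; split; first exact: inT.
exact: (form_iv_shadow hodd il (is_rep_skew hodd hs0N rd) sc0 sc1 sc2 mT).
Qed.

Lemma level_merge i d e (B F : 'M[O]_3) : (i < l)%N -> redm (l - i) B = redm (l - i) (e%:M + F) ->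
  redm l (d%:M + pi ^+ i *: B) = redm l ((d + pi ^+ i * e)%:M + pi ^+ i *: F).
Proof.
move=> il /(redm_affine i d); rewrite subnKC ?level_scalar => [->|]; [reflexivity|exact: ltnW].
Qed.

Lemma level_skew i d n e : is_rep i d -> is_rep n e -> cj (d + pi ^+ i * e) = - (d + pi ^+ i * e).
Proof.
move=> /(is_rep_skew hodd hs0N) sd /(is_rep_skew hodd hs0N) se.
by rewrite cjD cjM cjXpi sd se mulrN opprD.
Qed.

Lemma subcase_I_shadow M : case_v eps s0 l (subcase_I eps) M ->
  shadow_has_type (associated_class eps l M) TypeJ.
Proof.
move=> /(case_v_lift hs0)[i [d [B [il rd PB ->]]]]; have n0 : (0 < l - i)%N by rewrite subn_gt0.
have [e [c [re sc kc BE]]] := (subcase_IP hodd hs0 hs0N _ n0).1 PB.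
rewrite (level_merge d il BE).
exact: (form_I_shadow hodd il (level_skew rd re) sc kc).
Qed.

Lemma subcase_II_shadow M : case_v eps s0 l (subcase_II eps s0) M ->
  shadow_has_type (associated_class eps l M) TypeM.
Proof.
move=> /(case_v_lift hs0)[i [d [B [il rd PB ->]]]].
have [mu [e [a1 [b1 [c [mn re [sa sb sc] [kc kb] BE]]]]]] := (subcase_IIP hodd hs0 hs0N _ _).1 PB.
rewrite (level_merge d il BE).
have := form_v_shadow hodd il mn (level_skew rd re) sa sb sc kc (or_intror kb).
by rewrite (negPf kb).
Qed.

Lemma subcase_III1_shadow M : case_v eps s0 l (subcase_III1 eps s0) M ->
  shadow_has_type (associated_class eps l M) TypeN.
Proof.
move=> /(case_v_lift hs0)[i [d [B [il rd PB ->]]]].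
have [mu [e [a1 [b1 [c [mn re [sa sb sc] [kc kb ka] BE]]]]]] := (subcase_III1P hodd hs0 hs0N _ _).1 PB.
rewrite (level_merge d il BE).
have := form_v_shadow hodd il mn (level_skew rd re) sa sb sc kc (or_introl ka).
by rewrite kb eqxx.
Qed.

Lemma case_i_shadow M : case_i eps l M -> shadow_has_type (associated_class eps l M) TypeG.
Proof.
move=> /(case_iP hodd hs0 hs0N)[d rd ->].
exact: (scalar_shadow hodd l0 (is_rep_skew hodd hs0N rd)).
Qed.

Lemma case_ii_shadow M : case_ii eps s0 l M -> shadow_has_type (associated_class eps l M) TypeL.
Proof.
move=> /(case_iiP hodd hs0 hs0N)[i [d [a [il rd sa ka ->]]]].
exact: (form_ii_shadow hodd il (is_rep_skew hodd hs0N rd) sa ka).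
Qed.

End Classification.

Theorem theorem3p14 (o : compact_dvr) (hodd : odd_residue_char o)
    (eps : nonsquare_unit o)
    (s0 : forall n, oq o n -> o)
    (hs0 : forall n (x : oq o n), ored n (s0 n x) = x)
    (hs0N : forall n (x : oq o n), s0 n (- x) = - s0 n x)
    (l : nat) (hl : (0 < l)%N) :
  (* every listed matrix is conjugate to an anti-hermitian one *)
  (forall M, listed eps s0 l M ->
     exists A, gu3 eps l A /\ GL_similar M A) /\
  (* every similarity class meeting gu_3 contains exactly one listed matrix *)
  (forall X : 'M[Oq eps l]_3, sim_class X `&` gu3 eps l !=set0 ->
     exists! M, listed eps s0 l M /\ sim_class X M) /\
  (* the list parametrises the Ad(GU_3(o))-orbits on gu_3 *)
  set_bij (listed eps s0 l) (Ad_orbits eps l) (associated_class eps l) /\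
  (* the types of the associated unitary shadows *)
  (forall M, case_i eps l M ->
     shadow_has_type (associated_class eps l M) TypeG) /\
  (forall M, case_ii eps s0 l M ->
     shadow_has_type (associated_class eps l M) TypeL) /\
  (exists T : forall n, 'M[Oq eps n]_2 -> shadow_type,
     forall j C M, case_iii eps s0 l j C M ->
       List.In (T (l - j)%N C) [:: TypeT1; TypeT2; TypeM] /\
       shadow_has_type (associated_class eps l M) (T (l - j)%N C)) /\
  (exists T : forall n, 'M[Oq eps n]_3 -> shadow_type,
     forall i C M, case_iv eps s0 l i C M ->
       List.In (T (l - i)%N C) [:: TypeT1; TypeT2; TypeT3; TypeM; TypeN] /\
       shadow_has_type (associated_class eps l M) (T (l - i)%N C)) /\
  (forall M, case_v eps s0 l (subcase_I eps) M ->
     shadow_has_type (associated_class eps l M) TypeJ) /\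
  (forall M, case_v eps s0 l (subcase_II eps s0) M ->
     shadow_has_type (associated_class eps l M) TypeM) /\
  (forall M, case_v eps s0 l (subcase_III1 eps s0) M ->
     shadow_has_type (associated_class eps l M) TypeN).
Proof.
split; first exact: (listed_gu3 hodd hs0 hs0N hl).
split; first exact: (listed_exists_unique hodd hs0 hs0N hl).
split; first exact: (associated_bij eps hodd hs0 hs0N hl).
split; first exact: (case_i_shadow hodd hs0 hs0N hl).
split; first exact: (case_ii_shadow hodd hs0 hs0N).
split; first by exists (fun n C => choose_type (@type_iii o eps n C)); exact: (case_iii_shadow hodd hs0 hs0N).
split; first by exists (fun n C => choose_type (@type_iv o eps n C)); exact: (case_iv_shadow hodd hs0 hs0N).
split; first exact: (subcase_I_shadow hodd hs0 hs0N).
split; first exact: (subcase_II_shadow hodd hs0 hs0N).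
exact: (subcase_III1_shadow hodd hs0 hs0N).
Qed.
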